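(* Let $(f,\mathcal{X},\nu)$ be a non-uniformly expanding system whose ergodic invariant measure $\nu$ has density $\rho\in L^{1+\delta}(m)$ for some $\delta>0$. For $\tilde{x}\in\mathcal{X}$ let $\phi(x)=-\log(\operatorname{dist}(x,\tilde{x}))$, let $u_n=\frac{u}{d}+\frac{\log n}{d}$ (with $u\in\mathbb{R}$ fixed), and let $M_n$, $G_{\sqrt n}(u)$ be the associated maximum and comparison function defined in the context. 1. Suppose there exist $\theta_0\in(0,1)$, $\beta\in(0,1]$ and a monotonically decreasing sequence $\Theta(j)\to0$ with $\Theta(n)=O(\theta_0^{n^{\beta}})$ such that for all Lipschitz $\varphi_1$ and all $\varphi_2\in L^\infty$, $$\left|\int\varphi_1\cdot\varphi_2\circ f^j\,d\nu-\int\varphi_1\,d\nu\int\varphi_2\,d\nu\right|\le\Theta(j)\|\varphi_1\|_{\mathrm{Lip}}\|\varphi_2\|_{L^\infty}.$$ Suppose also that there exist constants $\gamma>1$, $\alpha>0$, $C>0$ such that $\tilde g(n)\sim(\log n)^\gamma$ implies $\nu(E_n)\le C(\log n)^{-\alpha}$, and that $\gamma\beta>1$. Then there is a constant $C_2>0$, depending on $\delta$, such that for $\nu$-a.e. $\tilde{x}\in\mathcal{X}$ and any $\kappa>C_2/\beta$, $$\left|\nu\{M_n\le u_n\}-G_{\sqrt n}(u)\right|\le\frac{C_1}{(\log n)^{\alpha-\kappa}},$$ where $C_1>0$ depends on $\tilde{x}$. 2. Suppose there exist $\theta_0\in(0,1)$, $\beta\in(0,1]$ and a monotonically decreasing sequence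 $\Theta(j)\to0$ with $\Theta(n)=O(\theta_0^{n^{\beta}})$ such that for all Lipschitz $\varphi_1$ and all $\varphi_2\in L^\infty$, $$\left|\int\varphi_1\cdot\varphi_2\circ f^j\,d\nu-\int\varphi_1\,d\nu\int\varphi_2\,d\nu\right|\le\Theta(j)\|\varphi_1\|_{\mathrm{Lip}}\|\varphi_2\|_{L^\infty}.$$ Suppose also that there exist constants $\gamma>1$, $\alpha\in(0,1)$, $C>0$ such that $\tilde g(n)\sim(\log n)^\gamma$ implies $\nu(E_n)\le C\exp\{-(\log n)^\alpha\}$, and that $\gamma\beta>1$. Then there exists $\tilde\alpha>0$ such that for $\nu$-a.e. $\tilde{x}\in\mathcal{X}$, $$\left|\nu\{M_n\le u_n\}-G_{\sqrt n}(u)\right|\le C_1\exp\{-(\log n)^{\tilde\alpha}\},$$ where $C_1$ depends on $\tilde{x}$. Furthermore, in these cases, for $\nu$-a.e. $\tilde{x}\in\mathcal{X}$ there exists $C(\tilde{x})>0$ such that $$\lim_{n\to\infty}\nu\{M_n\le u_n\}=\exp\{-C(\tilde{x})e^{-u}\}.$$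
   Context: $\mathcal{X}$ is a $d$-dimensional Riemannian manifold with Riemannian distance $\operatorname{dist}$ and Riemannian volume $m$; $f:\mathcal{X}\to\mathcal{X}$ is measurable; $\nu$ is an $f$-invariant probability measure supported on a compact invariant set. The system $(f,\mathcal{X},\nu)$ is called non-uniformly expanding if $\nu$ is absolutely continuous with respect to $m$ and there is $\lambda_0>0$ such that for $\nu$-a.e. $x$ and all (nonzero) $v\in T_x\mathcal{X}$, $\lim_{n\to\infty}\frac1n\log\|Df^n(x)v\|\ge\lambda_0$. Given the observable $\phi$, put $X_i=\phi\circ f^{i-1}$ ($i\ge1$) and $M_n=\max(X_1,\dots,X_n)$. Given $u_n$, put $$\tau_n(u)=n\,\nu\{x:\phi(x)\ge u_n\},\qquad G_{\sqrt n}(u)=\left(1-\frac{\tau_n(u)}{\sqrt n}\right)^{\sqrt n}.$$ Bounds are asymptotic: $u$ is fixed and $n$ is sufficiently large. Recurrence sets: for a monotonically increasing $\tilde g:\mathbb{N}\to\mathbb{R}$, $$E_n=\{x\in\mathcal{X}:\operatorname{dist}(x,f^jx)\le n^{-1/d}\text{ for some integer }j\in[1,\tilde g(n)]\}.$$ $\|\cdot\|_{\mathrm{Lip}}$ denotes the Lipschitz norm. Here $a_n\sim b_n$ means $a_n/b_n\to1$. *)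

(* Defs.v *)
From HB Require Import structures.
From mathcomp Require Import all_boot all_order all_algebra.
From mathcomp Require Import all_classical all_reals all_analysis.
Set Implicit Arguments.
Unset Strict Implicit.
Unset Printing Implicit Defensive.
Import Order.TTheory GRing.Theory Num.Theory.
Import numFieldNormedType.Exports.
Local Open Scope classical_set_scope.
Local Open Scope ring_scope.

Notation borel T := (g_sigma_algebraType (@open T)).

(* C^k on an open set U.  Only points of U are constrained, so that charts and
   their inverses may be total functions with arbitrary values elsewhere. *)
Fixpoint Ck {R : realType} {V W : normedModType R} (k : nat) (U : set V)
    (f : V -> W) : Prop :=
  (forall x, U x -> {for x, continuous f}) /\
  if k is k'.+1 then
    forall v, (forall x, U x -> derivable f x v) /\ Ck k' U ('D_v f)
  else True.

Definition smooth_on {R : realType} {V W : normedModType R} (U : set V)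
    (f : V -> W) : Prop :=
  forall k, Ck k U f.

(* Tangent vectors are written as rows, so a Gram matrix g gives the inner
   product v g w^T, and the Jacobian of a map acts on the right. *)
Definition gram_form {R : realType} {d : nat} (g : 'M[R]_d)
    (v w : 'rV[R]_d) : R :=
  (v *m g *m w^T) ord0 ord0.

Definition gram_norm {R : realType} {d : nat} (g : 'M[R]_d) (v : 'rV[R]_d) : R :=
  Num.sqrt (gram_form g v v).

(* A smooth d-manifold without boundary, given by a smooth atlas with a
   distinguished chart around each point, and a smooth metric tensor, given by
   its Gram matrix in each chart as a function of the coordinates. *)
Record riemannianManifold (R : realType) (d : nat) := RiemannianManifold {
  carrier :> ptopologicalType ;
  carrier_hausdorff : hausdorff_space carrier ;
  carrier_second_countable : @second_countable carrier ;
  chart_index : Type ;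
  dom : chart_index -> set carrier ;
  chart : chart_index -> carrier -> 'rV[R]_d ;
  param : chart_index -> 'rV[R]_d -> carrier ;
  chart_at : carrier -> chart_index ;
  dom_chart_at : forall x, dom (chart_at x) x ;
  dom_open : forall i, open (dom i) ;
  img_open : forall i, open (chart i @` dom i) ;
  chartK : forall i x, dom i x -> param i (chart i x) = x ;
  chart_continuous : forall i x, dom i x -> {for x, continuous (chart i)} ;
  param_continuous : forall i y,
    (chart i @` dom i) y -> {for y, continuous (param i)} ;
  transition_smooth : forall i j,
    smooth_on (chart i @` (dom i `&` dom j)) (chart j \o param i) ;
  metric : chart_index -> 'rV[R]_d -> 'M[R]_d ;
  metric_smooth : forall i, smooth_on (chart i @` dom i) (metric i) ;
  metric_sym : forall i y, (chart i @` dom i) y -> (metric i y)^T = metric i y ;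
  metric_pos : forall i y v,
    (chart i @` dom i) y -> v != 0 -> 0 < gram_form (metric i y) v v ;
  metric_transition : forall i j x v w, dom i x -> dom j x ->
    let D := 'd (chart j \o param i) (chart i x) in
    gram_form (metric i (chart i x)) v w =
    gram_form (metric j (chart j x)) (D v) (D w)
}.

(* curve_length x y l: some piecewise C^1 curve from x to y has length l.  By
   compactness such a curve is a concatenation of finitely many C^1 arcs, each
   inside the domain of one chart, and a C^1 arc on [0, 1] in coordinates
   extends to a C^1 map on the line. *)
Inductive curve_length {R : realType} {d : nat} (M : riemannianManifold R d) :
    M -> M -> R -> Prop :=
| curve_length_nil x : curve_length x x 0
| curve_length_cons (i : chart_index M) (s : R -> 'rV[R]_d) (y : M) (l : R) :
    (forall t, derivable s t 1) ->
    continuous (derive1 s) ->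
    (forall t, 0 <= t <= 1 -> (chart i @` dom i) (s t)) ->
    curve_length (param i (s 1)) y l ->
    curve_length (param i (s 0)) y
      ((\int[lebesgue_measure]_(t in `[0, 1])
           gram_norm (metric i (s t)) (derive1 s t)) + l).

(* The value is +oo between distinct connected components. *)
Definition rdist {R : realType} {d : nat} (M : riemannianManifold R d)
    (x y : M) : \bar R :=
  ereal_inf [set l%:E | l in curve_length x y].

(* This determines the Borel measure lambda, as half-open boxes form a
   generating pi-system. *)
Definition is_lebesgue {R : realType} {d : nat}
    (lambda : {measure set (borel 'rV[R]_d) -> \bar R}) : Prop :=
  forall a b : 'rV[R]_d, (forall i, a ord0 i <= b ord0 i) ->
    lambda [set x | forall i, a ord0 i <= x ord0 i < b ord0 i] =
    (\prod_i (b ord0 i - a ord0 i))%:E.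

Definition is_riemannian_volume {R : realType} {d : nat}
    (M : riemannianManifold R d) (m : {measure set (borel M) -> \bar R}) : Prop :=
  exists2 lambda : {measure set (borel 'rV[R]_d) -> \bar R},
    is_lebesgue lambda &
    forall (i : chart_index M) (A : set (borel M)),
      measurable A -> A `<=` dom i ->
      m A = (\int[lambda]_(y in chart i @` A)
               (Num.sqrt (\det (metric i y)))%:E)%E.

(* Coordinate expression of f near x; the tangent spaces at x and at f x are
   identified with R^d through the distinguished charts. *)
Definition local_expr {R : realType} {d : nat} (M : riemannianManifold R d)
    (f : M -> M) (x : M) : 'rV[R]_d -> 'rV[R]_d :=
  chart (chart_at (f x)) \o f \o param (chart_at x).

(* Continuity of f at x is required separately: without it the arbitrary values
   of the chart off its domain could make the coordinate expression smooth. *)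
Definition mdifferentiable {R : realType} {d : nat} (M : riemannianManifold R d)
    (f : M -> M) (x : M) : Prop :=
  {for x, continuous f} /\
  differentiable (local_expr f x) (chart (chart_at x) x).

Definition tangent_map {R : realType} {d : nat} (M : riemannianManifold R d)
    (f : M -> M) (x : M) : 'rV[R]_d -> 'rV[R]_d :=
  'd (local_expr f x) (chart (chart_at x) x).

Definition tangent_norm {R : realType} {d : nat} (M : riemannianManifold R d)
    (x : M) (v : 'rV[R]_d) : R :=
  gram_norm (metric (chart_at x) (chart (chart_at x) x)) v.

Definition invariant_measure {R : realType} {d : nat}
    (M : riemannianManifold R d) (f : M -> M)
    (nu : probability (borel M) R) : Prop :=
  forall A : set (borel M), measurable A -> nu (f @^-1` A) = nu A.

Definition supported_on_compact_invariant {R : realType} {d : nat}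
    (M : riemannianManifold R d) (f : M -> M)
    (nu : probability (borel M) R) : Prop :=
  exists K : set M, [/\ compact K, f @` K `<=` K & nu K = 1%E].

Definition is_ergodic {R : realType} {d : nat}
    (M : riemannianManifold R d) (f : M -> M)
    (nu : probability (borel M) R) : Prop :=
  forall A : set (borel M), measurable A -> f @^-1` A = A ->
    nu A = 0%E \/ nu A = 1%E.

(* The exponent may be +oo.  Mathcomp's convention ln 0 = 0 is harmless: the
   limit is positive, so the norms are eventually nonzero. *)
Definition nonuniformly_expanding {R : realType} {d : nat}
    (M : riemannianManifold R d) (m : {measure set (borel M) -> \bar R})
    (f : M -> M) (nu : probability (borel M) R) : Prop :=
  nu `<< m /\
  exists2 lambda0 : R, 0 < lambda0 &
    {ae nu, forall x : M,
      (forall n, mdifferentiable (iter n f) x) /\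
      forall v : 'rV[R]_d, v != 0 ->
        exists2 l : \bar R, (lambda0%:E <= l)%E &
          (n%:R^-1 *
             ln (tangent_norm (iter n f x) (tangent_map (iter n f) x v)))%:E
            @[n --> \oo] --> l}.

Definition is_density {R : realType} {d : nat} (M : riemannianManifold R d)
    (m : {measure set (borel M) -> \bar R}) (nu : probability (borel M) R)
    (rho : borel M -> R) : Prop :=
  [/\ measurable_fun setT rho, (forall x, 0 <= rho x) &
      forall A : set (borel M), measurable A ->
        nu A = (\int[m]_(x in A) (rho x)%:E)%E].

(* Sup norm plus best Lipschitz constant; finite exactly on bounded Lipschitz
   functions. *)
Definition lip_norm {R : realType} {d : nat} (M : riemannianManifold R d)
    (phi : M -> R) : \bar R :=
  (ereal_sup [set (`|phi x|)%:E | x in [set: M]] +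
   ereal_inf [set L%:E | L in [set L : R | (0 <= L)%R /\
     forall x y, (`|phi x - phi y|)%:E <= L%:E * rdist x y]])%E.

Definition correlation_decay {R : realType} {d : nat}
    (M : riemannianManifold R d) (f : M -> M) (nu : probability (borel M) R)
    (Theta : nat -> R) : Prop :=
  forall (phi1 phi2 : borel M -> R) (j : nat),
    (lip_norm (M := M) phi1 < +oo)%E ->
    measurable_fun setT phi2 -> finite_norm nu +oo%E phi2 ->
    ((`| (\int[nu]_x (phi1 x * phi2 (iter j f x)))
         - (\int[nu]_x phi1 x) * (\int[nu]_x phi2 x) |)%:E <=
     (Theta j)%:E * lip_norm (M := M) phi1 * 'N[nu]_+oo[EFin \o phi2])%E.

Definition stretched_exponential_decay {R : realType} {d : nat}
    (M : riemannianManifold R d) (f : M -> M) (nu : probability (borel M) R)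
    (beta : R) : Prop :=
  exists (theta0 : R) (Theta : nat -> R),
    [/\ 0 < theta0 < 1,
        {homo Theta : i j / (i <= j)%N >-> j <= i},
        Theta @ \oo --> 0,
        Theta =O_\oo (fun n => theta0 `^ (n%:R `^ beta)) &
        correlation_decay f nu Theta].

Definition recurrence_set {R : realType} {d : nat} (M : riemannianManifold R d)
    (f : M -> M) (g : nat -> R) (n : nat) : set M :=
  [set x | exists j : nat, [/\ (1 <= j)%N, j%:R <= g n &
     (rdist x (iter j f x) <= (n%:R `^ (- d%:R^-1))%:E)%E]].

(* "g(n) ~ (log n)^gamma implies nu(E_n) <= bound n", for n large. *)
Definition recurrence_bound {R : realType} {d : nat}
    (M : riemannianManifold R d) (f : M -> M) (nu : probability (borel M) R)
    (gamma : R) (bound : nat -> R) : Prop :=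
  forall g : nat -> R, {homo g : i j / (i <= j)%N >-> i <= j} ->
    g n / ln n%:R `^ gamma @[n --> \oo] --> (1 : R) ->
    \forall n \near \oo, (nu (recurrence_set f g n) <= (bound n)%:E)%E.

(* Extended-real valued, with value +oo at xt. *)
Definition observable {R : realType} {d : nat} (M : riemannianManifold R d)
    (xt x : M) : \bar R :=
  (- lne (rdist x xt))%E.

Definition block_max {R : realType} {T : Type} (f : T -> T) (phi : T -> \bar R)
    (n : nat) (x : T) : \bar R :=
  \big[maxe/-oo%E]_(1 <= i < n.+1) phi (iter i.-1 f x).

Definition threshold {R : realType} (d : nat) (u : R) (n : nat) : R :=
  u / d%:R + ln n%:R / d%:R.

Definition prob_max_le {R : realType} {d : nat} (M : riemannianManifold R d)
    (f : M -> M) (nu : probability (borel M) R) (xt : M) (u : R) (n : nat) : R :=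
  fine (nu [set x | (block_max f (observable xt) n x <= (threshold d u n)%:E)%E]).

Definition tau {R : realType} {d : nat} (M : riemannianManifold R d)
    (nu : probability (borel M) R) (xt : M) (u : R) (n : nat) : R :=
  n%:R * fine (nu [set x | ((threshold d u n)%:E <= observable xt x)%E]).

Definition G_sqrt {R : realType} {d : nat} (M : riemannianManifold R d)
    (nu : probability (borel M) R) (xt : M) (u : R) (n : nat) : R :=
  (1 - tau nu xt u n / Num.sqrt n%:R) `^ Num.sqrt n%:R.

(* C may depend on xt but not on u. *)
Definition gumbel_limit {R : realType} {d : nat} (M : riemannianManifold R d)
    (f : M -> M) (nu : probability (borel M) R) : Prop :=
  {ae nu, forall xt : M, exists2 C : R, 0 < C &
    forall u : R,
      prob_max_le f nu xt u @ \oo --> expR (- (C * expR (- u)))}.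

(* Main.v *)
(* Let B be the ball of radius exp (- u_n) about xt, so that M_n <= u_n means that
   the first n points of the orbit avoid B.  Mixing across a gap of length
   t = (log n)^gamma gives nu (avoid k.+1) ~ (1 - nu B) nu (avoid k), up to the
   mass of the points of B returning to B before time t and, since the indicator
   of B must be replaced by a Lipschitz function, up to the mass of a thin annulus
   around B.  Hence nu (M_n <= u_n) ~ (1 - nu B)^n ~ exp (- n nu B) ~ G.

   The annulus is small because contracting a chart towards xt maps the larger
   ball into the smaller one, and because rho is in L^(1 + delta).  The points of
   B returning early lie in a recurrence set E_N.  Along N_k = floor (exp (k^a)),
   the maximal inequality and Borel-Cantelli give, for almost every xt and
   uniformly in r, nu (E_(N_k) & ball r) <= const * k^2 bound(N_k) r^d, and
   k^2 is about (log n)^(2 / a).  Finally Lebesgue differentiation in a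
   chart makes nu (ball r) / r^d converge to a positive constant for almost every
   xt, which yields the Gumbel limit. *)
Require Import Defs.
From HB Require Import structures.
From mathcomp Require Import all_boot all_order all_algebra.
From mathcomp Require Import all_classical all_reals all_analysis.
From mathcomp Require Import measurable_realfun ring lra zify.
Set Implicit Arguments.
Unset Strict Implicit.
Unset Printing Implicit Defensive.
Import Order.TTheory GRing.Theory Num.Theory.
Import numFieldNormedType.Exports.
Local Open Scope classical_set_scope.
Local Open Scope ring_scope.

(** * Calculus in coordinates *)

(** The rate is decided by the early returns alone: every other error is at most n^(-1/4). Two of
    these errors pull against each other, since an annulus of width eps costs a factor 1 / eps in
    the decay of correlations. With x = log n the width is exp (- x^s) for some s with 1 < s < gamma
    beta: s > 1 makes it smaller than every power of n, while Theta (x^gamma), about exp (- c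
    x^(gamma beta)), still outweighs n / eps. This is the role of gamma beta > 1.

    The exponent a of the block times is free. In the polynomial case 2 / a <= 1 is the origin of
    the constant C_2, and 2 / a < alpha makes the bound tend to 0, so that the limit law follows
    whatever the sign of alpha - kappa.

    The geometric obstacle is that the distance is an infimum over curves, which may leave any
    chart. Distances are therefore estimated through functions capped at a height B: a bound on the
    slope below the cap bounds the growth along every curve, and a point reached below the cap is
    known to lie in the chart. *)

Lemma coord_le_norm (R : realType) (m n : nat) (A : 'M[R]_(m, n)) i j :
  `|A i j| <= `|A|.
Proof.
rewrite [leRHS]/Num.Def.normr/= mx_normrE.
exact: (le_bigmax _ (fun ij => `|A ij.1 ij.2|) (i, j)).
Qed.

Lemma norm_le_coord (R : realType) (d : nat) (v : 'rV[R]_d) (c : R) :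
  0 <= c -> (forall k, `|v ord0 k| <= c) -> `|v| <= c.
Proof.
move=> c0 vc; rewrite [leLHS]/Num.Def.normr/= mx_normrE.
apply: bigmax_le => // -[i j] _ /=; rewrite (ord1 i); exact: vc.
Qed.

Lemma norm_lt_coord (R : realType) (d : nat) (v : 'rV[R]_d) (c : R) :
  0 < c -> (forall k, `|v ord0 k| < c) -> `|v| < c.
Proof.
move=> c0 vc; rewrite [ltLHS]/Num.Def.normr/= mx_normrE.
apply: bigmax_lt => // -[i j] _ /=; rewrite (ord1 i); exact: vc.
Qed.

Lemma is_derive_line (R : realType) (V W : normedModType R) (f : V -> W)
    (z v : V) (t : R) : derivable f (z + t *: v) v ->
  is_derive t 1 (fun s => f (z + s *: v)) ('D_v f (z + t *: v)).
Proof.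
move=> /derivableP [df Df].
have E : (fun h : R => h^-1 *: (f (z + (h *: (1 : R) + t) *: v) - f (z + t *: v))) =
  (fun h => h^-1 *: (f (h *: v + (z + t *: v)) - f (z + t *: v))).
  apply/funext => h; congr (_ *: (f _ - _)).
  by rewrite scalerDl [h *: 1]mulr1 addrCA.
apply: DeriveDef.
  by rewrite /derivable /= E.
by rewrite /derive /= E.
Qed.

(* Telescoping along the coordinate axes: z_k agrees with y' on the first k
   coordinates and with y on the others. *)
Lemma partial_increment (R : realType) (d : nat) (f : 'rV[R]_d -> R)
    (x0 : 'rV[R]_d) (r eps : R) (c : 'I_d -> R) :
  (forall y, `|y - x0| < r -> forall k, derivable f y 'e_k /\
     `|'D_('e_k) f y - c k| <= eps) ->
  forall y y', `|y - x0| < r -> `|y' - x0| < r ->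
  `|f y' - f y - \sum_k c k * (y' - y) ord0 k| <= eps * d%:R * `|y' - y|.
Proof.
move=> H y y' yr y'r.
have r0 : 0 < r by exact: le_lt_trans yr.
pose z (k : nat) : 'rV[R]_d := \row_i (if (i < k)%N then y' ord0 i else y ord0 i).
have zd : z d = y'.
  by apply/rowP => i; rewrite mxE ltn_ord.
have z0 : z 0%N = y by apply/rowP => i; rewrite mxE.
have step (k : 'I_d) :
   `|f (z k.+1) - f (z k) - c k * (y' - y) ord0 k| <= eps * `|y' - y|.
  have eps0 : 0 <= eps by have [_] := H _ yr k; apply: le_trans.
  set tau := (y' - y) ord0 k.
  have zS : z k.+1 = z k + tau *: 'e_k.
    apply/rowP => i; rewrite !mxE eqxx/= ltnS leq_eqVlt -val_eqE/=.
    case: eqP => [/val_inj->|_] /=.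
      by rewrite ltnn mulr1 /tau !mxE subrKC.
    by rewrite mulr0 addr0.
  have zr t : `|t| <= `|tau| -> forall i, (`|(z k + t *: 'e_k - x0) ord0 i|
      < r) \/ i = k.
    move=> _ i; have [->|ik] := eqVneq i k; first by right.
    left; rewrite !mxE eqxx/= (negbTE ik) mulr0 addr0.
    case: ifP => _.
      by apply: le_lt_trans y'r; have := coord_le_norm (y' - x0) ord0 i; rewrite !mxE.
    by apply: le_lt_trans yr; have := coord_le_norm (y - x0) ord0 i; rewrite !mxE.
  (* A sup-norm ball is a box: the coordinates other than [k] come from [y] or [y'], and coordinate
     [k] is a convex combination of theirs. *)
  have zin s : 0 <= s <= 1 -> `|z k + (s * tau) *: 'e_k - x0| < r.
    move=> /andP[s0 s1]; apply: norm_lt_coord => // i.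
    have st : `|s * tau| <= `|tau|.
      by rewrite normrM ger0_norm// ler_piMl.
    have [//|->] := zr _ st i.
    rewrite !mxE !eqxx/= ltnn mulr1.
    have a1 : `|(y - x0) ord0 k| < r.
      exact: le_lt_trans (coord_le_norm _ _ _) yr.
    have a2 : `|(y' - x0) ord0 k| < r.
      exact: le_lt_trans (coord_le_norm _ _ _) y'r.
    move: a1 a2; rewrite !mxE => a1 a2.
    have -> : y ord0 k + s * tau - x0 ord0 k =
      (1 - s) * (y ord0 k - x0 ord0 k) + s * (y' ord0 k - x0 ord0 k).
      by rewrite /tau !mxE; ring.
    set A := y ord0 k - _ in a1 *; set B := y' ord0 k - _ in a2 *.
    rewrite (le_lt_trans (ler_normD _ _))// !normrM (ger0_norm s0) ger0_norm ?subr_ge0//.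
    have am : `|A| <= Num.max `|A| `|B| by rewrite le_max lexx.
    have bm : `|B| <= Num.max `|A| `|B| by rewrite le_max lexx orbT.
    have mr : Num.max `|A| `|B| < r by rewrite gt_max a1 a2.
    have := ler_wpM2l s0 bm; have := ler_wpM2l (_ : 0 <= 1 - s) am.
    rewrite subr_ge0 => /(_ s1) h1 h2.
    by apply: le_lt_trans mr; lra.
  pose h s := f (z k + s *: (tau *: 'e_k)).
  have hE s : h s = f (z k + (s * tau) *: 'e_k) by rewrite /h scalerA.
  pose g s := f (z k + s *: 'e_k).
  have [t0|t0] := eqVneq tau 0.
    by rewrite zS t0 scale0r addr0 subrr mulr0 subrr normr0 mulr_ge0.
  apply: (@le_trans _ _ (eps * `|tau|)); last first.
    by rewrite ler_wpM2l//; exact: coord_le_norm.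
  (* A general segment [[a, b]], so that both signs of [tau] are covered. *)
  have key : forall a b, (a <= b)%R ->
      (forall s, s \in `[a, b]%R -> 0 <= s / tau <= 1) ->
      `|g b - g a - c k * (b - a)| <= eps * (b - a).
    move=> a b ab Hab.
    have der s : s \in `[a, b]%R ->
        is_derive s 1 g ('D_('e_k) f (z k + s *: 'e_k)) /\
        `|'D_('e_k) f (z k + s *: 'e_k) - c k| <= eps.
      move=> /Hab/zin zs; have [d1 d2] : derivable f (z k + s *: 'e_k) 'e_k /\
          `|'D_('e_k) f (z k + s *: 'e_k) - c k| <= eps.
        by apply: H; rewrite (mulfVK t0) in zs.
      by split; [exact: is_derive_line|exact: d2].
    have [||s sI ->] := @MVT_segment _ g (fun s => 'D_('e_k) f (z k + s *: 'e_k)) a b ab.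
    - by move=> x /subset_itv_oo_cc/der[].
    - by apply: derivable_within_continuous => x /der[[]].
    rewrite -mulrBl normrM (@ger0_norm _ (b - a)) ?subr_ge0// ler_wpM2r ?subr_ge0//.
    by have [] := der _ sI.
  have [tp|tn] := ltP 0 tau.
    have := key 0 tau (ltW tp).
    rewrite subr0 (gtr0_norm tp) /g scale0r addr0 -zS; apply => s.
    rewrite in_itv/= => /andP[s0 s1]; rewrite divr_ge0 ?(ltW tp)//=.
    by rewrite ler_pdivrMr// mul1r.
  have tn' : tau < 0 by rewrite lt_neqAle t0.
  have := key tau 0 tn.
  have -> : g 0 - g tau - c k * (0 - tau) = - (f (z k.+1) - f (z k) - c k * tau).
    by rewrite /g scale0r addr0 -zS; ring.
  rewrite normrN sub0r (ltr0_norm tn'); apply => s; rewrite in_itv/= => /andP[s0 s1].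
  by rewrite mulr_le0 ?invr_le0//= ler_ndivrMr// mul1r.
have -> : f y' - f y - \sum_k c k * (y' - y) ord0 k =
   \sum_(k < d) (f (z k.+1) - f (z k) - c k * (y' - y) ord0 k).
  rewrite sumrB; congr (_ - _).
  rewrite -(big_mkord xpredT (fun k => f (z k.+1) - f (z k))).
  by rewrite telescope_sumr// zd z0.
apply: (@le_trans _ _ (\sum_(k < d)
    `|f (z k.+1) - f (z k) - c k * (y' - y) ord0 k|)).
  exact: ler_norm_sum.
apply: (@le_trans _ _ (\sum_(k < d) eps * `|y' - y|)).
  by apply: ler_sum => k _; exact: step.
by rewrite sumr_const card_ord -[leLHS]mulr_natr mulrAC lexx.
Qed.
Lemma differentiable_approx (R : realType) (V W : normedModType R) (f : V -> W)
    (df : {linear V -> W}) (x : V) : continuous df ->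
  (forall e : R, 0 < e -> \forall h \near (0 : V), `|f (h + x) - f x - df h| <= e * `|h|) ->
  differentiable f x /\ ('d f x = df :> (V -> W)).
Proof.
move=> dfc H.
have E : f \o shift x = cst (f x) + df +o_ (0 : V) id.
  apply/eqaddoP => e e0; apply: filterS (H e e0) => h /=.
  by rewrite opprD addrA.
have D := diff_unique dfc E; split => //.
by apply/diff_locallyP; rewrite D; split.
Qed.

Lemma diff_approx (R : realType) (V W : normedModType R) (f : V -> W) (x : V)
    (e : R) : differentiable f x -> 0 < e ->
  \forall y \near x, `|f y - f x - 'd f x (y - x)| <= e * `|y - x|.
Proof.
move=> /diff_locally /eqaddoP/[apply] H.
rewrite (near_shift 0); apply: filterS H => h /=.
by rewrite subr0 addrK opprD addrA.
Qed.

Lemma near_forall_fin (I : finType) (T : Type) (F : set_system T) (P : I -> T -> Prop) :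
  Filter F -> (forall k, \forall y \near F, P k y) ->
  \forall y \near F, forall k, P k y.
Proof. by move=> FF H; exact: (@filter_forall T I P). Qed.

Lemma mulmx_norm_le (R : realType) (m n : nat) (A : 'M[R]_(m, n)) (h : 'rV[R]_m) :
  `|h *m A| <= (\sum_k \sum_j `|A k j|) * `|h|.
Proof.
apply: norm_le_coord => [|j].
  by rewrite mulr_ge0// sumr_ge0// => k _; rewrite sumr_ge0.
rewrite mxE; apply: le_trans (ler_norm_sum _ _ _) _; rewrite mulr_suml.
apply: ler_sum => k _; rewrite normrM mulrC ler_pM//; last exact: coord_le_norm.
by rewrite (bigD1 j)//= lerDl sumr_ge0.
Qed.

Lemma continuous_mulmxr (R : realType) (m n : nat) (A : 'M[R]_(m, n)) :
  continuous (mulmxr A : 'rV[R]_m -> 'rV[R]_n).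
Proof.
apply: bounded_linear_continuous; apply/linear_boundedP.
near=> r => x; apply: le_trans (mulmx_norm_le _ _) _; rewrite ler_wpM2r//.
Unshelve. all: by end_near. Qed.

(** Strict differentiability: near [x] all partial derivatives are within [e'] of their values at
    [x], so both points may vary. Fixing [y = x] gives the differential; leaving both free gives a
    Lipschitz bound. Dividing [e] by [d + 1] pays for the sum over the coordinates and stays
    meaningful for [d = 0]. *)
Lemma C1_increment (R : realType) (d m n : nat) (U : set 'rV[R]_d)
    (f : 'rV[R]_d -> 'M[R]_(m, n)) (x : 'rV[R]_d) (e : R) :
  open U -> smooth_on U f -> U x -> 0 < e ->
  exists2 r : R, 0 < r & forall y y', `|y - x| < r -> `|y' - x| < r ->
    forall i j, `|f y' i j - f y i j -
      \sum_k ('D_('e_k) f x) i j * (y' - y) ord0 k| <= e * `|y' - y|.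
Proof.
move=> oU sf Ux e0.
have [_ /= C1] := sf 1%N.
pose e' := e / d.+1%:R.
have e'0 : 0 < e' by rewrite divr_gt0.
have cD (k : 'I_d) : \forall y \near x, `|'D_('e_k) f y - 'D_('e_k) f x| <= e'.
  have [_ [/(_ _ Ux) ck _]] := C1 'e_k.
  by have /cvgrPdistC_le /(_ e' e'0) := ck.
have : \forall y \near x, U y /\ forall k : 'I_d, `|'D_('e_k) f y - 'D_('e_k) f x| <= e'.
  by apply: filterI; [exact: open_nbhs_nbhs|exact: (@near_forall_fin 'I_d _ (nbhs x)
    (fun k y => `|'D_('e_k) f y - 'D_('e_k) f x| <= e') _ cD)].
move=> /nbhs_ballP [r /= r0 H].
exists r => // y y' yr y'r i j.
have := @partial_increment R d (fun y => f y i j) x r e' (fun k => ('D_('e_k) f x) i j).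
move=> /(_ _ y y' yr y'r) P.
apply: le_trans (P _) _.
  move=> z zr k; have zB : ball x r z by rewrite -ball_normE/= distrC.
  have [Uz Hz] := H z zB.
  have [/(_ _ Uz) dz _] := C1 'e_k.
  split; first exact: (derivable_mxP _ _ _).1 dz i j.
  have -> : 'D_('e_k) (fun y => f y i j) z = ('D_('e_k) f z) i j.
    by rewrite (derive_mx dz) mxE.
  apply: le_trans (Hz k).
  have := coord_le_norm ('D_('e_k) f z - 'D_('e_k) f x) i j.
  by rewrite !mxE.
rewrite ler_wpM2r// /e' -mulrA ler_piMr ?(ltW e0)//.
by rewrite mulrC ler_pdivrMr// mul1r ler_nat.
Qed.

Lemma smooth_differentiable (R : realType) (d n : nat) (U : set 'rV[R]_d)
    (f : 'rV[R]_d -> 'rV[R]_n) (x : 'rV[R]_d) :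
  open U -> smooth_on U f -> U x -> differentiable f x.
Proof.
move=> oU sf Ux.
pose A := \matrix_(k < d, j < n) ('D_('e_k) f x) ord0 j.
have [] // := @differentiable_approx R _ _ f (mulmxr A) x (@continuous_mulmxr _ _ _ A).
move=> e e0; have [r r0 H] := C1_increment oU sf Ux e0.
apply/nbhs_ballP; exists r => // h; rewrite -ball_normE/= sub0r normrN => hr.
apply: norm_le_coord => [|j]; first by rewrite mulr_ge0// ltW.
have := H x (h + x); rewrite subrr normr0 addrK => /(_ r0 hr ord0 j).
rewrite !mxE; congr (`|_ - _| <= _).
by apply: eq_bigr => k _; rewrite mxE mulrC.
Qed.

Lemma smooth_lipschitz (R : realType) (d m n : nat) (U : set 'rV[R]_d)
    (f : 'rV[R]_d -> 'M[R]_(m, n)) (x : 'rV[R]_d) :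
  open U -> smooth_on U f -> U x ->
  exists r L : R, [/\ 0 < r, 0 < L & forall y y', `|y - x| < r -> `|y' - x| < r ->
    forall i j, `|f y' i j - f y i j| <= L * `|y' - y|].
Proof.
move=> oU sf Ux; have [r r0 H] := C1_increment oU sf Ux ltr01.
exists r; exists (1 + \sum_k `|'D_('e_k) f x|); split => //.
  by rewrite ltr_wpDr// sumr_ge0.
move=> y y' yr y'r i j.
rewrite mulrDl mul1r -[X in `|X|](subrK (\sum_k ('D_('e_k) f x) i j * (y' - y) ord0 k)).
apply: le_trans (ler_normD _ _) _; apply: lerD.
  by have := H _ _ yr y'r i j; rewrite mul1r.
apply: le_trans (ler_norm_sum _ _ _) _; rewrite mulr_suml; apply: ler_sum => k _.
rewrite normrM ler_pM//; last exact: coord_le_norm.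
exact: coord_le_norm.
Qed.

(** * Inner products given by Gram matrices *)

Lemma gram_formDl (R : realType) (d : nat) (g : 'M[R]_d) u v w :
  gram_form g (u + v) w = gram_form g u w + gram_form g v w.
Proof. by rewrite /gram_form !mulmxDl mxE. Qed.

Lemma gram_formDr (R : realType) (d : nat) (g : 'M[R]_d) u v w :
  gram_form g w (u + v) = gram_form g w u + gram_form g w v.
Proof. by rewrite /gram_form linearD mulmxDr mxE. Qed.

Lemma gram_formZl (R : realType) (d : nat) (g : 'M[R]_d) a v w :
  gram_form g (a *: v) w = a * gram_form g v w.
Proof. by rewrite /gram_form -!scalemxAl mxE. Qed.

Lemma gram_formZr (R : realType) (d : nat) (g : 'M[R]_d) a v w :
  gram_form g v (a *: w) = a * gram_form g v w.
Proof. by rewrite /gram_form linearZ -scalemxAr mxE. Qed.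

Lemma gram_formC (R : realType) (d : nat) (g : 'M[R]_d) v w :
  g^T = g -> gram_form g v w = gram_form g w v.
Proof.
move=> gT; rewrite /gram_form -[in RHS]gT.
have -> : w *m g^T *m v^T = (v *m g *m w^T)^T.
  by rewrite !trmx_mul trmxK mulmxA.
by rewrite [RHS]mxE.
Qed.

Lemma gram_formBg (R : realType) (d : nat) (g h : 'M[R]_d) v w :
  gram_form (g - h) v w = gram_form g v w - gram_form h v w.
Proof. by rewrite /gram_form mulmxBr mulmxBl !mxE. Qed.

Lemma gram_form_le (R : realType) (d : nat) (g : 'M[R]_d) v w c :
  0 <= c -> (forall i j, `|g i j| <= c) ->
  `|gram_form g v w| <= c * d%:R ^+ 2 * (`|v| * `|w|).
Proof.
move=> c0 gc; rewrite /gram_form mxE.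
apply: le_trans (ler_norm_sum _ _ _) _.
have : \sum_(i < d) `|(v *m g) ord0 i * w^T i ord0| <=
    \sum_(i < d) c * d%:R * (`|v| * `|w|).
  apply: ler_sum => i _; rewrite normrM mulrA ler_pM//; last first.
    by rewrite mxE; exact: coord_le_norm.
  rewrite mxE; apply: le_trans (ler_norm_sum _ _ _) _.
  have : \sum_(j < d) `|v ord0 j * g j i| <= \sum_(j < d) c * `|v|.
    apply: ler_sum => j _; rewrite normrM mulrC ler_pM//.
    exact: coord_le_norm.
  move=> /le_trans; apply.
  by rewrite sumr_const card_ord -[leLHS]mulr_natr mulrAC lexx.
move=> /le_trans; apply.
by rewrite sumr_const card_ord -[leLHS]mulr_natr expr2 mulrA mulrAC lexx.
Qed.

Definition posdef (R : realType) (d : nat) (g : 'M[R]_d) : Prop :=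
  g^T = g /\ forall v, v != 0 -> 0 < gram_form g v v.

Lemma gram_form0 (R : realType) (d : nat) (g : 'M[R]_d) w : gram_form g 0 w = 0.
Proof. by rewrite /gram_form !mul0mx mxE. Qed.

Lemma gram_form_ge0 (R : realType) (d : nat) (g : 'M[R]_d) v :
  posdef g -> 0 <= gram_form g v v.
Proof.
move=> [_ H]; have [->|v0] := eqVneq v 0; first by rewrite gram_form0.
exact/ltW/H.
Qed.

Lemma gram_norm_ge0 (R : realType) (d : nat) (g : 'M[R]_d) v : 0 <= gram_norm g v.
Proof. exact: sqrtr_ge0. Qed.

Lemma gram_norm_sqr (R : realType) (d : nat) (g : 'M[R]_d) v :
  posdef g -> gram_norm g v ^+ 2 = gram_form g v v.
Proof. by move=> pg; rewrite sqr_sqrtr// gram_form_ge0. Qed.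

Lemma gram_norm0 (R : realType) (d : nat) (g : 'M[R]_d) : gram_norm g 0 = 0.
Proof. by rewrite /gram_norm gram_form0 sqrtr0. Qed.

Lemma gram_norm_gt0 (R : realType) (d : nat) (g : 'M[R]_d) v :
  posdef g -> v != 0 -> 0 < gram_norm g v.
Proof. by move=> [_ H] /H; rewrite sqrtr_gt0. Qed.

Lemma gram_normZ (R : realType) (d : nat) (g : 'M[R]_d) a v :
  gram_norm g (a *: v) = `|a| * gram_norm g v.
Proof.
by rewrite /gram_norm gram_formZl gram_formZr mulrA -expr2 sqrtrM ?sqr_ge0// sqrtr_sqr.
Qed.

Lemma gram_CS (R : realType) (d : nat) (g : 'M[R]_d) v w :
  posdef g -> gram_form g v w <= gram_norm g v * gram_norm g w.
Proof.
move=> pg; have [->|v0] := eqVneq v 0.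
  by rewrite gram_form0 gram_norm0 mul0r.
have [->|w0] := eqVneq w 0.
  by rewrite (gram_formC _ _ pg.1) gram_form0 gram_norm0 mulr0.
have a0 := gram_norm_gt0 pg v0; have b0 := gram_norm_gt0 pg w0.
set a := gram_norm g v in a0 *; set b := gram_norm g w in b0 *.
(* Nonnegativity at [b *: v - a *: w] is the claim multiplied by [2 * a * b]. *)
have := gram_form_ge0 (b *: v + (- a) *: w) pg.
rewrite !(gram_formDl, gram_formDr, gram_formZl, gram_formZr).
rewrite (gram_formC w v pg.1) -!gram_norm_sqr// -/a -/b => H.
have ab : 0 < a * b by rewrite mulr_gt0.
rewrite -(ler_pM2l ab); lra.
Qed.

Lemma gram_normD (R : realType) (d : nat) (g : 'M[R]_d) v w :
  posdef g -> gram_norm g (v + w) <= gram_norm g v + gram_norm g w.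
Proof.
move=> pg.
rewrite -(@ler_pXn2r _ 2)// ?nnegrE ?addr_ge0 ?gram_norm_ge0//.
rewrite gram_norm_sqr// gram_formDl !gram_formDr sqrrD !gram_norm_sqr//.
have := gram_CS v w pg; rewrite (gram_formC w v pg.1); lra.
Qed.

Lemma gram_normN (R : realType) (d : nat) (g : 'M[R]_d) v :
  gram_norm g (- v) = gram_norm g v.
Proof. by rewrite -scaleN1r gram_normZ normrN normr1 mul1r. Qed.

Lemma gram_norm_le_coord (R : realType) (d : nat) (g : 'M[R]_d) :
  exists2 C : R, 0 < C & forall v, gram_norm g v <= C * `|v|.
Proof.
pose c := \sum_i \sum_j `|g i j|.
have c0 : 0 <= c by rewrite sumr_ge0// => i _; rewrite sumr_ge0.
have gc i j : `|g i j| <= c.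
  rewrite /c (bigD1 i)//= (bigD1 j)//= -addrA lerDl addr_ge0// sumr_ge0// => k _.
  by rewrite sumr_ge0.
exists (Num.sqrt (c * d%:R ^+ 2) + 1) => [|v]; first by rewrite ltr_wpDl// sqrtr_ge0.
have := gram_form_le v v c0 gc.
move=> /(le_trans (ler_norm _)) /ler_wsqrtr.
rewrite sqrtrM ?mulr_ge0// -expr2 sqrtr_sqr normr_id => /le_trans; apply.
by rewrite ler_wpM2r// lerDl.
Qed.

Lemma continuous_gram_norm (R : realType) (d : nat) (g : 'M[R]_d) :
  posdef g -> continuous (gram_norm g).
Proof.
move=> pg x; have [C C0 HC] := gram_norm_le_coord g.
apply/(@cvgrPdist_le _ _ _ (nbhs (x : 'rV[R]_d))) => e e0; near=> y.
have xy : `|x - y| <= e / C.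
  by near: y; apply: cvgr_dist_le; rewrite ?divr_gt0.
have a1 : gram_norm g (x - y) <= e.
  by apply: le_trans (HC _) _; rewrite mulrC -ler_pdivlMr.
have := gram_normD (x - y) y pg; rewrite subrK => h1.
have := gram_normD (y - x) x pg; rewrite subrK -(opprB x y) gram_normN => h2.
by rewrite ler_norml; apply/andP; split; lra.
Unshelve. all: by end_near. Qed.

Lemma gram_norm_ge_coord (R : realType) (d : nat) (g : 'M[R]_d) : posdef g ->
  exists2 c : R, 0 < c & forall v, c * `|v| <= gram_norm g v.
Proof.
move=> pg.
(* Without nonzero vectors the unit sphere is empty and has no minimum to take; any constant then
   works. *)
case: (pselect (exists v : 'rV[R]_d, v != 0)) => [[v1 v10]|H]; last first.
  exists 1 => // v; have [->|v0] := eqVneq v 0.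
    by rewrite normr0 mulr0 gram_norm_ge0.
  by exfalso; apply: H; exists v.
pose S : set 'rV[R]_d := [set v | `|v| = 1].
have cS : compact S.
  apply: bounded_closed_compact.
    by exists 1; split => // y y1 v Sv /=; rewrite Sv ltW.
  have -> : S = (fun v : 'rV[R]_d => `|v|) @^-1` [set 1] by [].
  apply: preimage_closed; last exact: closed_eq.
  by move=> v _; exact: norm_continuous.
have S0 : S !=set0.
  exists (`|v1|^-1 *: v1); rewrite /S/= normrZ normfV normr_id mulVf//.
  by rewrite normr_eq0.
have [|c cS' cmin] := EVT_min_rV S0 cS (f := gram_norm g).
  exact/continuous_subspaceT/continuous_gram_norm.
move: cS'; rewrite inE /S/= => c1.
have c0 : c != 0 by rewrite -normr_eq0 c1 oner_eq0.
exists (gram_norm g c) => [|v]; first exact: gram_norm_gt0.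
have [->|v0] := eqVneq v 0; first by rewrite normr0 mulr0 gram_norm_ge0.
have vp : 0 < `|v| by rewrite normr_gt0.
have := cmin (`|v|^-1 *: v); rewrite inE /S/= normrZ normfV normr_id mulVf ?gt_eqF//.
move=> /(_ erefl); rewrite gram_normZ normfV normr_id.
by rewrite mulrC ler_pdivlMr.
Qed.
(** * Riemannian distance *)

(** Continuous induction on the set of [t] where the inequality holds with slack [e * t]: lower
    semicontinuity carries it to the supremum of the set, and the increment bound carries it beyond
    unless the supremum is 1. Only lower semicontinuity is asked, because for a function extended
    from a chart it comes down to closed sublevel sets. *)
Lemma dini_le (R : realType) (phi F : R -> R) :
  (forall t : R, 0 < t <= 1 -> forall e : R, 0 < e ->
     \forall u \near t, phi t - e <= phi u) ->
  (forall t : R, 0 <= t < 1 -> forall e : R, 0 < e ->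
     \forall h \near (0 : R)^'+, t + h <= 1 ->
       phi (t + h) - phi t <= F (t + h) - F t + e * h) ->
  (forall t u : R, 0 <= t -> t <= u -> u <= 1 -> F t <= F u) ->
  phi 1 - phi 0 <= F 1 - F 0.
Proof.
move=> lsc dini Fnd; apply/ler_addgt0Pr => e e0.
pose S := [set t | 0 <= t <= 1 /\ phi t - phi 0 <= F t - F 0 + e * t].
have S0 : S 0 by rewrite /S/= lexx ler01 !subrr mulr0 addr0.
have Sub : ubound S 1 by move=> t [/andP[]].
have hS : has_sup S by split; [exists 0|exists 1].
pose s := sup S.
have s0 : 0 <= s by apply: ub_le_sup => //; exists 1.
have s1 : s <= 1 by apply: ge_sup => //; exists 0.
have Ss : S s.
  have [<-//|s0'] := eqVneq 0 s.
  have sp : 0 < s by rewrite lt_neqAle s0'.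
  split; first by rewrite s0 s1.
  apply/ler_addgt0Pr => e1 e10.
  have := lsc s; rewrite sp s1 => /(_ isT e1 e10) /nbhs_ballP [r /= r0 H].
  have [u Su su] := sup_adherent r0 hS; rewrite -/s in su.
  have us : u <= s by apply: ub_le_sup => //; exists 1.
  have /H : ball s r u by rewrite /ball/= ger0_norm ?subr_ge0//; lra.
  case: Su => /andP[u0 u1] Su pu.
  have := Fnd u s u0 us s1.
  have : e * u <= e * s by rewrite ler_pM2l.
  lra.
have [s1'|s1'] := eqVneq s 1.
  by case: Ss => _; rewrite s1' mulr1.
have slt : s < 1 by rewrite lt_neqAle s1' s1.
have := dini s; rewrite s0 slt => /(_ isT e e0) H.
have [h [h0 hs hphi]] : exists h : R, [/\ 0 < h, s + h <= 1 &
    phi (s + h) - phi s <= F (s + h) - F s + e * h].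
  near (0 : R)^'+ => h; exists h.
  have sh1 : s + h <= 1.
    rewrite -lerBrDl; near: h; apply: nbhs_right_le; rewrite subr_gt0//.
  by split => //; move: sh1; near: h.
have : S (s + h).
  split; first by rewrite hs addr_ge0// ltW.
  by case: Ss => _; rewrite mulrDr; lra.
move=> /(ub_le_sup (ex_intro _ 1 Sub)); rewrite -/s; lra.
Unshelve. all: by end_near. Qed.

Lemma Rintegral_increment_ge (R : realType) (w : R -> R) (a b c : R) :
  {within `[0, 1], continuous w} -> 0 <= a -> a <= b -> b <= 1 ->
  (forall t, a <= t <= b -> c <= w t) ->
  c * (b - a) <= \int[lebesgue_measure]_(t in `[0, b]) w t -
                 \int[lebesgue_measure]_(t in `[0, a]) w t.
Proof.
move=> cw a0 ab b1 H.
have iw : lebesgue_measure.-integrable `[0, 1] (EFin \o w).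
  by apply: continuous_compact_integrable => //; exact: segment_compact.
have ib : lebesgue_measure.-integrable `[0, b] (EFin \o w).
  by apply: integrableS iw => //; apply: subset_itvl; rewrite bnd_simp.
rewrite Rintegral_itvB//.
have -> : c * (b - a) = \int[lebesgue_measure]_(t in `]a, b]) c.
  rewrite Rintegral_cst//= lebesgue_measure_itv/= lte_fin.
  case: ifPn => //; rewrite -leNgt => ba.
  have -> : b = a by apply/eqP; rewrite eq_le ba ab.
  by rewrite subrr.
apply: le_Rintegral => //.
- have ic : lebesgue_measure.-integrable `[a, b] (EFin \o (fun=> c)).
    apply: continuous_compact_integrable; first exact: segment_compact.
    exact/continuous_subspaceT/cst_continuous.
  by apply: integrableS ic => //; apply: subset_itvr; rewrite bnd_simp.
- apply: integrableS ib => //; apply: subset_itvr; rewrite bnd_simp//.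
by move=> t /=; rewrite in_itv/= => /andP[ta tb]; rewrite H// ltW.
Qed.

Lemma cvg_sum_seq (R : realType) (T I : Type) (F : set_system T) (r : seq I)
    (f : I -> T -> R) (a : I -> R) : Filter F ->
  (forall i, f i x @[x --> F] --> a i) ->
  \sum_(i <- r) f i x @[x --> F] --> \sum_(i <- r) a i.
Proof.
move=> FF fa; elim: r => [|i r IH].
  by rewrite big_nil; under eq_fun do rewrite big_nil; exact: cvg_cst.
rewrite big_cons; under eq_fun do rewrite big_cons.
exact: cvgD.
Qed.

Lemma cvg_gram_norm (R : realType) (d : nat) (T : Type) (F : set_system T)
    (g : T -> 'M[R]_d) (v : T -> 'rV[R]_d) (g0 : 'M[R]_d) (v0 : 'rV[R]_d) :
  Filter F -> g x @[x --> F] --> g0 -> v x @[x --> F] --> v0 ->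
  gram_norm (g x) (v x) @[x --> F] --> gram_norm g0 v0.
Proof.
move=> FF gg vv.
have cc m n (h : T -> 'M[R]_(m, n)) (h0 : 'M[R]_(m, n)) i j : h x @[x --> F] --> h0 ->
    h x i j @[x --> F] --> h0 i j.
  move=> hh; apply: (@cvg_comp _ _ _ h (fun A : 'M[R]_(m, n) => A i j) F (nbhs h0) (nbhs (h0 i j)) hh).
  exact: coord_continuous.
rewrite /gram_norm; apply: (@cvg_comp _ _ _ _ (@Num.sqrt R)); last exact: sqrt_continuous.
have E (h : 'M[R]_d) (u : 'rV[R]_d) : gram_form h u u =
    \sum_j (\sum_k u ord0 k * h k j) * u ord0 j.
  by rewrite /gram_form mxE; apply: eq_bigr => j _; rewrite !mxE.
rewrite E; under eq_fun do rewrite E.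
apply: cvg_sum_seq => j; apply: cvgM; last exact: cc.
by apply: cvg_sum_seq => k; apply: cvgM; exact: cc.
Qed.

(** * Growth of functions along curves *)

Lemma imgP (R : realType) (d : nat) (M : riemannianManifold R d) (i : chart_index M)
    (y : 'rV[R]_d) : (chart i @` dom i) y ->
  dom i (param i y) /\ chart i (param i y) = y.
Proof. by move=> [x dx <-]; rewrite chartK. Qed.

Lemma img_dom (R : realType) (d : nat) (M : riemannianManifold R d)
    (i : chart_index M) (x : M) : dom i x -> (chart i @` dom i) (chart i x).
Proof. by move=> dx; exists x. Qed.

Lemma overlap_open (R : realType) (d : nat) (M : riemannianManifold R d)
    (i j : chart_index M) : open (chart i @` (dom i `&` dom j)).
Proof.
rewrite openE => y [x [di dj] xy].
have iy : (chart i @` dom i) y by exists x.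
have py : param i y = x by rewrite -xy chartK.
have n1 : nbhs y (chart i @` dom i).
  by apply: open_nbhs_nbhs; split => //; exact: img_open.
have n2 : \forall z \near y, dom j (param i z).
  apply: (param_continuous iy); apply: open_nbhs_nbhs; split; first exact: dom_open.
  by rewrite py.
apply: filterS2 n1 n2 => z /imgP[dz cz] djz.
by exists (param i z).
Qed.

Lemma metric_posdef (R : realType) (d : nat) (M : riemannianManifold R d)
    (i : chart_index M) (y : 'rV[R]_d) : (chart i @` dom i) y ->
  posdef (metric i y).
Proof.
by move=> iy; split; [exact: Defs.metric_sym|move=> v v0; exact: metric_pos].
Qed.

Lemma metric_continuous (R : realType) (d : nat) (M : riemannianManifold R d)
    (i : chart_index M) (y : 'rV[R]_d) : (chart i @` dom i) y ->
  {for y, continuous (metric i)}.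
Proof. by have [+ _] := metric_smooth i 0%N; exact. Qed.

(* A function psi <= B of slope at most c wherever psi < B grows by at most c l
   along a curve of length l.  For psi = min (B, distance to a point), only the
   points near the base point matter, so one chart suffices. *)
Definition slope_le (R : realType) (d : nat) (M : riemannianManifold R d)
    (psi : M -> R) (c : R) (x : M) : Prop :=
  exists2 j, dom j x & forall e : R, 0 < e -> \forall y \near chart j x,
    psi (param j y) <= psi x + c * gram_norm (metric j (chart j x)) (y - chart j x)
      + e * `|y - chart j x|.

Definition lower_semicont (T : topologicalType) (R : realType) (psi : T -> R) :=
  forall x a, a < psi x -> \forall y \near x, a < psi y.

(** [dini_le] with [F] equal to [c] times the length of the arc so far. Where [psi] has reached [B]
    it cannot grow. Elsewhere its slope is bounded in some chart [j], possibly different from [i],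
    and the invariance of the metric under transition maps converts the speed. *)
Lemma arc_growth (R : realType) (d : nat) (M : riemannianManifold R d)
    (psi : M -> R) (c B : R) (i : chart_index M) (s : R -> 'rV[R]_d) :
  0 <= c -> lower_semicont psi -> (forall x, psi x <= B) ->
  (forall x, psi x < B -> slope_le psi c x) ->
  (forall t, derivable s t 1) -> continuous (derive1 s) ->
  (forall t, 0 <= t <= 1 -> (chart i @` dom i) (s t)) ->
  psi (param i (s 1)) <= psi (param i (s 0)) +
   c * \int[lebesgue_measure]_(t in `[0, 1])
           gram_norm (metric i (s t)) (derive1 s t).
Proof.
move=> c0 lsc psiB slope ds cds ims.
have cs : continuous s.
  by move=> t; apply: differentiable_continuous; apply/derivable1_diffP.
pose w t := gram_norm (metric i (s t)) (derive1 s t).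
(* Only on [[0, 1]]: elsewhere [s] may leave the chart. *)
have cvw t : 0 <= t <= 1 -> {for t, continuous w}.
  move=> t01; apply: cvg_gram_norm; last exact: cds.
  by apply: (cvg_comp _ _ (cs t)); exact/metric_continuous/ims.
have cw : {within `[0, 1], continuous w}.
  apply: continuous_in_subspaceT => t; rewrite inE/= in_itv/= => t01; exact: cvw.
pose F t := c * \int[lebesgue_measure]_(u in `[0, t]) w u.
pose phi t := psi (param i (s t)).
have F0 : F 0 = 0 by rewrite /F set_itv1 Rintegral_set1 mulr0.
suff : phi 1 - phi 0 <= F 1 - F 0 by rewrite F0 subr0 lerBlDl.
apply: (@dini_le R phi F).
- move=> t /andP[t0 t1] e e0.
  have it := ims t; rewrite (ltW t0) t1 in it.
  have : \forall z \near s t, phi t - e < psi (param i z).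
    have pc := param_continuous (it isT).
    apply: (pc [set z | phi t - e < psi z]); apply: lsc; rewrite /phi; lra.
  by move=> /(cs t) H; near=> u; apply/ltW; near: u; exact: H.
- move=> t /andP[t0 t1] e e0.
  have t01 : 0 <= t <= 1 by rewrite t0 ltW.
  have it := ims t t01.
  have [pB|pB] := eqVneq (psi (param i (s t))) B.
    near=> h => h1.
    have h0 : 0 <= h by near: h; exact: nbhs_right_ge.
    have Fge : 0 <= F (t + h) - F t.
      rewrite /F -mulrBr mulr_ge0//.
      have := @Rintegral_increment_ge R w t (t + h) 0 cw t0.
      rewrite mul0r lerDl => /(_ h0 h1); apply => u _; exact: gram_norm_ge0.
    have := psiB (param i (s (t + h))); rewrite /phi pB.
    have : 0 <= e * h by rewrite mulr_ge0// ltW.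
    lra.
  have {pB}/slope [j dj Hj] : psi (param i (s t)) < B by rewrite lt_neqAle pB psiB.
  have [di ci] := imgP it.
  pose x := param i (s t); rewrite -/x in dj Hj di ci.
  pose T := chart j \o param i.
  pose U := chart i @` (dom i `&` dom j).
  have Ust : U (s t) by exists x.
  have dT : differentiable T (s t).
    by apply: smooth_differentiable Ust; [exact: overlap_open|exact: transition_smooth].
  pose D := 'd T (s t) (derive1 s t).
  pose k u := T (s u).
  have dk : differentiable k t.
    apply: (@differentiable_comp R _ _ _ s T); last exact: dT.
    by apply/derivable1_diffP.
  have Dk : forall h : R, 'd k t h = h *: D.
    move=> h; have -> : 'd k t = 'd T (s t) \o 'd s t :> (R -> 'rV[R]_d).
      by apply: (@diff_comp R _ _ _ s T) => //; apply/derivable1_diffP.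
    by rewrite /= deriv1E// linearZ.
  have jx : (chart j @` dom j) (chart j x) by exact: img_dom.
  pose G := metric j (chart j x).
  have pG : posdef G by exact: metric_posdef.
  have GD : gram_norm G D = w t.
    rewrite /w /gram_norm; congr Num.sqrt.
    have := @metric_transition _ _ M i j x (derive1 s t) (derive1 s t) di dj.
    by rewrite /= ci => ->.
  have [CG CG0 HCG] := gram_norm_le_coord G.
  (* The total error is [e1 * K * h]: [c * CG] comes from linearising [k], [|D| + 1] from the error
     term of the slope bound, and the last [c] from the variation of the speed [w]. *)
  pose K := c * CG + `|D| + 1 + c.
  have K0 : 0 < K by rewrite ltr_wpDr// ltr_wpDl// addr_ge0// mulr_ge0// ltW.
  pose e1 := Num.min 1 (e / K).
  have e10 : 0 < e1 by rewrite lt_min ltr01 divr_gt0.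
  have e1K : e1 * K <= e.
    by rewrite -ler_pdivlMr// /e1 ge_min lexx orbT.
  have e11 : e1 <= 1 by rewrite /e1 ge_min lexx.
  have kt : k t = chart j x by [].
  have N1 : \forall u \near t, psi (param j (k u)) <= psi x +
      c * gram_norm G (k u - k t) + e1 * `|k u - k t|.
    have ck := differentiable_continuous dk.
    have Hk : nbhs (k t) [set y | psi (param j y) <= psi x +
        c * gram_norm G (y - k t) + e1 * `|y - k t|].
      by rewrite kt; exact: Hj.
    exact: (ck _ Hk).
  have N2 : \forall u \near t, U (s u).
    apply: (cs t U); apply: open_nbhs_nbhs; split; [exact: overlap_open|exact: Ust].
  have N3 := diff_approx dk e10.
  have N4 : \forall u \near t, w t - e1 <= w u.
    have /cvgrPdist_le /(_ e1 e10) := cvw t t01; apply: filterS => u.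
    by rewrite ler_norml => /andP[_]; rewrite lerBlDr -lerBlDl.
  have : \forall u \near t, [/\ psi (param j (k u)) <= psi x +
      c * gram_norm G (k u - k t) + e1 * `|k u - k t|, U (s u),
      `|k u - k t - 'd k t (u - t)| <= e1 * `|u - t| & w t - e1 <= w u].
    by near=> u; split; near: u; [exact: N1|exact: N2|exact: N3|exact: N4].
  move=> /nbhs_ballP [r /= r0 H].
  near=> h => h1.
  have h0 : 0 < h by near: h; exact: nbhs_right_gt.
  have hr : h < r by near: h; exact: nbhs_right_lt.
  have inb u : t <= u <= t + h -> ball t r u.
    by move=> /andP[tu uh]; rewrite /ball/= ler0_norm ?subr_le0//; lra.
  have thb : t <= t + h <= t + h by rewrite lerDl lexx (ltW h0).
  have [M1 M2 M3 _] := H (t + h) (inb _ thb).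
  have Finc : c * ((w t - e1) * h) <= F (t + h) - F t.
    rewrite /F -mulrBr ler_wpM2l//.
    have := @Rintegral_increment_ge R w t (t + h) (w t - e1) cw t0.
    rewrite lerDl (ltW h0) addrAC subrr add0r => /(_ isT h1); apply => u tu.
    by have [] := H u (inb _ tu).
  have pk : param j (k (t + h)) = param i (s (t + h)).
    by case: M2 => z [zi zj] zs; rewrite /k /T /= -zs (chartK zi) chartK.
  rewrite pk in M1.
  have th : t + h - t = h by ring.
  rewrite th Dk (gtr0_norm h0) in M3.
  pose E := k (t + h) - k t - h *: D.
  have kE : k (t + h) - k t = h *: D + E by rewrite /E subrKC.
  have kn : `|k (t + h) - k t| <= h * (`|D| + 1).
    rewrite kE (le_trans (ler_normD _ _))// normrZ (gtr0_norm h0) mulrDr mulr1 lerD2l.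
    by rewrite (le_trans M3)// ler_piMl// ltW.
  have kg : gram_norm G (k (t + h) - k t) <= h * w t + CG * (e1 * h).
    rewrite kE (le_trans (gram_normD _ _ pG))// gram_normZ (gtr0_norm h0) GD lerD2l.
    by rewrite (le_trans (HCG _))// ler_pM2l.
  rewrite /phi -/x.
  have a1 := ler_wpM2l c0 kg.
  have a2 := ler_wpM2l (ltW e10) kn.
  have a3 : e1 * K * h <= e * h by rewrite ler_pM2r.
  rewrite /K in a3.
  lra.
- move=> t u t0 tu u1; rewrite /F ler_wpM2l// -subr_ge0.
  have := @Rintegral_increment_ge R w t u 0 cw t0 tu u1.
  by rewrite mul0r; apply => v _; exact: gram_norm_ge0.
Unshelve. all: by end_near. Qed.

Lemma curve_growth (R : realType) (d : nat) (M : riemannianManifold R d)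
    (psi : M -> R) (c B : R) : 0 <= c -> lower_semicont psi ->
  (forall x, psi x <= B) -> (forall x, psi x < B -> slope_le psi c x) ->
  forall a b l, curve_length a b l -> psi b <= psi a + c * l.
Proof.
move=> c0 lsc psiB slope a b l; elim => [x|i s y l' ds cds ims _ IH].
  by rewrite mulr0 addr0.
rewrite mulrDr addrA (le_trans IH)// lerD2r.
exact: (arc_growth c0 lsc psiB slope ds cds ims).
Qed.

Lemma curve_length_ge0 (R : realType) (d : nat) (M : riemannianManifold R d)
    (a b : M) l : curve_length a b l -> 0 <= l.
Proof.
elim => // i s y l' _ _ _ _ IH; rewrite addr_ge0// Rintegral_ge0// => t _.
exact: gram_norm_ge0.
Qed.

Lemma rdist_ltP (R : realType) (d : nat) (M : riemannianManifold R d)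
    (a b : M) (r : R) :
  (rdist a b < r%:E)%E <-> exists2 l, curve_length a b l & l < r.
Proof.
split=> [/ereal_inf_lt[_ [l cl <-]]|[l cl lr]]; first by exists l.
by apply: le_lt_trans (_ : (l%:E < r%:E)%E) => //; apply: ereal_inf_lbound; exists l.
Qed.

Lemma rdist_growth (R : realType) (d : nat) (M : riemannianManifold R d)
    (psi : M -> R) (c B : R) : 0 < c -> lower_semicont psi ->
  (forall x, psi x <= B) -> (forall x, psi x < B -> slope_le psi c x) ->
  forall a b r, (rdist a b < r%:E)%E -> psi b < psi a + c * r.
Proof.
move=> c0 lsc psiB slope a b r /rdist_ltP[l cl lr].
apply: le_lt_trans (curve_growth (ltW c0) lsc psiB slope cl) _.
by rewrite ltrD2l ltr_pM2l.
Qed.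

Lemma curve_length_cat (R : realType) (d : nat) (M : riemannianManifold R d)
    (a b z : M) l1 l2 : curve_length a b l1 -> curve_length b z l2 ->
  curve_length a z (l1 + l2).
Proof.
move=> c1 c2; elim: c1 c2 => [x|i s y l ds cs ims _ IH] c2; first by rewrite add0r.
by rewrite -addrA; apply: curve_length_cons => //; exact: IH.
Qed.

Lemma rdist_tri (R : realType) (d : nat) (M : riemannianManifold R d)
    (a b z : M) (r s : R) :
  (rdist a b < r%:E)%E -> (rdist b z < s%:E)%E -> (rdist a z < (r + s)%:E)%E.
Proof.
move=> /rdist_ltP[l cl lr] /rdist_ltP[k ck ks]; apply/rdist_ltP.
by exists (l + k); [exact: curve_length_cat ck|rewrite ltrD].
Qed.

Lemma rdist_ge0 (R : realType) (d : nat) (M : riemannianManifold R d)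
    (a b : M) : (0 <= rdist a b)%E.
Proof.
by apply: le_ereal_inf_tmp => _ [l /curve_length_ge0 l0 <-]; rewrite lee_fin.
Qed.

Lemma rdist_refl (R : realType) (d : nat) (M : riemannianManifold R d)
    (a : M) : rdist a a = 0%E.
Proof.
apply/eqP; rewrite eq_le rdist_ge0 andbT; apply: ereal_inf_lbound.
by exists 0 => //; exact: curve_length_nil.
Qed.

(** * The distance compared with the metric in one chart *)

(** Positive definiteness at [p] bounds the coordinate norm by the form there, which turns a small
    additive change of the coefficients into a multiplicative one. *)
Lemma gram_norm_near (R : realType) (d : nat) (M : riemannianManifold R d)
    (i : chart_index M) (p : 'rV[R]_d) (eta : R) :
  (chart i @` dom i) p -> 0 < eta ->
  \forall y \near p, (chart i @` dom i) y /\ forall v,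
     gram_norm (metric i y) v <= (1 + eta) * gram_norm (metric i p) v /\
     gram_norm (metric i p) v <= (1 + eta) * gram_norm (metric i y) v.
Proof.
move=> ip eta0; have pG := metric_posdef ip.
have [c c0 Hc] := gram_norm_ge_coord pG.
(* [k <= 1/2] gives [A <= 2 * B], so that the error [k * A] can also be charged to the form [B] at
   [y]. *)
pose k := Num.min 2^-1 (eta / 2).
have k0 : 0 < k by rewrite lt_min invr_gt0 ltr0n divr_gt0.
have k1 : k <= 2^-1 by rewrite /k ge_min lexx.
have k2 : k <= eta / 2 by rewrite /k ge_min lexx orbT.
pose e := k * c ^+ 2 / d.+1%:R ^+ 2.
have e0 : 0 < e by rewrite divr_gt0 ?mulr_gt0 ?exprn_gt0.
have /cvgrPdist_le/(_ e e0) Hm := metric_continuous ip.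
have Ho : \forall y \near p, (chart i @` dom i) y.
  by apply: open_nbhs_nbhs; split => //; exact: img_open.
near=> y.
have iy : (chart i @` dom i) y by near: y.
have my : `|metric i p - metric i y| <= e by near: y.
have pY := metric_posdef iy.
split => // v.
have key : `|gram_form (metric i p) v v - gram_form (metric i y) v v| <=
    k * gram_form (metric i p) v v.
  rewrite -gram_formBg.
  have := @gram_form_le R d (metric i p - metric i y) v v e (ltW e0).
  move=> /(_ (fun a b => le_trans (coord_le_norm _ a b) my)) /le_trans; apply.
  have cv : (c * `|v|) ^+ 2 <= gram_form (metric i p) v v.
    rewrite -gram_norm_sqr// ler_pXn2r// nnegrE ?gram_norm_ge0//.
    by rewrite mulr_ge0// ltW.
  have dd : d%:R ^+ 2 / d.+1%:R ^+ 2 <= 1 :> R.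
    by rewrite ler_pdivrMr ?exprn_gt0// mul1r ler_pXn2r ?nnegrE// ler_nat.
  apply: (@le_trans _ _ (k * (c * `|v|) ^+ 2)); last by rewrite ler_pM2l.
  have -> : e * d%:R ^+ 2 * (`|v| * `|v|) =
     k * (c * `|v|) ^+ 2 * (d%:R ^+ 2 / d.+1%:R ^+ 2) by rewrite /e; ring.
  by rewrite ler_piMr// mulr_ge0 ?sqr_ge0// ltW.
set A := gram_form (metric i p) v v in key.
set B := gram_form (metric i y) v v in key.
have A0 : 0 <= A by exact: gram_form_ge0.
have B0 : 0 <= B by exact: gram_form_ge0.
move: key; rewrite ler_norml => /andP[h1 h2].
have kA : k * A <= 2^-1 * A by rewrite ler_wpM2r.
have kA' : k * A <= eta / 2 * A by rewrite ler_wpM2r.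
have E (x z : R) : 0 <= x -> 0 <= z -> x <= (1 + eta) ^+ 2 * z ->
    Num.sqrt x <= (1 + eta) * Num.sqrt z.
  move=> x0 z0 /ler_wsqrtr; rewrite sqrtrM ?sqr_ge0// sqrtr_sqr ger0_norm//.
  by rewrite addr_ge0// ltW.
have ee : 0 <= eta ^+ 2 by rewrite sqr_ge0.
have eA : 0 <= eta * A by rewrite mulr_ge0// ltW.
have eeA : 0 <= eta ^+ 2 * A by rewrite mulr_ge0.
have eeB : 0 <= eta ^+ 2 * B by rewrite mulr_ge0.
have eB : eta * A <= eta * (2 * B) by rewrite ler_pM2l//; lra.
split; apply: E => //; rewrite -/A -/B sqrrD expr1n mul1r mulrDl mulrDl mul1r; lra.
Unshelve. all: by end_near. Qed.

(** The straight coordinate segment is an admissible curve: balls are convex, so it stays where the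
    metric is within a factor [1 + eta] of its value at [p]. *)
Lemma rdist_segment (R : realType) (d : nat) (M : riemannianManifold R d)
    (i : chart_index M) (p : 'rV[R]_d) (eta : R) :
  (chart i @` dom i) p -> 0 < eta ->
  exists2 r : R, 0 < r & forall q q', `|q - p| < r -> `|q' - p| < r ->
   (rdist (param i q) (param i q') <=
      ((1 + eta) * gram_norm (metric i p) (q' - q))%:E)%E.
Proof.
move=> ip eta0; have /nbhs_ballP[r /= r0 H] := gram_norm_near ip eta0.
exists r => // q q' qr q'r.
pose s (t : R) : 'rV[R]_d := q + t *: (q' - q).
have s0 : s 0 = q by rewrite /s scale0r addr0.
have s1 : s 1 = q' by rewrite /s scale1r addrC subrK.
pose v := q' - q.
have ds (t : R) : is_derive t 1 s v.
  have := @is_derive_line R _ _ id q v t; rewrite derive_id; apply.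
  exact: derivable_id.
have s'E : derive1 s = cst v :> (R -> 'rV[R]_d).
  by apply/funext => t; rewrite derive1E; exact: derive_val.
have sb t : 0 <= t <= 1 -> `|s t - p| < r.
  move=> /andP[t0 t1].
  have -> : s t - p = (1 - t) *: (q - p) + t *: (q' - p).
    rewrite /s !scalerBr !scalerBl !scale1r.
    by apply/rowP => k; rewrite !mxE; ring.
  rewrite (le_lt_trans (ler_normD _ _))// !normrZ (ger0_norm t0) ger0_norm ?subr_ge0//.
  have am : `|q - p| <= Num.max `|q - p| `|q' - p| by rewrite le_max lexx.
  have bm : `|q' - p| <= Num.max `|q - p| `|q' - p| by rewrite le_max lexx orbT.
  have mr : Num.max `|q - p| `|q' - p| < r by rewrite gt_max qr q'r.
  have := ler_wpM2l t0 bm; have := ler_wpM2l (_ : 0 <= 1 - t) am.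
  rewrite subr_ge0 => /(_ t1) h1 h2.
  by apply: le_lt_trans mr; lra.
have inb t : 0 <= t <= 1 -> ball p r (s t).
  by move=> /sb; rewrite -ball_normE/= distrC.
have ims t : 0 <= t <= 1 -> (chart i @` dom i) (s t) by move=> /inb/H[].
have C : curve_length (param i (s 0)) (param i (s 1))
    ((\int[lebesgue_measure]_(t in `[0, 1])
      gram_norm (metric i (s t)) (derive1 s t)) + 0).
  apply: curve_length_cons => //; first by rewrite s'E; exact: cst_continuous.
  exact: curve_length_nil.
rewrite s0 s1 addr0 in C.
apply: ge_ereal_inf; eexists; first by eexists; [exact: C|reflexivity].
rewrite lee_fin.
have -> : (1 + eta) * gram_norm (metric i p) (q' - q) =
   \int[lebesgue_measure]_(t in `[0, 1]) ((1 + eta) * gram_norm (metric i p) v).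
  by rewrite Rintegral_cst//= lebesgue_measure_itv/= lte_fin ltr01 oppr0 adde0 /= mulr1.
apply: le_Rintegral => //.
- apply: continuous_compact_integrable; first exact: segment_compact.
  apply: continuous_in_subspaceT => t; rewrite inE/= in_itv/= => t01.
  rewrite s'E; apply: cvg_gram_norm; last exact: cvg_cst.
  have cs : {for t, continuous s}.
    by apply: differentiable_continuous; apply/derivable1_diffP.
  by apply: (cvg_comp _ _ cs); exact/metric_continuous/ims.
- apply: continuous_compact_integrable; first exact: segment_compact.
  exact/continuous_subspaceT/cst_continuous.
- move=> t /=; rewrite in_itv/= => t01; rewrite s'E.
  by have [_ /(_ v)[]] := H _ (inb _ t01).
Qed.
(** Confines [rdist_growth] to one chart: [h] is capped at [B] and extended by [B] off [K]. Growing
    by less than the room left under the cap, the extension is still below [B] at [b], and this is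
    possible only if [b] comes from [V]. *)
Lemma coord_growth (R : realType) (d : nat) (M : riemannianManifold R d)
    (i : chart_index M) (K V : set 'rV[R]_d) (h : 'rV[R]_d -> R) (c B : R) :
  compact K -> K `<=` chart i @` dom i -> open V -> V `<=` K -> 0 < c ->
  (forall y a, K y -> a < h y -> \forall z \near y, a < h z) ->
  (forall y, K y -> h y < B -> V y) ->
  (forall y, V y -> h y < B -> forall e : R, 0 < e -> \forall z \near y,
     h z <= h y + c * gram_norm (metric i y) (z - y) + e * `|z - y|) ->
  forall q b r, V q -> h q + c * r <= B -> (rdist (param i q) b < r%:E)%E ->
  exists q', [/\ V q', param i q' = b & h q' < h q + c * r].
Proof.
move=> cK Ki oV VK c0 lsch hV sl q b r Vq qB qb.
pose psi (x : M) := if `[< dom i x /\ K (chart i x) >] then Num.min B (h (chart i x)) else B.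
have psiB x : psi x <= B.
  by rewrite /psi; case: ifP => // _; rewrite ge_min lexx.
have psiV x t : t <= B -> psi x < t -> [/\ dom i x, V (chart i x) & h (chart i x) < t].
  move=> tB; rewrite /psi; case: ifPn => [/asboolP[dx Kx]|_ Bt]; last first.
    by have := lt_le_trans Bt tB; rewrite ltxx.
  rewrite gt_min => /orP[Bt|ht]; first by have := lt_le_trans Bt tB; rewrite ltxx.
  split => //; apply: hV => //; exact: lt_le_trans ht tB.
have cKM : closed K by apply: compact_closed => //; exact: norm_hausdorff.
have lsc : lower_semicont psi.
  move=> x a ax; have aB : a < B by exact: lt_le_trans ax (psiB x).
  (* Below the cap, the sublevel sets of the extension are images of the compact sets [Ka], hence
     closed in the Hausdorff space [M]. This gives semicontinuity also at points outside the
     chart. *)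
  pose Ka := K `&` [set y | h y <= a].
  have clKa : closed Ka.
    rewrite closedE => y H; apply: contrapT => nKy; apply: H.
    case: (pselect (K y)) => Ky; last first.
      have : open (~` K) by rewrite openC.
      rewrite openE => /(_ y Ky); apply: filterS => z /= nKz [Kz _]; exact: nKz.
    have [hy|hy] := leP (h y) a; last first.
      have := lsch y a Ky hy; apply: filterS => z az [_ /= za].
      by have := lt_le_trans az za; rewrite ltxx.
    by exfalso; apply: nKy.
  have cKa : compact Ka.
    by apply: (subclosed_compact clKa cK) => y [].
  have cP : compact (param i @` Ka).
    apply: continuous_compact cKa; apply: continuous_in_subspaceT => y.
    by rewrite inE => -[Ky _]; exact/param_continuous/Ki.
  have clP : closed (param i @` Ka).
    by apply: compact_closed cP; exact: carrier_hausdorff.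
  have nP : (~` (param i @` Ka)) x.
    move=> [y [Ky hy] yx].
    have [dx cx] := imgP (Ki _ Ky).
    rewrite yx in dx cx.
    move: ax; rewrite /psi; case: ifPn => [_|/asboolP]; last by rewrite cx; tauto.
    by rewrite /= in hy; rewrite cx lt_min => /andP[_]; rewrite ltNge hy.
  have : open (~` (param i @` Ka)) by rewrite openC.
  rewrite openE => /(_ x nP); apply: filterS => z nz.
  rewrite ltNge; apply/negP => za; apply: nz.
  move: za; rewrite /psi; case: ifPn => [/asboolP[dz Kz]|_]; last by rewrite leNgt aB.
  rewrite ge_min leNgt aB /= => hz.
  by exists (chart i z) => //; exact: chartK.
have slope x : psi x < B -> slope_le psi c x.
  move=> /(psiV _ _ (lexx _))[dx Vx hx].
  have px : psi x = h (chart i x).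
    rewrite /psi asboolT; last by split=> //; exact: VK.
    by apply/min_idPr; exact: ltW.
  exists i => // e e0; rewrite px.
  have nV : \forall z \near chart i x, V z by exact: open_nbhs_nbhs.
  have := sl _ Vx hx e e0; apply: filterS2 nV => z Vz; apply: le_trans.
  have [dz cz] := imgP (Ki _ (VK _ Vz)).
  rewrite /psi cz asboolT; last by split=> //; exact: VK.
  by rewrite ge_min lexx orbT.
have := rdist_growth c0 lsc psiB slope qb.
have [dq cq] := imgP (Ki _ (VK _ Vq)).
have pq : psi (param i q) <= h q.
  rewrite /psi cq asboolT; last by split=> //; exact: VK.
  by rewrite ge_min lexx orbT.
move=> /lt_le_trans /(_ (_ : _ <= h q + c * r)); rewrite lerD2r => /(_ pq).
move=> /(psiV _ _ qB)[db Vb hb].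
by exists (chart i b); split => //; exact: chartK.
Qed.

Lemma continuous_affine (R : realType) (d : nat) (v p : 'rV[R]_d) (c : R) :
  continuous (fun y : 'rV[R]_d => v + c *: (y - p)).
Proof.
move=> y; apply: (@cvgD _ _ _ (nbhs (y : 'rV[R]_d))); first exact: cvg_cst.
by apply: cvgZr; apply: cvgB; [exact: cvg_id|exact: cvg_cst].
Qed.

Lemma continuous_gram_dist (R : realType) (d : nat) (G : 'M[R]_d) (p : 'rV[R]_d) :
  continuous (fun y : 'rV[R]_d => gram_norm G (y - p)).
Proof.
move=> y; apply: (@cvg_gram_norm R d _ (nbhs (y : 'rV[R]_d)) (fun=> G) (fun y => y - p) G (y - p)).
  exact: cvg_cst.
by apply: cvgB; [exact: cvg_id|exact: cvg_cst].
Qed.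

Lemma gram_ball_compact (R : realType) (d : nat) (G : 'M[R]_d) (p : 'rV[R]_d) (r : R) :
  posdef G -> compact [set y | gram_norm G (y - p) <= r].
Proof.
move=> pG; have [c c0 Hc] := gram_norm_ge_coord pG.
apply: bounded_closed_compact.
  exists (r / c + `|p|); split; first by rewrite num_real.
  move=> x xr y /= yr; apply/ltW; apply: le_lt_trans xr.
  rewrite -[y](subrK p) (le_trans (ler_normD _ _))// lerD2r.
  by rewrite ler_pdivlMr// mulrC; exact: le_trans yr.
have -> : [set y | gram_norm G (y - p) <= r] =
   (fun y => gram_norm G (y - p)) @^-1` [set t | t <= r] by [].
apply: preimage_closed; last exact: closed_le.
by move=> y _; exact: continuous_gram_dist.
Qed.

Lemma gram_ball_open (R : realType) (d : nat) (G : 'M[R]_d) (p : 'rV[R]_d) (r : R) :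
  posdef G -> open [set y | gram_norm G (y - p) < r].
Proof.
move=> pG.
have -> : [set y | gram_norm G (y - p) < r] =
   (fun y => gram_norm G (y - p)) @^-1` [set t | t < r] by [].
apply: open_comp; last exact: open_lt.
by move=> y _; exact: continuous_gram_dist.
Qed.

Lemma near_gram_ball (R : realType) (d : nat) (G : 'M[R]_d) (p : 'rV[R]_d)
    (A : set 'rV[R]_d) : posdef G -> nbhs p A ->
  exists2 r : R, 0 < r & [set y | gram_norm G (y - p) <= r] `<=` A.
Proof.
move=> pG /nbhs_ballP[r /= r0 rA]; have [c c0 Hc] := gram_norm_ge_coord pG.
exists (c * r / 2); first by rewrite divr_gt0// mulr_gt0.
move=> y /= yr; apply: rA; rewrite -ball_normE/= distrC.
rewrite -(ltr_pM2l c0); apply: le_lt_trans (Hc _) _; apply: le_lt_trans yr _.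
by rewrite ltr_pdivrMr// ltr_pMr ?mulr_gt0// ltr1n.
Qed.

(** The converse of [rdist_segment], which moreover locates nearby points in the chart. It is
    [coord_growth] for the coordinate distance to [q], whose slope near [p] is at most [1 + eta]. *)
Lemma rdist_lower (R : realType) (d : nat) (M : riemannianManifold R d)
    (i : chart_index M) (p : 'rV[R]_d) (eta : R) :
  (chart i @` dom i) p -> 0 < eta ->
  exists2 r0 : R, 0 < r0 & forall q, gram_norm (metric i p) (q - p) < r0 ->
    forall b r, (1 + eta) * r <= r0 -> (rdist (param i q) b < r%:E)%E ->
    exists q', [/\ (chart i @` dom i) q', param i q' = b &
       gram_norm (metric i p) (q' - q) < (1 + eta) * r].
Proof.
move=> ip eta0; have pG := metric_posdef ip; set G := metric i p.
have [r1 r10 H1] := near_gram_ball pG (gram_norm_near ip eta0).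
(* Half of [r1] is for the offset of [q] from [p], half for the motion away from [q]. *)
exists (r1 / 2); first by rewrite divr_gt0.
move=> q qp b r rr0 qb.
pose K := [set y | gram_norm G (y - p) <= r1].
pose V := [set y | gram_norm G (y - p) < r1].
have VK : V `<=` K by move=> y /=; exact: ltW.
have Ki : K `<=` chart i @` dom i by move=> y /H1[].
have nZ y z : gram_norm G (z - q) <= gram_norm G (y - q) + gram_norm G (z - y).
  apply: le_trans (gram_normD _ _ pG).
  by rewrite -/G (_ : y - q + (z - y) = z - q)// addrC addrA subrK.
have qq : gram_norm G (q - q) = 0 by rewrite subrr gram_norm0.
have [|||||||q' [Vq' q'b]] := @coord_growth R d M i K V (fun y => gram_norm G (y - q)) (1 + eta)
    (r1 / 2) (@gram_ball_compact R d G p r1 pG) Ki (@gram_ball_open R d G p r1 pG) VK _ _ _ _ q b r.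
- by rewrite addr_gt0.
- move=> y a _ ay.
  have : open [set z | a < gram_norm G (z - q)].
    have -> : [set z | a < gram_norm G (z - q)] =
      (fun y => gram_norm G (y - q)) @^-1` [set t | a < t] by [].
    apply: open_comp; last exact: open_gt.
    by move=> z _; exact: continuous_gram_dist.
  by rewrite openE => /(_ y ay).
- move=> y _ yq /=; have := gram_normD (y - q) (q - p) pG.
  by rewrite -/G subrKA => /le_lt_trans; apply; lra.
- move=> y Vy _ e e0; near=> z.
  have [_ /(_ (z - y))[_ h]] := H1 y (VK _ Vy).
  have := nZ y z.
  have : 0 <= e * `|z - y| by rewrite mulr_ge0// ltW.
  by rewrite -/G in h; lra.
- by rewrite /V/=; lra.
- by rewrite qq add0r.
- exact: qb.
by rewrite qq add0r => hq; exists q'; split => //; exact/Ki/VK.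
Unshelve. all: by end_near. Qed.

Lemma near_rdist (R : realType) (d : nat) (M : riemannianManifold R d)
    (x : M) (e : R) : 0 < e ->
  \forall y \near x, (rdist x y < e%:E)%E /\ (rdist y x < e%:E)%E.
Proof.
move=> e0; pose i := chart_at x.
have dx : dom i x by exact: dom_chart_at.
have ip := img_dom dx.
have [r r0 H] := rdist_segment ip ltr01.
have [C C0 HC] := gram_norm_le_coord (metric i (chart i x)).
pose r' := Num.min r (e / (2 * C)).
have r'0 : 0 < r' by rewrite lt_min r0 divr_gt0// mulr_gt0.
have n1 : nbhs x (dom i) by apply: open_nbhs_nbhs; split => //; exact: dom_open.
have n2 : \forall y \near x, `|chart i x - chart i y| < r'.
  by have /cvgrPdist_lt := chart_continuous dx; apply.
apply: filterS2 n1 n2 => y dy.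
rewrite lt_min => /andP[cr ce].
have b1 : `|chart i x - chart i x| < r by rewrite subrr normr0.
have b2 : `|chart i y - chart i x| < r by rewrite distrC.
have fin v : `|v| = `|chart i x - chart i y| ->
    (((1 + 1) * gram_norm (metric i (chart i x)) v)%:E < e%:E)%E.
  move=> vE; rewrite lte_fin; apply: le_lt_trans (_ : 2 * (C * `|v|) < e).
    by rewrite ler_pM2l// addr_gt0.
  by rewrite vE mulrA mulrC -ltr_pdivlMr// mulr_gt0.
have := H _ _ b1 b2; have := H _ _ b2 b1; rewrite !chartK// => h1 h2.
by split; [apply: le_lt_trans h2 _|apply: le_lt_trans h1 _]; apply: fin;
  rewrite // distrC.
Qed.

Lemma rdist_ball_open (R : realType) (d : nat) (M : riemannianManifold R d)
    (a : M) (r : R) :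
  open [set x | (rdist a x < r%:E)%E] /\ open [set x | (rdist x a < r%:E)%E].
Proof.
have gap (z : \bar R) : (0 <= z)%E -> (z < r%:E)%E ->
    exists2 e : R, 0 < e & (z < (r - e)%:E)%E.
  case: z => // z _; rewrite lte_fin => zr; exists ((r - z) / 2); first lra.
  by rewrite lte_fin; lra.
split; rewrite openE => x /= /(gap _ (rdist_ge0 _ _))[e e0 xe];
  have := near_rdist x e0; apply: filterS => y [xy yx] /=.
  by have := rdist_tri xe xy; rewrite subrK.
by have := rdist_tri yx xe; rewrite addrC subrK.
Qed.

Lemma rdist_triangle (R : realType) (d : nat) (M : riemannianManifold R d)
    (a b z : M) : (rdist a z <= rdist a b + rdist b z)%E.
Proof.
case E : (rdist a b) (rdist_ge0 a b) => [x| |]// _; last first.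
  by rewrite addye ?leey// gt_eqF// (lt_le_trans _ (rdist_ge0 _ _)).
case F : (rdist b z) (rdist_ge0 b z) => [y| |]// _; last by rewrite addey ?leey.
apply/lee_addgt0Pr => e e0; apply/ltW.
have e2 : 0 < e / 2 by rewrite divr_gt0.
have h1 : (rdist a b < (x + e / 2)%:E)%E by rewrite E lte_fin ltrDl.
have h2 : (rdist b z < (y + e / 2)%:E)%E by rewrite F lte_fin ltrDl.
by have := rdist_tri h1 h2; rewrite addrACA -splitr.
Qed.

Lemma rdist_gt_open (R : realType) (d : nat) (M : riemannianManifold R d)
    (a : M) (r : R) : open [set x | (r%:E < rdist a x)%E].
Proof.
rewrite openE => x /= rx.
have [e e0 re] : exists2 e : R, 0 < e & ((r + e + e)%:E <= rdist a x)%E.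
  case: (rdist a x) rx => [t| |]// rt; last by exists 1 => //; rewrite leey.
  by exists ((t - r) / 2); move: rt; rewrite lte_fin ?lee_fin; lra.
have := near_rdist x e0; apply: filterS => y [_ yx] /=.
rewrite ltNge; apply/negP => yr.
have ay : (rdist a y < (r + e)%:E)%E by apply: le_lt_trans yr _; rewrite lte_fin ltrDl.
by have := lt_le_trans (rdist_tri ay yx) re; rewrite ltxx.
Qed.

(** The infinitesimal form of [rdist_segment], shaped for checking [slope_le]: the distance to a
    point has slope one. *)
Lemma slope_segment (R : realType) (d : nat) (M : riemannianManifold R d)
    (i : chart_index M) (p : 'rV[R]_d) (e : R) :
  (chart i @` dom i) p -> 0 < e ->
  \forall z \near p,
   (rdist (param i p) (param i z) <= (gram_norm (metric i p) (z - p) + e * `|z - p|)%:E)%E /\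
   (rdist (param i z) (param i p) <= (gram_norm (metric i p) (z - p) + e * `|z - p|)%:E)%E.
Proof.
move=> ip e0; have [C C0 HC] := gram_norm_le_coord (metric i p).
have eC : 0 < e / C by rewrite divr_gt0.
have [r r0 H] := rdist_segment ip eC.
near=> z.
have zr : `|z - p| < r.
  by near: z; apply: cvgr_distC_lt.
have pr : `|p - p| < r by rewrite subrr normr0.
have bnd v : `|v| = `|z - p| -> gram_norm (metric i p) v = gram_norm (metric i p) (z - p) ->
    ((1 + e / C) * gram_norm (metric i p) v <= gram_norm (metric i p) (z - p) + e * `|z - p|).
  move=> vn ->; rewrite mulrDl mul1r lerD2l -mulrA ler_pM2l// mulrC ler_pdivrMr//.
  by rewrite mulrC.
split; [apply: le_trans (H _ _ pr zr) _|apply: le_trans (H _ _ zr pr) _];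
  rewrite lee_fin; apply: bnd => //; first by rewrite distrC.
by rewrite -opprB gram_normN.
Unshelve. all: by end_near. Qed.

(** The cap turns an extended distance into a real function; points of another connected component
    simply sit at height [B]. *)
Definition truncate (R : realType) (B : R) (x : \bar R) : R := fine (Order.min B%:E x).

Lemma truncate_le (R : realType) (B : R) (x : \bar R) : 0 <= B -> (0 <= x)%E ->
  truncate B x <= B.
Proof.
move=> B0; rewrite /truncate; case: x => [x| |]//=.
  by rewrite -EFin_min /= ge_min lexx.
by rewrite min_l// leey.
Qed.

Lemma truncate_lt (R : realType) (B t : R) (x : \bar R) : (0 <= x)%E -> t <= B ->
  (truncate B x < t) = (x < t%:E)%E.
Proof.
rewrite /truncate; case: x => [x| |]//= x0 tB.
  by rewrite -EFin_min /= gt_min lte_fin ltNge tB.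
by rewrite min_l ?leey//= ltNge tB.
Qed.

Lemma truncate_leP (R : realType) (B t : R) (x : \bar R) : (0 <= x)%E -> (x <= t%:E)%E ->
  truncate B x <= t.
Proof.
rewrite /truncate; case: x => [x| |]//= x0.
by rewrite lee_fin -EFin_min /= ge_min => ->; rewrite orbT.
Qed.

Lemma truncate_id (R : realType) (B : R) (x : \bar R) : (0 <= x)%E ->
  truncate B x < B -> x = (truncate B x)%:E.
Proof.
rewrite /truncate; case: x => [x| |]//= x0.
  rewrite -EFin_min /= gt_min ltxx /= => xB.
  by congr EFin; apply/esym/min_idPr; exact: ltW.
by rewrite min_l ?leey//= ltxx.
Qed.

(** No curve is reversed. The truncated distance to [a] has slope at most one and vanishes at [a],
    so it grows by less than [r] along some curve from [a] to [b]. *)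
Lemma rdist_lt_sym (R : realType) (d : nat) (M : riemannianManifold R d)
    (a b : M) (r : R) : (rdist a b < r%:E)%E -> (rdist b a < r%:E)%E.
Proof.
move=> ab.
have r0 : 0 < r by rewrite -lte_fin; exact: le_lt_trans (rdist_ge0 _ _) ab.
pose psi x := truncate r (rdist x a).
have psir x : psi x <= r by apply: truncate_le; [exact: ltW|exact: rdist_ge0].
suff : psi b < psi a + 1 * r.
  have -> : psi a = 0 by rewrite /psi rdist_refl /truncate min_r// lee_fin ltW.
  by rewrite add0r mul1r truncate_lt// rdist_ge0.
apply: (@rdist_growth R d M psi 1 r) => //.
- move=> x t tx; pose e := psi x - t.
  have e0 : 0 < e by rewrite subr_gt0.
  have := near_rdist x e0; apply: filterS => y [xy _].
  rewrite ltNge; apply/negP => yt.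
  have yr : psi y < r by apply: le_lt_trans yt _; exact: lt_le_trans tx (psir x).
  have [f f0 ef] : exists2 f : R, 0 < f & (rdist x y < (e - f)%:E)%E.
    case: (rdist x y) (rdist_ge0 x y) xy => // z _; rewrite lte_fin => ze.
    by exists ((e - z) / 2); [lra|rewrite lte_fin; lra].
  have ya : (rdist y a < (psi y + f)%:E)%E.
    by rewrite (truncate_id (rdist_ge0 _ _) yr) lte_fin -/(psi y) ltrDl.
  have := rdist_tri ef ya.
  have -> : e - f + (psi y + f) = e + psi y by ring.
  rewrite -(@truncate_lt _ r)//; last first.
  - rewrite /e; have := psir x; lra.
  - exact: rdist_ge0.
  by rewrite -/(psi x) /e; lra.
- move=> x xr; exists (chart_at x); first exact: dom_chart_at.
  move=> e e0; have dx := dom_chart_at x; have ip := img_dom dx.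
  have := slope_segment ip e0; apply: filterS => z [_ h2].
  rewrite (chartK dx) in h2; rewrite mul1r -addrA.
  apply: truncate_leP; first exact: rdist_ge0.
  apply/lee_addgt0Pr => f f0.
  have f2 : 0 < f / 2 by rewrite divr_gt0.
  have l1 : (rdist (param (chart_at x) z) x <
     (gram_norm (metric (chart_at x) (chart (chart_at x) x)) (z - chart (chart_at x) x)
      + e * `|z - chart (chart_at x) x| + f / 2)%:E)%E.
    by apply: le_lt_trans h2 _; rewrite lte_fin ltrDl.
  have l2 : (rdist x a < (psi x + f / 2)%:E)%E.
    by rewrite (truncate_id (rdist_ge0 _ _) xr) lte_fin -/(psi x) ltrDl.
  apply/ltW/(lt_le_trans (rdist_tri l1 l2)); rewrite -EFinD lee_fin; lra.
Qed.

Lemma rdistC (R : realType) (d : nat) (M : riemannianManifold R d) (a b : M) :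
  rdist a b = rdist b a.
Proof.
suff H (x y : M) : (rdist x y <= rdist y x)%E by apply/eqP; rewrite eq_le !H.
case E : (rdist y x) (rdist_ge0 y x) => [z| |]// _; last by rewrite leey.
apply/lee_addgt0Pr => e e0; apply/ltW/rdist_lt_sym.
by rewrite E lte_fin ltrDl.
Qed.


(** * Contraction towards a point *)

Lemma near_comp (T U : topologicalType) (f : T -> U) (x : T) (P : U -> Prop) :
  {for x, continuous f} -> (\forall u \near f x, P u) ->
  \forall y \near x, P (f y).
Proof. by move=> cf /cf. Qed.

(** Moving [y] towards [p] by the fraction [s] displaces it by [s * |y - p|]. The metric is
    Lipschitz in coordinates, so its relative change is a small multiple of [s] once [|y - p|] is
    small. *)
Lemma metric_radial_le (R : realType) (d : nat) (M : riemannianManifold R d)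
    (i : chart_index M) (p : 'rV[R]_d) : (chart i @` dom i) p ->
  \forall y \near p, forall s : R, 0 <= s <= 1 -> forall v,
    gram_norm (metric i (p + (1 - s) *: (y - p))) v <=
    (1 + s / 4) * gram_norm (metric i y) v.
Proof.
move=> ip; have pG := metric_posdef ip.
have [r [L [r0 L0 HL]]] := smooth_lipschitz (@img_open _ _ M i) (metric_smooth i) ip.
have [c c0 Hc] := gram_norm_ge_coord pG.
pose D : R := d.+1%:R ^+ 2.
have D0 : 0 < D by rewrite exprn_gt0.
(* Chosen so that [L * (s * k) * D * |v|^2] equals [s / 8 * c^2 * |v|^2], while
   [c^2 * |v|^2 <= 4 * A]. *)
pose k := c ^+ 2 / (8 * L * D).
have k0 : 0 < k by rewrite divr_gt0 ?exprn_gt0// !mulr_gt0.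
have Hn := gram_norm_near ip ltr01.
near=> y => s /andP[s0 s1] v.
have [iy Hy] : (chart i @` dom i) y /\ forall v,
     gram_norm (metric i y) v <= (1 + 1) * gram_norm (metric i p) v /\
     gram_norm (metric i p) v <= (1 + 1) * gram_norm (metric i y) v.
  by near: y.
have yr : `|y - p| < r by near: y; apply: cvgr_distC_lt.
have yk : `|y - p| < k by near: y; apply: cvgr_distC_lt.
set z := p + _.
have zy : z - y = (- s) *: (y - p).
  by apply/rowP => j; rewrite !mxE; ring.
have zp : `|z - p| < r.
  rewrite /z addrC addKr normrZ ger0_norm ?subr_ge0//.
  by apply: le_lt_trans yr; rewrite ler_piMl// gerBl.
have zk : `|z - y| <= s * k.
  by rewrite zy normrZ normrN (ger0_norm s0) ler_wpM2l// ltW.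
have pY := metric_posdef iy.
set A := gram_form (metric i y) v v.
have A0 : 0 <= A by exact: gram_form_ge0.
have key : gram_form (metric i z) v v <= (1 + s / 2) * A.
  have Lz a b : `|(metric i z - metric i y) a b| <= L * (s * k).
    rewrite !mxE; apply: le_trans (HL _ _ yr zp a b) _.
    by rewrite ler_pM2l.
  have c1 : 0 <= L * (s * k) by apply: mulr_ge0; [exact: ltW|apply: mulr_ge0; [|exact: ltW]].
  have := gram_form_le v v c1 Lz.
  rewrite gram_formBg -/A => /(le_trans (ler_norm _)).
  have cv : c ^+ 2 * (`|v| * `|v|) <= 4 * A.
    have h : c * `|v| <= 2 * gram_norm (metric i y) v.
      by apply: le_trans (Hc v) _; have [] := Hy v.
    have c0v : 0 <= c * `|v| by rewrite mulr_ge0// ltW.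
    have g0 : 0 <= 2 * gram_norm (metric i y) v by rewrite mulr_ge0// gram_norm_ge0.
    have := ler_pM c0v c0v h h.
    rewrite /A -gram_norm_sqr// expr2 => H; apply: le_trans (_ : _ <= 2 * gram_norm (metric i y) v * (2 * gram_norm (metric i y) v)) _.
      by rewrite (_ : c * c * (`|v| * `|v|) = c * `|v| * (c * `|v|))//; ring.
    by rewrite le_eqVlt; apply/orP; left; apply/eqP; ring.
  have dD : d%:R ^+ 2 <= D by rewrite /D ler_pXn2r ?nnegrE// ler_nat.
  have : L * (s * k) * d%:R ^+ 2 * (`|v| * `|v|) <= s / 2 * A.
    apply: (@le_trans _ _ (L * (s * k) * D * (`|v| * `|v|))).
      by rewrite ler_wpM2r ?mulr_ge0// ler_wpM2l.
    have -> : L * (s * k) * D * (`|v| * `|v|) = s / 8 * (c ^+ 2 * (`|v| * `|v|)).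
      by rewrite /k; field; rewrite !gt_eqF.
    apply: (@le_trans _ _ (s / 8 * (4 * A))).
      by rewrite ler_wpM2l// divr_ge0.
    by rewrite le_eqVlt; apply/orP; left; apply/eqP; field.
  by rewrite mulrDl mul1r; lra.
rewrite /gram_norm -/A.
have : Num.sqrt (gram_form (metric i z) v v) <= Num.sqrt ((1 + s / 4) ^+ 2 * A).
  rewrite ler_wsqrtr// (le_trans key)// ler_wpM2r//.
  by have := sqr_ge0 s; rewrite expr2; lra.
rewrite sqrtrM ?sqr_ge0// sqrtr_sqr ger0_norm// addr_ge0// divr_ge0//.
Unshelve. all: by end_near. Qed.

(* Radial changes of the metric are of lower order than the gain s of the
   contraction, hence the loss of a factor 2. *)
Lemma rdist_contract (R : realType) (d : nat) (M : riemannianManifold R d)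
    (i : chart_index M) (p : 'rV[R]_d) : (chart i @` dom i) p ->
  exists2 r0 : R, 0 < r0 & forall b r s, r <= r0 -> 0 <= s <= 2^-1 ->
    (rdist (param i p) b < r%:E)%E ->
    exists q, [/\ (chart i @` dom i) q, param i q = b,
      (chart i @` dom i) (p + (1 - s) *: (q - p)) &
      (rdist (param i p) (param i (p + (1 - s) *: (q - p))) < ((1 - s / 2) * r)%:E)%E].
Proof.
move=> ip; have pG := metric_posdef ip; set G := metric i p.
have io : \forall y \near p, (chart i @` dom i) y.
  by apply: open_nbhs_nbhs; split => //; exact: img_open.
have [r1 r10 H1] := near_gram_ball pG (filterI io (metric_radial_le ip)).
have [r2 r20 H2] := rdist_lower ip ltr01.
pose r3 := Num.min r1 r2.
have r30 : 0 < r3 by rewrite lt_min r10 r20.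
have r31 : r3 <= r1 by rewrite ge_min lexx.
have r32 : r3 <= r2 by rewrite ge_min lexx orbT.
exists (r3 / 4); first by rewrite divr_gt0.
move=> b r s rr /andP[s0 s1] pb.
pose K := [set y | gram_norm G (y - p) <= r3].
pose V := [set y | gram_norm G (y - p) < r3].
have VK : V `<=` K by move=> y /=; exact: ltW.
have KP y : K y -> (chart i @` dom i) y /\ forall s : R, 0 <= s <= 1 -> forall v,
    gram_norm (metric i (p + (1 - s) *: (y - p))) v <=
    (1 + s / 4) * gram_norm (metric i y) v.
  by move=> /= ky; apply: H1 => /=; exact: le_trans ky r31.
pose z y := p + (1 - s) *: (y - p).
have zz y y' : z y' - z y = (1 - s) *: (y' - y).
  by apply/rowP => j; rewrite !mxE; ring.
have zp y : z y - p = (1 - s) *: (y - p) by rewrite /z addrC addKr.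
have s01 : 0 <= 1 - s by lra.
have gz y : gram_norm G (z y - p) = (1 - s) * gram_norm G (y - p).
  by rewrite zp gram_normZ ger0_norm.
have Kz y : K y -> K (z y).
  move=> ky; rewrite /K/= gz; apply: le_trans ky.
  by rewrite ler_piMl ?gram_norm_ge0//; lra.
have iz y : K y -> (chart i @` dom i) (z y) by move=> /Kz/KP[].
have cz : continuous z by exact: continuous_affine.
pose B := r3 / 4.
have B0 : 0 < B by rewrite divr_gt0.
(* As a function of the uncontracted point, this distance has slope at most
   [(1 - s) * (1 + s / 4) <= 1 - s / 2]. *)
pose D y := rdist (param i p) (param i (z y)).
have D0 y : (0 <= D y)%E by exact: rdist_ge0.
pose h y := truncate B (D y).
have hB y : h y <= B by apply: truncate_le; [exact: ltW|].
have zpp : z p = p by rewrite /z subrr scaler0 addr0.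
have hp : h p = 0.
  by rewrite /h /D zpp rdist_refl /truncate min_r// lee_fin ltW.
have c0 : 0 < 1 - s / 2 by lra.
have [|||||||q [Vq qb hq]] := @coord_growth R d M i K V h (1 - s / 2) B
    (@gram_ball_compact R d G p r3 pG) (fun y Ky => (KP y Ky).1)
    (@gram_ball_open R d G p r3 pG) VK _ _ _ _ p b r.
- exact: c0.
- move=> y a Ky ay.
  have aB : a < B by exact: lt_le_trans ay (hB y).
  have ya : (a%:E < D y)%E.
    rewrite ltNge; apply/negP => ya; have := truncate_leP B (D0 y) ya.
    by rewrite leNgt ay.
  have nS : \forall y' \near y, (a%:E < D y')%E.
    apply: (@near_comp _ _ z y (fun w => (a%:E < rdist (param i p) (param i w))%E)).
      exact: cz.
    apply: (@near_comp _ _ (param i) (z y) (fun x => (a%:E < rdist (param i p) x)%E)).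
      exact: (param_continuous (iz y Ky)).
    by apply: open_nbhs_nbhs; split; [exact: rdist_gt_open|exact: ya].
  near=> y'; have ay' : (a%:E < D y')%E by near: y'; exact: nS.
  have [hB'|hB'] := ltP (h y') B; last exact: lt_le_trans aB hB'.
  by move: ay'; rewrite (truncate_id (D0 y') hB') lte_fin.
(* Being below the cap [r3 / 4] puts [z y] within [r3 / 2] of [p] in the norm of [G], and then
   [s <= 1/2] puts [y] within [r3]. *)
- move=> y Ky; rewrite truncate_lt// => DB.
  have pp : gram_norm G (p - p) < r2 by rewrite subrr gram_norm0.
  have BB : (1 + 1) * B <= r2 by apply: le_trans r32; rewrite /B; lra.
  have [q' [iq' q'z]] := H2 p pp _ _ BB DB.
  have -> : q' = z y.
    by rewrite -(imgP iq').2 q'z (imgP (iz _ Ky)).2.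
  rewrite -/G gz /V /= /B => hq'; have := gram_norm_ge0 G (y - p).
  move: hq'; set t := gram_norm _ _ => hq' t0.
  have : 2^-1 * t <= (1 - s) * t by rewrite ler_wpM2r//; lra.
  by move=> ht; lra.
- move=> y Vy hyB e e0.
  have Ky := VK _ Vy.
  have [iy /(_ s)] := KP _ Ky; rewrite s0 (le_trans s1) ?invf_le1 ?ler1n// => /(_ isT) gle.
  have nS : \forall y' \near y, (rdist (param i (z y)) (param i (z y')) <=
      (gram_norm (metric i (z y)) (z y' - z y) + e * `|z y' - z y|)%:E)%E.
    apply: (@near_comp _ _ z y (fun w => (rdist (param i (z y)) (param i w) <=
      (gram_norm (metric i (z y)) (w - z y) + e * `|w - z y|)%:E)%E)).
      exact: cz.
    by apply: filterS (slope_segment (iz _ Ky) e0) => w [].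
  near=> y'; have h1 : (rdist (param i (z y)) (param i (z y')) <=
      (gram_norm (metric i (z y)) (z y' - z y) + e * `|z y' - z y|)%:E)%E.
    by near: y'; exact: nS.
  apply: truncate_leP => //.
  apply: le_trans (rdist_triangle _ (param i (z y)) _) _.
  rewrite -/(D y) (truncate_id (D0 y) hyB) -/(h y) -addrA EFinD leeD2l//.
  apply: le_trans h1 _; rewrite lee_fin zz gram_normZ normrZ (ger0_norm s01).
  have := gle (y' - y); rewrite -/(z y).
  have := gram_norm_ge0 (metric i y) (y' - y).
  set a := gram_norm (metric i (z y)) _; set a' := gram_norm (metric i y) _.
  move=> a'0 aa'; apply: lerD.
    apply: (@le_trans _ _ ((1 - s) * ((1 + s / 4) * a'))); first by rewrite ler_wpM2l.
    by rewrite mulrA ler_wpM2r//; have := sqr_ge0 s; rewrite expr2; lra.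
  by rewrite ler_pM2l// ler_piMl//; lra.
- by rewrite /V/= subrr gram_norm0.
- rewrite hp add0r; apply: le_trans rr; rewrite ler_piMl//; last lra.
  by rewrite -lee_fin; apply: le_trans (rdist_ge0 _ _) (ltW pb).
- exact: pb.
exists q; split => //.
- exact: (KP _ (VK _ Vq)).1.
- exact/iz/VK.
move: hq; rewrite hp add0r truncate_lt//.
apply: le_trans rr; rewrite ler_piMl//; last lra.
by rewrite -lee_fin; apply: le_trans (rdist_ge0 _ _) (ltW pb).
Unshelve. all: by end_near. Qed.
(** * Lebesgue measure on coordinate space *)

Lemma borel_open (T : ptopologicalType) (A : set (borel T)) :
  open (A : set T) -> measurable A.
Proof. by move=> oA; exact: sub_sigma_algebra. Qed.

Lemma borel_closed (T : ptopologicalType) (A : set (borel T)) :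
  closed (A : set T) -> measurable A.
Proof.
move=> cA; rewrite -[A]setCK; apply: measurableC; apply: borel_open.
by rewrite openC.
Qed.

Lemma borel_continuous (T U : ptopologicalType) (f : borel T -> borel U) :
  continuous (f : T -> U) -> measurable_fun setT f.
Proof.
move=> cf; apply: (@measurability _ _ (borel T) (borel U) setT f (@open U)) => // _ [A oA <-].
by rewrite setTI; apply: borel_open; move/continuousP : cf; exact.
Qed.

Lemma pushforward_measure (d1 d2 : measure_display) (T1 : measurableType d1)
    (T2 : measurableType d2) (R : realType) (mu : {measure set T1 -> \bar R})
    (f : T1 -> T2) : measurable_fun setT f ->
  exists mu2 : {measure set T2 -> \bar R}, forall A, mu2 A = mu (f @^-1` A).
Proof.
by move=> mf; exists (measure_function_pushforward__canonical__measure_function_Measure mu mf).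
Qed.

Definition halfbox (R : realType) (d : nat) (a b : 'rV[R]_d) : set 'rV[R]_d :=
  [set x | forall i, a ord0 i <= x ord0 i < b ord0 i].

Definition halfboxes (R : realType) (d : nat) : set (set 'rV[R]_d) :=
  [set A | exists a b : 'rV[R]_d, (forall i, a ord0 i <= b ord0 i) /\ A = halfbox a b].

Lemma coord_continuous_rV (R : realType) (d : nat) (i : 'I_d) :
  continuous (fun x : 'rV[R]_d => x ord0 i).
Proof. exact: coord_continuous. Qed.

Lemma measurable_halfbox (R : realType) (d : nat) (a b : 'rV[R]_d) :
  measurable (halfbox a b : set (borel 'rV[R]_d)).
Proof.
have -> : halfbox a b = \bigcap_(i in [set: 'I_d])
   ([set x : 'rV[R]_d | a ord0 i <= x ord0 i] `&` [set x | x ord0 i < b ord0 i]).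
  apply/seteqP; split => x /= H i; first by have /andP[] := H i.
  by have [-> ->] := H i I.
apply: fin_bigcap_measurable => // i _; apply: measurableI.
  apply: borel_closed; apply: (@preimage_closed _ _ (fun x : 'rV[R]_d => x ord0 i) [set t | a ord0 i <= t]).
    by move=> x _; exact: coord_continuous_rV.
  exact: closed_ge.
apply: borel_open; apply: (@open_comp _ _ (fun x : 'rV[R]_d => x ord0 i) [set t | t < b ord0 i]).
  by move=> x _; exact: coord_continuous_rV.
exact: open_lt.
Qed.

Lemma setI_closed_halfboxes (R : realType) (d : nat) : setI_closed (@halfboxes R d).
Proof.
move=> _ _ [a [b [ab ->]]] [a' [b' [a'b' ->]]].
pose c := \row_i Num.max (a ord0 i) (a' ord0 i) : 'rV[R]_d.
pose e := \row_i Num.min (b ord0 i) (b' ord0 i) : 'rV[R]_d.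
have E x : (halfbox a b `&` halfbox a' b') x <-> halfbox c e x.
  split=> [[h1 h2] i|h].
    rewrite !mxE ge_max lt_min.
    by have /andP[-> ->] := h1 i; have /andP[-> ->] := h2 i.
  by split=> i; have := h i; rewrite !mxE ge_max lt_min =>
    /andP[/andP[h1 h2] /andP[h3 h4]]; apply/andP.
have [ce|] := pselect (forall i, c ord0 i <= e ord0 i).
  by exists c, e; split => //; apply/seteqP; split => x /E.
move=> /existsNP[i /negP]; rewrite -ltNge => ce.
(* An empty intersection is again a box, the degenerate one at [a]: coordinate [i] leaves no
   room. *)
exists a, a; split => //; apply/seteqP; split => x.
  by move=> /E /(_ i) /andP[h1 h2]; have := lt_trans (le_lt_trans h1 h2) ce; rewrite ltxx.
by move=> /(_ i) /andP[h1 h2]; have := le_lt_trans h1 h2; rewrite ltxx.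
Qed.

(** Rational corners keep the union countable, so that boxes generate the Borel sets. *)
Lemma open_halfboxes (R : realType) (d : nat) (O : set 'rV[R]_d) : open O ->
  exists2 P : set ('rV[rat]_d * 'rV[rat]_d), True &
   O = \bigcup_(q in P) halfbox (map_mx ratr q.1) (map_mx ratr q.2) /\
   forall q, P q -> forall i, (map_mx ratr q.1 : 'rV[R]_d) ord0 i <= (map_mx ratr q.2 : 'rV[R]_d) ord0 i.
Proof.
move=> oO.
exists [set q : 'rV[rat]_d * 'rV[rat]_d | halfbox (map_mx ratr q.1) (map_mx ratr q.2) `<=` O /\
  forall i, (map_mx ratr q.1 : 'rV[R]_d) ord0 i <= (map_mx ratr q.2 : 'rV[R]_d) ord0 i] => //.
split; last by move=> q [].
apply/seteqP; split => [x Ox|x [q [qO _]]]; last exact: qO.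
have : nbhs x O by exact: open_nbhs_nbhs.
move=> /nbhs_ballP[r /= r0 rO].
have la i : exists q : rat, ratr q \in `](x ord0 i - r / 2), (x ord0 i)[.
  by apply: rat_in_itvoo; rewrite gtrBl divr_gt0.
have lb i : exists q : rat, ratr q \in `](x ord0 i), (x ord0 i + r / 2)[.
  by apply: rat_in_itvoo; rewrite ltrDl divr_gt0.
pose qa := \row_i projT1 (cid (la i)) : 'rV[rat]_d.
pose qb := \row_i projT1 (cid (lb i)) : 'rV[rat]_d.
have Ha i : x ord0 i - r / 2 < ratr (qa ord0 i) < x ord0 i.
  by rewrite mxE; case: cid => /= q; rewrite in_itv.
have Hb i : x ord0 i < ratr (qb ord0 i) < x ord0 i + r / 2.
  by rewrite mxE; case: cid => /= q; rewrite in_itv.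
exists (qa, qb) => /=; last first.
  move=> i; rewrite [(map_mx _ _) _ _]mxE [X in _ < X]mxE.
  by have /andP[_ /ltW ->] := Ha i; have /andP[-> _] := Hb i.
split=> [y hy|i]; last first.
  rewrite [leLHS]mxE [leRHS]mxE ltW//.
  by have /andP[_ h] := Ha i; have /andP[h' _] := Hb i; exact: lt_trans h h'.
apply: rO; rewrite -ball_normE /=.
apply: le_lt_trans (_ : r / 2 < r); last by rewrite ltr_pdivrMr// ltr_pMr// ltr1n.
apply: norm_le_coord => [|i]; first by rewrite divr_ge0// ltW.
have := hy i; rewrite [(map_mx _ _) _ _]mxE [X in _ < X]mxE => /andP[h1 h2].
have /andP[h3 h4] := Ha i; have /andP[h5 h6] := Hb i.
rewrite !mxE ler_norml; apply/andP; split; lra.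
Qed.

Lemma borel_halfboxes (R : realType) (d : nat) :
  @measurable _ (borel 'rV[R]_d) = <<s @halfboxes R d >>.
Proof.
apply/seteqP; split.
  apply: smallest_sub; first exact: smallest_sigma_algebra.
  move=> O /open_halfboxes[P _ [-> HP]].
  rewrite bigcup_mkcond.
  have := @countable_bigcupT_measurable _ (g_sigma_algebraType (@halfboxes R d))
     ('rV[rat]_d * 'rV[rat]_d)%type
     (fun q => if q \in P then halfbox (map_mx ratr q.1) (map_mx ratr q.2) else set0).
  apply; first exact: countableP.
  move=> q; case: ifPn => [/set_mem Pq|_]; last exact: measurable0.
  apply: sub_sigma_algebra; exists (map_mx ratr q.1), (map_mx ratr q.2).
  by split => //; exact: HP.
apply: smallest_sub; first exact: sigma_algebra_measurable.
by move=> _ [a [b [_ ->]]]; exact: measurable_halfbox.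
Qed.

Lemma halfbox_unique (R : realType) (d : nat)
    (m1 m2 : {measure set (borel 'rV[R]_d) -> \bar R}) :
  (forall a b : 'rV[R]_d, (forall i, a ord0 i <= b ord0 i) ->
    (m1 (halfbox a b) < +oo)%E /\ m1 (halfbox a b) = m2 (halfbox a b)) ->
  forall A, measurable A -> m1 A = m2 A.
Proof.
move=> H A mA.
apply: (@measure_unique _ R (borel 'rV[R]_d) (@halfboxes R d)
   (fun k : nat => halfbox (const_mx (- k%:R)) (const_mx k%:R))
   (@borel_halfboxes R d) (@setI_closed_halfboxes R d)) mA.
- move=> k; exists (const_mx (- k%:R)), (const_mx k%:R); split => // i.
  by rewrite !mxE; apply: (@le_trans _ _ 0); rewrite ?oppr_le0 ?ler0n.
- apply/seteqP; split => // x _.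
  exists (Num.truncn (`|x|)).+1 => // i; rewrite !mxE.
  have xi := le_lt_trans (coord_le_norm x ord0 i) (truncnS_gt `|x|).
  move: xi; rewrite ltr_norml => /andP[h1 h2].
  by rewrite (ltW h1) h2.
- by move=> _ [a [b [ab ->]]]; have [] := H a b ab.
- move=> k; have [] := H (const_mx (- k%:R)) (const_mx k%:R) => //.
  by move=> i; rewrite !mxE; apply: (@le_trans _ _ 0); rewrite ?oppr_le0 ?ler0n.
Qed.

(** Uniqueness on boxes reduces the Jacobian of a homothety to a product of lengths. It serves to
    scale ellipsoids and to compare a ball with its contraction. *)
Lemma lebesgue_affine (R : realType) (d : nat)
    (lam : {measure set (borel 'rV[R]_d) -> \bar R}) (v p : 'rV[R]_d) (c : R) :
  is_lebesgue lam -> 0 < c -> forall A : set (borel 'rV[R]_d), measurable A ->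
  lam ((fun y : 'rV[R]_d => v + c *: (y - p)) @^-1` A) = (((c^-1) ^+ d)%:E * lam A)%E.
Proof.
move=> lebl c0 A mA.
have mz : measurable_fun setT ((fun y : 'rV[R]_d => v + c *: (y - p)) : borel _ -> borel _).
  by apply: borel_continuous; exact: continuous_affine.
have [mu2 mu2E] := pushforward_measure lam mz.
have cd0 : 0 <= c^-1 ^+ d by rewrite exprn_ge0// invr_ge0 ltW.
rewrite -mu2E.
have -> : (((c^-1) ^+ d)%:E * lam A = mscale (NngNum cd0) lam A)%E by [].
apply: halfbox_unique A mA => a b ab.
have abf : (lam (halfbox a b) < +oo)%E by rewrite lebl// ltry.
pose a' := p + c^-1 *: (a - v); pose b' := p + c^-1 *: (b - v).
have E1 (al y w q : R) : (al <= w + c * (y - q)) = (q + c^-1 * (al - w) <= y).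
  by rewrite -lerBrDl ler_pdivrMl// lerBlDl.
have E1' (al y w q : R) : (w + c * (y - q) < al) = (y < q + c^-1 * (al - w)).
  by rewrite -[in RHS]ltrBlDl ltr_pdivlMl// ltrBrDl.
have E : (fun y : 'rV[R]_d => v + c *: (y - p)) @^-1` halfbox a b = halfbox a' b'.
  by apply/seteqP; split => y H i; have := H i; rewrite !mxE E1 E1'.
have E2 : mu2 (halfbox a b) = mscale (NngNum cd0) lam (halfbox a b).
  rewrite mu2E E lebl; last first.
    by move=> i; rewrite !mxE lerD2l ler_pM2l ?invr_gt0// lerD2r.
  rewrite /mscale /= lebl// -EFinM; congr EFin.
  have -> : c^-1 ^+ d = \prod_(i < d) c^-1 by rewrite prodr_const card_ord.
  rewrite -big_split /=; apply: eq_bigr => i _; rewrite !mxE; ring.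
split; last exact: E2.
by rewrite E2 /mscale /= lebl// -EFinM ltry.
Qed.


Lemma prod_const_box (R : realType) (d : nat) (p : 'rV[R]_d) (r : R) :
  \prod_(i < d) ((p + const_mx r) ord0 i - (p - const_mx r) ord0 i) = (2 * r) ^+ d.
Proof.
rewrite -[in RHS](card_ord d) -prodr_const; apply: eq_bigr => i _.
by rewrite !mxE; ring.
Qed.

Lemma lebesgue_ball_le (R : realType) (d : nat)
    (lam : {measure set (borel 'rV[R]_d) -> \bar R}) (p : 'rV[R]_d) (r : R) :
  is_lebesgue lam -> 0 <= r ->
  (lam [set y | (`|y - p| < r)%R] <= ((2 * r) ^+ d)%:E)%E.
Proof.
move=> lebl r0; rewrite -(prod_const_box p) -lebl; last first.
  by move=> i; rewrite !mxE lerD2l; apply: (@le_trans _ _ 0); rewrite ?oppr_le0.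
apply: le_measure; rewrite ?inE.
- apply: borel_open.
  have -> : [set y | `|y - p| < r] = (fun y : 'rV[R]_d => `|y - p|) @^-1` [set t | t < r] by [].
  apply: open_comp; last exact: open_lt.
  move=> y _; apply: (@cvg_norm _ _ _ (nbhs (y : 'rV[R]_d))).
  by apply: cvgB; [exact: cvg_id|exact: cvg_cst].
- exact: measurable_halfbox.
- move=> y /= yr i; rewrite !mxE.
  have := le_lt_trans (coord_le_norm (y - p) ord0 i) yr.
  rewrite !mxE ltr_norml => /andP[h1 h2]; apply/andP; split; lra.
Qed.

Lemma lebesgue_ball_ge (R : realType) (d : nat)
    (lam : {measure set (borel 'rV[R]_d) -> \bar R}) (p : 'rV[R]_d) (r : R) :
  is_lebesgue lam -> 0 < r ->
  ((r ^+ d)%:E <= lam [set y | (`|y - p| < r)%R])%E.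
Proof.
move=> lebl r0.
have -> : r ^+ d = (2 * (r / 2)) ^+ d by rewrite mulrC divfK.
rewrite -(prod_const_box p) -lebl; last first.
  move=> i; rewrite !mxE lerD2l; apply: (@le_trans _ _ 0); rewrite ?oppr_le0 ?divr_ge0// ltW//.
apply: le_measure; rewrite ?inE.
- exact: measurable_halfbox.
- apply: borel_open.
  have -> : [set y | `|y - p| < r] = (fun y : 'rV[R]_d => `|y - p|) @^-1` [set t | t < r] by [].
  apply: open_comp; last exact: open_lt.
  move=> y _; apply: (@cvg_norm _ _ _ (nbhs (y : 'rV[R]_d))).
  by apply: cvgB; [exact: cvg_id|exact: cvg_cst].
- move=> y yr; apply: (@le_lt_trans _ _ (r / 2)); last by rewrite ltr_pdivrMr// ltr_pMr// ltr1n.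
  apply: norm_le_coord => [|i]; first by rewrite divr_ge0// ltW.
  have := yr i; rewrite !mxE => /andP[h1 h2]; rewrite ler_norml; apply/andP; split; lra.
Qed.
(** * Covering and differentiation *)

Lemma cvg_exists_lt (R : realType) (u : nat -> \bar R) (l e : \bar R) :
  u n @[n --> \oo] --> l -> (l < e)%E -> exists n, (u n < e)%E.
Proof.
move=> cv le; have : nbhs l [set y | (y < e)%E].
  by apply: open_nbhs_nbhs; split => //; exact: open_ereal_lt_ereal.
by move=> /cv [n _ H]; exists n; apply: H => /=.
Qed.

Lemma le_mu (d : measure_display) (T : measurableType d) (R : realType)
    (mu : {measure set T -> \bar R}) (A B : set T) :
  measurable A -> measurable B -> A `<=` B -> (mu A <= mu B)%E.
Proof. by move=> mA mB AB; apply: le_measure; rewrite ?inE. Qed.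

(** Inner and outer approximation form a single condition on [O] minus [C], which makes it symmetric
    under complement and stable enough to define a sigma-algebra. *)
Definition regular_set (R : realType) (d : nat)
    (mu : {measure set (borel 'rV[R]_d) -> \bar R}) (A : set 'rV[R]_d) : Prop :=
  forall e : R, 0 < e -> exists O C : set 'rV[R]_d,
    [/\ open O, closed C, C `<=` A, A `<=` O & (mu (O `\` C) <= e%:E)%E].

Lemma open_regular_set (R : realType) (d : nat)
    (mu : {measure set (borel 'rV[R]_d) -> \bar R}) (U : set 'rV[R]_d) :
  (mu setT < +oo)%E -> open U -> regular_set mu U.
Proof.
move=> fmu oU e e0.
(* The points at distance at least [1 / (n + 1)] from the complement of [U]: closed sets exhausting
   [U]. *)
pose C (n : nat) : set 'rV[R]_d := [set x | forall z, `|z - x| < n.+1%:R^-1 -> U z].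
have cC n : closed (C n).
  rewrite -[C n]setCK; apply: open_closedC; rewrite openE => x /= /existsNP[z /not_implyP[zx nUz]].
  apply/nbhs_ballP; exists (n.+1%:R^-1 - `|z - x|); first by rewrite /= subr_gt0.
  move=> y; rewrite -ball_normE/= => xy Cy; apply: nUz; apply: Cy.
  by rewrite ltrBrDl in xy; exact: le_lt_trans (ler_distD x z y) xy.
have CU n : C n `<=` U by move=> x; apply; rewrite subrr normr0 invr_gt0.
pose F n : set (borel 'rV[R]_d) := U `\` C n.
have mF n : measurable (F n).
  by apply: measurableD; [exact: borel_open|exact: borel_closed].
have F0 : \bigcap_n F n = set0.
  apply/seteqP; split => // x H.
  have [Ux _] := H 0%N I.
  have : nbhs x U by exact: open_nbhs_nbhs.
  move=> /nbhs_ballP[r /= r0 rU].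
  have [_] := H (Num.truncn r^-1) I; apply => z zx; apply: rU.
  rewrite -ball_normE/= distrC; apply: lt_le_trans zx _.
  by rewrite invf_ple ?posrE// ltW// truncnS_gt.
have : (mu \o F) n @[n --> \oo] --> mu (\bigcap_n F n).
  apply: nonincreasing_cvg_mu => //.
  - by apply: le_lt_trans fmu; apply: le_measure; rewrite ?inE.
  - by rewrite F0.
  - move=> n m nm; apply/subsetPset => x [Ux nC]; split => // Cx; apply: nC => z zx.
    by apply: Cx; apply: lt_le_trans zx _; rewrite lef_pV2 ?posrE// ler_nat.
rewrite F0 measure0 => cv.
have [|n Fn] := cvg_exists_lt cv (_ : (0 < e%:E)%E); first by rewrite lte_fin.
by exists U, (C n); split => //; exact: ltW.
Qed.

Lemma regular_sigma_algebra (R : realType) (d : nat)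
    (mu : {measure set (borel 'rV[R]_d) -> \bar R}) :
  (mu setT < +oo)%E -> sigma_algebra setT (fun A => measurable (A : set (borel 'rV[R]_d)) /\ regular_set mu A).
Proof.
move=> fmu; split.
- split=> // e e0; exists set0, set0.
  by split; rewrite ?setD0 ?measure0 ?lee_fin ?(ltW e0)//;
    first [exact: open0|exact: closed0].
- move=> A [mA rA]; split; first by rewrite setTD; exact: measurableC.
  move=> e /rA[V [C [oV cC CA AV VC]]].
  exists (~` C), (~` V); split.
  + by rewrite openC.
  + by rewrite closedC.
  + by rewrite setTD; exact: subsetC.
  + by rewrite setTD; exact: subsetC.
  + by rewrite (_ : ~` C `\` ~` V = V `\` C)// setDE setCK setDE setIC.
- move=> A mrA; split; first by apply: bigcupT_measurable => n; have [] := mrA n.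
  move=> e e0.
  have H n : exists OC : set 'rV[R]_d * set 'rV[R]_d,
     [/\ open OC.1, closed OC.2, OC.2 `<=` A n, A n `<=` OC.1 &
      (mu (OC.1 `\` OC.2) <= (e / 2 / (2 ^ n.+1)%:R)%:E)%E].
    have en : 0 < e / 2 / (2 ^ n.+1)%:R :> R by rewrite !divr_gt0// ltr0n expn_gt0.
    by have [_ /(_ _ en) [V [C H]]] := mrA n; exists (V, C).
  pose O n := (projT1 (cid (H n))).1; pose C n := (projT1 (cid (H n))).2.
  have HOC n : [/\ open (O n), closed (C n), C n `<=` A n, A n `<=` O n &
      (mu (O n `\` C n) <= (e / 2 / (2 ^ n.+1)%:R)%:E)%E].
    by rewrite /O /C; case: cid.
  have mO n : measurable (O n : set (borel 'rV[R]_d)).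
    by apply: borel_open; have [] := HOC n.
  have mC n : measurable (C n : set (borel 'rV[R]_d)).
    by apply: borel_closed; have [] := HOC n.
  (* An infinite union of closed sets need not be closed. Only finitely many are kept, and
     continuity from above, available because [mu] is finite, makes the rest small. *)
  pose D n := \big[setU/set0]_(i < n) C i.
  have cD n : closed (D n).
    by apply: closed_bigsetU => i _; have [] := HOC i.
  pose OO := \bigcup_n O n.
  have oOO : open OO by apply: bigcup_open => n _; have [] := HOC n.
  pose F n : set (borel 'rV[R]_d) := OO `\` D n.
  have mF n : measurable (F n).
    by apply: measurableD; [exact: borel_open|exact: borel_closed].
  have FE : \bigcap_n F n = OO `\` \bigcup_n C n.
    apply/seteqP; split => [x h|x [Ox nC] n _].
      split; first by have [] := h 0%N I.
      move=> [n _ Cx]; have [_] := h n.+1 I; apply.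
      by rewrite /D big_ord_recr; right.
    by split => // Dx; apply: nC; exact: (bigsetU_bigcup Dx).
  have mFE : measurable (\bigcap_n F n) by exact: bigcap_measurableType.
  have muF : (mu (\bigcap_n F n) <= (e / 2)%:E)%E.
    apply: (@le_trans _ _ (\sum_(0 <= n <oo) mu (O n `\` C n))%E).
      apply: measure_sigma_subadditive => //.
        by move=> n; exact: measurableD.
      rewrite FE => x [[n _ Ox] nC]; exists n => //; split => // Cx; apply: nC.
      by exists n.
    apply: (@le_trans _ _ (\sum_(0 <= n <oo) (e / 2 / (2 ^ n.+1)%:R)%:E)%E).
      by apply: lee_nneseries => // n _ ; have [] := HOC n.
    by apply: epsilon_trick0; rewrite divr_ge0// ltW.
  have : (mu \o F) n @[n --> \oo] --> mu (\bigcap_n F n).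
    apply: nonincreasing_cvg_mu => //.
    - by apply: le_lt_trans fmu; apply: le_measure; rewrite ?inE.
    - move=> n m nm; apply/subsetPset => x [Ux nD]; split => // Dx; apply: nD.
      rewrite /D -(subnKC nm) big_split_ord /=; left; exact: Dx.
  move=> cv.
  have [|n Fn] := cvg_exists_lt cv (_ : (mu (\bigcap_n F n) < e%:E)%E).
    by apply: le_lt_trans muF _; rewrite lte_fin ltr_pdivrMr// ltr_pMr// ltr1n.
  exists OO, (D n); split => //.
  - by move=> x Dx; have [k _ Ck] := bigsetU_bigcup Dx; exists k => //;
      have [_ _ CA _ _] := HOC k; exact: CA.
  - by move=> x [k _ Ak]; exists k => //; have [_ _ _ AO _] := HOC k; exact: AO.
  - exact: ltW.
Qed.

Lemma outer_regular (R : realType) (d : nat)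
    (mu : {measure set (borel 'rV[R]_d) -> \bar R}) (A : set (borel 'rV[R]_d)) (e : R) :
  (mu setT < +oo)%E -> measurable A -> mu A = 0%E -> 0 < e ->
  exists O : set 'rV[R]_d, [/\ open O, A `<=` O & (mu O <= e%:E)%E].
Proof.
move=> fmu mA A0 e0.
have [_ rA] : measurable A /\ regular_set mu A.
  have h : @open 'rV[R]_d `<=` (fun A => measurable (A : set (borel 'rV[R]_d)) /\ regular_set mu A).
    by move=> U oU; split; [exact: borel_open|exact: open_regular_set].
  exact: (mA _ (conj (regular_sigma_algebra fmu) h)).
have [V [C [oV cC CA AV VC]]] := rA e e0.
have mV := borel_open oV; have mC := borel_closed cC.
exists V; split=> //; rewrite (measureDI _ mV mC).
rewrite -[e%:E]adde0 leeD// -A0; apply: le_mu => //; first exact: measurableI.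
by move=> x [_ /CA].
Qed.

Definition cball (R : realType) (d : nat) (q : 'rV[R]_d * R) : set 'rV[R]_d :=
  [set y | `|y - q.1| < q.2].

Lemma cball_open (R : realType) (d : nat) (q : 'rV[R]_d * R) : open (cball q).
Proof.
have -> : cball q = (fun y : 'rV[R]_d => `|y - q.1|) @^-1` [set t | t < q.2] by [].
apply: open_comp; last exact: open_lt.
move=> y _; apply: (@cvg_norm _ _ _ (nbhs (y : 'rV[R]_d))).
by apply: cvgB; [exact: cvg_id|exact: cvg_cst].
Qed.

Lemma max_radius (T : eqType) (R : realType) (s : seq (T * R)) : s != [::] ->
  exists2 x, x \in s & forall q, q \in s -> q.2 <= x.2.
Proof.
elim: s => // a s IH _; have [->|s0] := eqVneq s [::].
  by exists a; rewrite ?mem_seq1// => q; rewrite mem_seq1 => /eqP ->.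
have [x xs xm] := IH s0; have [ax|xa] := leP a.2 x.2.
  exists x; first by rewrite inE xs orbT.
  by move=> q; rewrite inE => /predU1P[->|/xm].
exists a; first by rewrite inE eqxx.
by move=> q; rewrite inE => /predU1P[->//|/xm qx]; exact/ltW/(le_lt_trans qx).
Qed.

(* Greedy selection by decreasing radius: every discarded ball is contained in
   the threefold enlargement of a selected one. *)
Lemma vitali_finite (R : realType) (d : nat)
    (lam mu : {measure set (borel 'rV[R]_d) -> \bar R}) (t : R) :
  is_lebesgue lam -> 0 <= t -> forall (n : nat) (s : seq ('rV[R]_d * R)), (size s <= n)%N ->
  (forall q, q \in s -> 0 < q.2 /\ ((t * q.2 ^+ d)%:E <= mu (cball q))%E) ->
  (t%:E * lam (\bigcup_(q in [set` s]) cball q) <=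
   (6 ^+ d)%:E * mu (\bigcup_(q in [set` s]) cball q))%E.
Proof.
move=> lebl t0; elim => [|n IH] s sn H.
  move: sn; rewrite leqn0 size_eq0 => /eqP ->.
  by rewrite set_nil bigcup_set0 !measure0 !mule0.
have [->|s0] := eqVneq s [::].
  by rewrite set_nil bigcup_set0 !measure0 !mule0.
have [x xs xm] := max_radius s0.
pose s' := seq.filter (fun q => `[< cball q `&` cball x = set0 >]) s.
have ss' : (size s' <= n)%N.
  rewrite -ltnS; apply: leq_trans sn; rewrite size_filter ltn_neqAle count_size andbT.
  rewrite -all_count; apply/negP => /allP /(_ x xs) /asboolP.
  move=> /seteqP[+ _] => /(_ x.1); apply; rewrite setIid /cball/= subrr normr0.
  by have [] := H x xs.
have mU (r : seq ('rV[R]_d * R)) : measurable (\bigcup_(q in [set` r]) cball q : set (borel 'rV[R]_d)).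
  by apply: borel_open; apply: bigcup_open => q _; exact: cball_open.
have mB q : measurable (cball q : set (borel 'rV[R]_d)) by apply: borel_open; exact: cball_open.
have [x0 Hx] := H x xs.
have cov : \bigcup_(q in [set` s]) cball q `<=`
   cball (x.1, 3 * x.2) `|` \bigcup_(q in [set` s']) cball q.
  move=> y [q /= qs qy].
  have [qx|/eqP/set0P [z [qz xz]]] := pselect (cball q `&` cball x = set0).
    by right; exists q => //=; rewrite mem_filter qs andbT; apply/asboolP.
  left; rewrite /cball /= in qy qz xz *; have qr := xm q qs.
  have -> : y - x.1 = (y - q.1) - (z - q.1) + (z - x.1).
    by apply/rowP => j; rewrite !mxE; ring.
  rewrite (le_lt_trans (ler_normD _ _))//.
  have := ler_normB (y - q.1) (z - q.1); lra.
have IH' := IH s' ss' _.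
have sub' : {subset s' <= s} by move=> q; rewrite mem_filter => /andP[].
have {IH'} I1 := IH' (fun q qs' => H q (sub' q qs')).
(* The threefold ball is a cube of side [6 * x.2], whence the constant [6 ^+ d]. *)
have L3 : (lam (cball (x.1, (3 * x.2)%R)) <= ((6 * x.2) ^+ d)%:E)%E.
  have := @lebesgue_ball_le R d lam x.1 (3 * x.2) lebl; rewrite mulrA -natrM; apply.
  by rewrite mulr_ge0// ltW.
have dis : cball x `&` \bigcup_(q in [set` s']) cball q = set0.
  apply/seteqP; split => // y [xy [q /=]]; rewrite mem_filter => /andP[/asboolP qx _] qy.
  by have : set0 y by rewrite -qx.
apply: (@le_trans _ _ (t%:E * (lam (cball (x.1, (3 * x.2)%R)) + lam (\bigcup_(q in [set` s']) cball q)))%E).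
  rewrite lee_wpmul2l// ?lee_fin//.
  apply: le_trans (measureU2 _ (mB _) (mU s')).
  by apply: le_measure; rewrite ?inE//; exact: measurableU.
rewrite ge0_muleDr//.
apply: (@le_trans _ _ ((6 ^+ d)%:E * (mu (cball x) + mu (\bigcup_(q in [set` s']) cball q)))%E).
  rewrite [leRHS]ge0_muleDr// leeD//.
  apply: (@le_trans _ _ (t%:E * ((6 * x.2) ^+ d)%:E)%E).
    by rewrite lee_wpmul2l// ?lee_fin.
  rewrite exprMn -EFinM mulrCA EFinM lee_wpmul2l// ?lee_fin ?exprn_ge0//.
rewrite lee_wpmul2l// ?lee_fin ?exprn_ge0//.
rewrite -measureU//; apply: le_measure; rewrite ?inE//; first exact: measurableU.
move=> y [xy|[q /= qs' qy]]; first by exists x.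
by exists q => //=; exact: sub'.
Qed.

(** Reduces arbitrary families of balls to a countable one. Doubling the radius costs a factor
    [2 ^+ d] in density. *)
Lemma rational_cball (R : realType) (d : nat) (q : 'rV[R]_d * R) : 0 < q.2 ->
  exists w : 'rV[rat]_d * rat, [/\ 0 < (ratr w.2 : R), ratr w.2 <= 2 * q.2 &
    cball q `<=` cball (map_mx ratr w.1, ratr w.2)].
Proof.
case: q => p r /= r0.
have li i : exists q : rat, ratr q \in `](p ord0 i), (p ord0 i + r / 4)[.
  by apply: rat_in_itvoo; rewrite ltrDl divr_gt0.
have [c] : exists q : rat, ratr q \in `](r + r / 4), (2 * r)[.
  by apply: rat_in_itvoo; lra.
rewrite in_itv/= => /andP[c1 c2].
exists (\row_i projT1 (cid (li i)), c) => /=; split.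
- lra.
- exact: ltW.
move=> y; rewrite /cball/= => yp.
set w : 'rV[rat]_d := \row_i _.
have wp : `|p - map_mx ratr w| <= r / 4.
  apply: norm_le_coord => [|i]; first by rewrite divr_ge0// ltW.
  rewrite !mxE; case: cid => /= x; rewrite in_itv/= => /andP[h1 h2].
  by rewrite ler_norml; apply/andP; split; lra.
rewrite -(subrKA p) (le_lt_trans (ler_normD _ _))//; lra.
Qed.

(** The weak-type bound for the maximal function. The family [P] is covered by rational balls of
    density at least [t / 2 ^+ d]; [vitali_finite] applies to the first [n] of an enumeration, and
    the bound passes to the increasing union. The constant is 12 = 6 * 2. *)
Lemma maximal_inequality (R : realType) (d : nat)
    (lam mu : {measure set (borel 'rV[R]_d) -> \bar R}) (t : R)
    (P : set ('rV[R]_d * R)) :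
  is_lebesgue lam -> 0 <= t ->
  (forall q, P q -> 0 < q.2 /\ ((t * q.2 ^+ d)%:E <= mu (cball q))%E) ->
  (t%:E * lam (\bigcup_(q in P) cball q) <= (12 ^+ d)%:E * mu setT)%E.
Proof.
move=> lebl t0 H.
pose W (w : 'rV[rat]_d * rat) : 'rV[R]_d * R := (map_mx ratr w.1, ratr w.2).
pose good w := 0 < (W w).2 /\ ((t / 2 ^+ d * (W w).2 ^+ d)%:E <= mu (cball (W w)))%E.
pose enum_ n : seq ('rV[R]_d * R) := [seq W w | w <- pmap (@unpickle ('rV[rat]_d * rat)%type) (iota 0 n) & `[< good w >]].
pose F n : set (borel 'rV[R]_d) := \bigcup_(q in [set` enum_ n]) cball q.
have mF n : measurable (F n).
  by apply: borel_open; apply: bigcup_open => q _; exact: cball_open.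
have gF n q : q \in enum_ n -> 0 < q.2 /\ ((t / 2 ^+ d * q.2 ^+ d)%:E <= mu (cball q))%E.
  by move=> /mapP[w]; rewrite mem_filter => /andP[/asboolP gw _] ->.
have t2 : 0 <= t / 2 ^+ d by rewrite divr_ge0// exprn_ge0.
have Fb n : (t%:E * lam (F n) <= (12 ^+ d)%:E * mu setT)%E.
  have := vitali_finite lebl t2 (leqnn _) (@gF n).
  move=> h; have := @lee_wpmul2l R (2 ^+ d)%:E _ _ _ h; rewrite lee_fin exprn_ge0// => /(_ isT).
  rewrite !muleA -!EFinM mulrC divfK ?expf_neq0// -exprMn -natrM => /le_trans; apply.
  rewrite lee_wpmul2l// ?lee_fin ?exprn_ge0//.
  exact: (le_mu _ (mF n)).
have Fnd : {homo F : n m / (n <= m)%N >-> (n <= m)%O}.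
  move=> n m nm; apply/subsetPset => y [q /= qn qy]; exists q => //=.
  move: qn => /mapP[w]; rewrite mem_filter => /andP[gw wn] ->.
  apply/mapP; exists w => //; rewrite mem_filter gw /=.
  move: wn; rewrite !mem_pmap => /mapP[k kn ->]; apply/mapP; exists k => //.
  by move: kn; rewrite !mem_iota !add0n !leq0n /= => /leq_trans; apply.
have mUF : measurable (\bigcup_n F n) by exact: bigcupT_measurable.
have PF : \bigcup_(q in P) cball q `<=` \bigcup_n F n.
  move=> y [q Pq qy]; have [q0 Hq] := H q Pq.
  have [w [w0 w2 qw]] := rational_cball q0.
  exists (pickle w).+1 => //; exists (W w); last exact: qw.
  apply/mapP; exists w => //; rewrite mem_filter; apply/andP; split.
    apply/asboolP; split => //=; apply: (@le_trans _ _ (mu (cball q))).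
      apply: le_trans Hq; rewrite lee_fin -mulrA ler_wpM2l//.
      rewrite ler_pdivrMl ?exprn_gt0// -exprMn lerXn2r ?nnegrE//; first exact: ltW.
      by rewrite mulr_ge0// ltW.
    by apply: le_measure => //; rewrite inE; apply: borel_open; exact: cball_open.
  rewrite mem_pmap; apply/mapP; exists (pickle w); first by rewrite mem_iota/= add0n ltnSn.
  by rewrite pickleK.
have mP : measurable (\bigcup_(q in P) cball q : set (borel 'rV[R]_d)).
  by apply: borel_open; apply: bigcup_open => q _; exact: cball_open.
apply: (@le_trans _ _ (t%:E * lam (\bigcup_n F n))%E).
  by rewrite lee_wpmul2l// ?lee_fin//; apply: le_measure; rewrite ?inE.
have cv : (lam \o F) n @[n --> \oo] --> lam (\bigcup_n F n).
  exact: nondecreasing_cvg_mu.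
have cv2 : (t%:E * lam (F n))%E @[n --> \oo] --> (t%:E * lam (\bigcup_n F n))%E.
  exact: cvgeZl.
rewrite -(cvg_lim _ cv2)//; apply: lime_le; first by apply/cvg_ex; eexists; exact: cv2.
by apply: nearW => n; exact: Fb.
Qed.

Lemma negligible_small (d : measure_display) (T : measurableType d) (R : realType)
    (mu : {measure set T -> \bar R}) (N : set T) :
  (forall e : R, 0 < e -> exists G : set T, [/\ measurable G, N `<=` G & (mu G <= e%:E)%E]) ->
  mu.-negligible N.
Proof.
move=> H.
have Hn (n : nat) : exists G : set T, [/\ measurable G, N `<=` G & (mu G <= (n.+1%:R^-1)%:E)%E].
  by apply: H; rewrite invr_gt0.
pose G n := projT1 (cid (Hn n)).
have HG n : [/\ measurable (G n), N `<=` G n & (mu (G n) <= (n.+1%:R^-1)%:E)%E].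
  by rewrite /G; case: cid.
exists (\bigcap_n G n); split.
- by apply: bigcap_measurableType => n _; have [] := HG n.
- apply/eqP; rewrite eq_le measure_ge0 andbT; apply/lee_addgt0Pr => e e0; rewrite add0e.
  have [m1 _ b1] := HG (Num.truncn e^-1).
  apply: (@le_trans _ _ (mu (G (Num.truncn e^-1)))).
    apply: le_mu => //; last by move=> x; apply.
    by apply: bigcap_measurableType => n _; have [] := HG n.
  apply: le_trans b1 _; rewrite lee_fin invf_ple ?posrE// ltW// truncnS_gt//.
- by move=> x Nx n _; have [_ + _] := HG n; apply.
Qed.

(** Restrict [mu] to an open set [V] around [A] of tiny mass. Small balls about points of [A] lie in
    [V], so the bad points fall in a superlevel set of the maximal function of the restriction. *)
Lemma null_density (R : realType) (d : nat)
    (lam mu : {measure set (borel 'rV[R]_d) -> \bar R}) (A : set (borel 'rV[R]_d)) :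
  is_lebesgue lam -> (mu setT < +oo)%E -> measurable A -> mu A = 0%E ->
  lam.-negligible [set y : borel 'rV[R]_d | A y /\ ~ (forall e : R, 0 < e ->
    \forall r \near (0 : R)^'+, (mu (cball (y, r)) <= (e * r ^+ d)%:E)%E)].
Proof.
move=> lebl fmu mA A0.
pose bad (k : nat) : set (borel 'rV[R]_d) := [set y | A y /\
   ~ (\forall r \near (0 : R)^'+, (mu (cball (y, r)) <= (k.+1%:R^-1 * r ^+ d)%:E)%E)].
suff : lam.-negligible (\bigcup_k bad k).
  apply: negligibleS => y /= [Ay /existsNP[e /not_implyP[e0 H]]].
  exists (Num.truncn e^-1) => //; split => // H'; apply: H.
  near=> r; apply: le_trans (_ : _ <= ((Num.truncn e^-1).+1%:R^-1 * r ^+ d)%:E)%E _.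
    by near: r.
  rewrite lee_fin ler_wpM2r ?exprn_ge0//.
  by rewrite invf_ple ?posrE// ltW// truncnS_gt.
apply: negligible_bigcup => k; apply: negligible_small => e e0.
pose t : R := k.+1%:R^-1.
have t0 : 0 < t by rewrite invr_gt0.
(* The mass [e * t / 12 ^+ d] is what the maximal inequality at level [t] turns into [e]. *)
have [V [oV AV muV]] := outer_regular fmu mA A0 (divr_gt0 (mulr_gt0 e0 t0) (exprn_gt0 d (ltr0n R 12))).
have mV : measurable (V : set (borel 'rV[R]_d)) by exact: borel_open.
pose P : set ('rV[R]_d * R) := [set q | [/\ 0 < q.2, cball q `<=` V &
   ((t * q.2 ^+ d)%:E <= mu (cball q))%E]].
pose muV' : {measure set (borel 'rV[R]_d) -> \bar R} := mrestr mu mV.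
exists (\bigcup_(q in P) cball q); split.
- by apply: borel_open; apply: bigcup_open => q _; exact: cball_open.
- move=> y [Ay H].
  have : nbhs y V by apply: open_nbhs_nbhs; split => //; exact: AV.
  move=> /nbhs_ballP[r /= r0 rV].
  have [r' [r'0 r'r Hr']] : exists r' : R, [/\ 0 < r', r' < r & ~ (mu (cball (y, r')) <= (t * r' ^+ d)%:E)%E].
    apply: contrapT => nex; apply: H; near=> r'; apply: contrapT => Hr'; apply: nex.
    by exists r'; split.
  exists (y, r'); last by rewrite /cball/= subrr normr0.
  split => //=.
  + move=> z; rewrite /cball/= => zy; apply: rV; rewrite -ball_normE/= distrC.
    exact: lt_trans r'r.
  + by apply/ltW; rewrite ltNge; apply/negP.
- have := @maximal_inequality R d lam muV' t P lebl (ltW t0).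
  have HP q : P q -> 0 < q.2 /\ ((t * q.2 ^+ d)%:E <= muV' (cball q))%E.
    by move=> [q0 qO Hq]; split => //; rewrite /muV'/= /mrestr setIidl.
  move=> /(_ HP); rewrite /muV'/= /mrestr setTI => h.
  rewrite -(@lee_pmul2l _ t%:E)//; apply: le_trans h _.
  apply: le_trans (_ : _ <= (12 ^+ d)%:E * (e * t / 12 ^+ d)%:E)%E _.
    by rewrite lee_wpmul2l// lee_fin exprn_ge0.
  by rewrite -!EFinM lee_fin mulrC divfK ?expf_neq0// mulrC.
Unshelve. all: by end_near. Qed.
(** * Hitting times and the Poisson approximation *)

Lemma pr_fin (d : measure_display) (T : measurableType d) (R : realType)
    (nu : probability T R) (A : set T) : measurable A -> nu A = (fine (nu A))%:E.
Proof. by move=> mA; rewrite fineK// fin_num_measure. Qed.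

Lemma pr_ge0 (d : measure_display) (T : measurableType d) (R : realType)
    (nu : probability T R) (A : set T) : 0 <= fine (nu A).
Proof. exact: fine_ge0. Qed.

Lemma pr_le (d : measure_display) (T : measurableType d) (R : realType)
    (nu : probability T R) (A B : set T) : measurable A -> measurable B ->
  A `<=` B -> fine (nu A) <= fine (nu B).
Proof.
by move=> mA mB AB; rewrite -lee_fin -!pr_fin//; exact: le_mu.
Qed.

Lemma pr_le1 (d : measure_display) (T : measurableType d) (R : realType)
    (nu : probability T R) (A : set T) : measurable A -> fine (nu A) <= 1.
Proof. by move=> mA; rewrite -lee_fin -pr_fin//; exact: probability_le1. Qed.

Lemma prDI (d : measure_display) (T : measurableType d) (R : realType)
    (nu : probability T R) (A B : set T) : measurable A -> measurable B ->
  fine (nu A) = fine (nu (A `\` B)) + fine (nu (A `&` B)).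
Proof.
move=> mA mB; apply: EFin_inj; rewrite EFinD -!pr_fin//; last 2 first.
- exact: measurableI.
- exact: measurableD.
exact: measureDI.
Qed.

Lemma prU2 (d : measure_display) (T : measurableType d) (R : realType)
    (nu : probability T R) (A B : set T) : measurable A -> measurable B ->
  fine (nu (A `|` B)) <= fine (nu A) + fine (nu B).
Proof.
move=> mA mB; rewrite -lee_fin EFinD -!pr_fin//; last exact: measurableU.
exact: measureU2.
Qed.

Definition avoid (T : Type) (f : T -> T) (B : set T) (k : nat) : set T :=
  [set x | forall i, (i < k)%N -> ~ B (iter i f x)].

Definition return_set (T : Type) (f : T -> T) (B : set T) (t : nat) : set T :=
  [set x | exists j, (0 < j < t)%N /\ B (iter j f x)].

Lemma measurable_iter (d : measure_display) (T : measurableType d) (f : T -> T)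
    (n : nat) : measurable_fun setT f -> measurable_fun setT (iter n f).
Proof.
move=> mf; elim: n => [|n IH]; first exact: measurable_id.
exact: (measurableT_comp mf IH).
Qed.

Lemma measurable_preimage_iter (d : measure_display) (T : measurableType d) (f : T -> T)
    (n : nat) (B : set T) : measurable_fun setT f -> measurable B ->
  measurable [set x | B (iter n f x)].
Proof.
move=> mf mB; rewrite -[X in measurable X]setTI.
exact: (measurable_iter n mf).
Qed.

Lemma measurable_avoid (d : measure_display) (T : measurableType d) (f : T -> T)
    (B : set T) (k : nat) : measurable_fun setT f -> measurable B ->
  measurable (avoid f B k).
Proof.
move=> mf mB.
have -> : avoid f B k = \bigcap_(i in [set i | (i < k)%N]) [set x | (~` B) (iter i f x)].
  by apply/seteqP; split.
apply: bigcap_measurableType => i _; apply: measurable_preimage_iter => //.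
exact: measurableC.
Qed.

Lemma measurable_return (d : measure_display) (T : measurableType d) (f : T -> T)
    (B : set T) (t : nat) : measurable_fun setT f -> measurable B ->
  measurable (return_set f B t).
Proof.
move=> mf mB.
have -> : return_set f B t = \bigcup_(j in [set j | (0 < j < t)%N]) [set x | B (iter j f x)].
  by apply/seteqP; split => [x [j [jt Bj]]|x [j jt Bj]]; exists j.
by apply: bigcup_measurable => j _; exact: measurable_preimage_iter.
Qed.

(* By invariance nu (avoid k) - nu (avoid k.+1) is the mass of the points of B
   avoiding B at times 1, ..., k.  Dropping the times below t costs the points
   returning early, and mixing then decouples the two events. *)
Lemma avoid_poisson (d : measure_display) (T : measurableType d) (R : realType)
    (nu : probability T R) (f : T -> T) (B : set T) (t : nat) (xi : R) :
  measurable_fun setT f -> (forall A, measurable A -> nu (f @^-1` A) = nu A) ->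
  measurable B -> (0 < t)%N ->
  (forall k, `|fine (nu (B `&` [set x | avoid f B k (iter t f x)]))
     - fine (nu B) * fine (nu (avoid f B k))| <= xi) ->
  forall n, `|fine (nu (avoid f B n)) - (1 - fine (nu B)) ^+ n| <=
    n%:R * (fine (nu (B `&` return_set f B t)) + xi + t%:R * fine (nu B) ^+ 2)
    + t%:R * fine (nu B).
Proof.
move=> mf inv mB t0 Hxi.
set b := fine (nu B); set ret := fine (nu (B `&` return_set f B t)).
pose w k := fine (nu (avoid f B k)).
have b0 : 0 <= b by exact: pr_ge0.
have b1 : b <= 1 by exact: pr_le1.
have mW k : measurable (avoid f B k) by exact: measurable_avoid.
have mP k : measurable (f @^-1` avoid f B k).
  by rewrite -[X in measurable X]setTI; exact: mf.
have xi0 : 0 <= xi by apply: le_trans (Hxi 0%N).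
have ret0 : 0 <= ret by exact: pr_ge0.
have mR : measurable (return_set f B t) by exact: measurable_return.
have wS k : w k - w k.+1 = fine (nu (B `&` f @^-1` avoid f B k)).
  have -> : w k = fine (nu (f @^-1` avoid f B k)) by rewrite inv.
  rewrite (prDI nu (mP k) mB) setIC.
  have -> : f @^-1` avoid f B k `\` B = avoid f B k.+1.
    apply/seteqP; split => x.
      by move=> [H nB] [|i]//= ik; rewrite -iterS iterSr; exact: H.
    move=> H; split => [i ik|]; last exact: (H 0%N).
    by rewrite /= -iterSr; exact: H.
  by rewrite [w k.+1]/(fine _) addrC addKr.
have q0 k : 0 <= fine (nu (B `&` f @^-1` avoid f B k)) by exact: pr_ge0.
have qb k : fine (nu (B `&` f @^-1` avoid f B k)) <= b.
  by apply: pr_le => //; exact: measurableI.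
have w1 k : 0 <= w k <= 1 by rewrite pr_ge0 pr_le1.
have wdec m j : 0 <= w m - w (m + j)%N <= j%:R * b.
  elim: j => [|j IH]; first by rewrite addn0 subrr mul0r lexx.
  rewrite addnS; have := wS (m + j)%N; have := q0 (m + j)%N; have := qb (m + j)%N.
  by move: IH => /andP[]; rewrite -natr1 mulrDl mul1r; lra.
have step k : `|w k.+1 - (1 - b) * w k| <= ret + xi + t%:R * b ^+ 2 + (k < t)%:R * b.
  have tb0 : 0 <= t%:R * b ^+ 2 by rewrite mulr_ge0// sqr_ge0.
  have [kt|tk] := ltnP k t.
    have := wS k; have := q0 k; have := qb k; have /andP[k0 k1] := w1 k.
    have : 0 <= b * w k <= b by rewrite mulr_ge0//= ler_piMr.
    move=> /andP[h1 h2] h3 h4 h5.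
    by rewrite mul1r ler_norml; apply/andP; split; lra.
  (* After the gap, [m] of the times 1, ..., [k + 1] requirements remain: dropping the first [t - 1]
     times leaves avoidance from time [t] on, and replaces [w k] by [w m] at a cost of at most
     [t * b]. *)
  pose m := (k.+1 - t)%N.
  have km : k = (m + t.-1)%N by rewrite /m; lia.
  pose q' := fine (nu (B `&` [set x | avoid f B m (iter t f x)])).
  have mQ : measurable [set x | avoid f B m (iter t f x)].
    exact: measurable_preimage_iter.
  have l1 : fine (nu (B `&` f @^-1` avoid f B k)) <= q'.
    apply: pr_le; [exact: measurableI|exact: measurableI|].
    move=> x [Bx H]; split => // i im; rewrite /= -iterD addnC.
    have := H (t.-1 + i)%N; rewrite /= -iterSr -addSn (prednK t0); apply.
    by move: im; rewrite /m; lia.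
  have l2 : q' <= fine (nu (B `&` f @^-1` avoid f B k)) + ret.
    apply: le_trans (prU2 _ _ _); [|exact: measurableI|exact: measurableI].
    apply: pr_le; [exact: measurableI|by apply: measurableU; exact: measurableI|].
    move=> x [Bx H].
    have [Rx|nRx] := pselect (return_set f B t x); first by right.
    left; split => // i ik; rewrite /= -iterSr => Bi.
    have [it|ti] := ltnP i.+1 t; first by apply: nRx; exists i.+1.
    apply: (H (i.+1 - t)%N); first by move: ik; rewrite km; lia.
    by rewrite /= -iterD subnK.
  have := Hxi m; rewrite -/q' -/b -/(w m) => hx.
  have := wdec m t.-1; rewrite -km => /andP[d0 d1].
  have := wS k => hS.
  have bd : 0 <= b * (w m - w k) <= t%:R * b ^+ 2.
    rewrite mulr_ge0//= expr2 [t%:R * _]mulrA mulrC ler_wpM2r//.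
    by apply: le_trans d1 _; rewrite ler_wpM2r// ler_nat leq_pred.
  move: hx bd; rewrite ler_norml mul0r addr0 => /andP[hx1 hx2] /andP[bd1 bd2].
  by rewrite ler_norml; apply/andP; split; lra.
(* The extra error [b] arises only at the steps before [t], which accounts for [minn n t]. *)
have main n : `|w n - (1 - b) ^+ n| <= n%:R * (ret + xi + t%:R * b ^+ 2) + (minn n t)%:R * b.
  elim: n => [|n IH].
    have -> : w 0%N = 1.
      rewrite /w (_ : avoid f B 0 = setT) ?probability_setT//.
      by apply/seteqP; split.
    by rewrite expr0 subrr normr0 min0n !mul0r addr0.
  have -> : w n.+1 - (1 - b) ^+ n.+1 = (w n.+1 - (1 - b) * w n) + (1 - b) * (w n - (1 - b) ^+ n).
    by rewrite exprS; ring.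
  apply: le_trans (ler_normD _ _) _; rewrite normrM ger0_norm ?subr_ge0//.
  have h1 := step n.
  have h2 : (1 - b) * `|w n - (1 - b) ^+ n| <= `|w n - (1 - b) ^+ n|.
    by rewrite ler_piMl//; lra.
  have -> : (minn n.+1 t)%:R = (minn n t)%:R + (n < t)%:R :> R.
    by rewrite -natrD; congr (_%:R); case: ltnP => h; lia.
  move: h1 h2 IH; set A := `|_ - _ * _|; set D := `|_ - _ ^+ _|.
  by rewrite -natr1 => h1 h2 IH; lra.
move=> n; apply: le_trans (main n) _; rewrite lerD2l ler_wpM2r// ler_nat geq_minr//.
Qed.

(** * Elementary exponential estimates *)

Lemma exp_sub_le (R : realType) (a b : R) : a <= 0 -> b <= 0 ->
  `|expR a - expR b| <= `|a - b|.
Proof.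
wlog ab : a b / a <= b.
  move=> H a0 b0; have [ab|ba] := leP a b; first exact: H.
  by rewrite distrC [leRHS]distrC; apply: H => //; exact: ltW.
move=> a0 b0; rewrite distrC ger0_norm ?subr_ge0 ?ler_expR// distrC ger0_norm ?subr_ge0//.
have -> : expR b - expR a = expR b * (1 - expR (a - b)).
  by rewrite mulrBr mulr1 -expRD subrKC.
have e1 : expR b <= 1 by rewrite expR_le1.
have e0 : 0 <= 1 - expR (a - b) by rewrite subr_ge0 expR_le1; lra.
apply: le_trans (_ : _ <= 1 - expR (a - b)) _; first by rewrite ler_piMl.
have := expR_ge1Dx (a - b); lra.
Qed.

Lemma pow_sub_le (R : realType) (a b : R) (n : nat) : 0 <= a <= 1 -> 0 <= b <= 1 ->
  `|a ^+ n - b ^+ n| <= n%:R * `|a - b|.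
Proof.
move=> /andP[a0 a1] /andP[b0 b1]; elim: n => [|n IH]; first by rewrite subrr normr0 mul0r.
have -> : a ^+ n.+1 - b ^+ n.+1 = a * (a ^+ n - b ^+ n) + (a - b) * b ^+ n.
  by rewrite !exprS; ring.
apply: le_trans (ler_normD _ _) _; rewrite !normrM (ger0_norm a0) (@ger0_norm _ (b ^+ n)) ?exprn_ge0//.
have h1 : a * `|a ^+ n - b ^+ n| <= `|a ^+ n - b ^+ n| by rewrite ler_piMl.
have h2 : `|a - b| * b ^+ n <= `|a - b| by rewrite ler_piMr// exprn_ile1.
rewrite -natr1 mulrDl mul1r; lra.
Qed.

Lemma pow_exp_le (R : realType) (b : R) (n : nat) : 0 <= b <= 1 ->
  `|(1 - b) ^+ n - expR (- (n%:R * b))| <= n%:R * b ^+ 2.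
Proof.
move=> /andP[b0 b1].
have -> : expR (- (n%:R * b)) = expR (- b) ^+ n.
  by rewrite -expRM_natl mulrN.
apply: le_trans (pow_sub_le _ _ _) _.
- by rewrite subr_ge0 b1/=; lra.
- by rewrite expR_ge0 expR_le1 oppr_le0.
rewrite ler_wpM2l// distrC.
have e1 := expR_ge1Dx (- b).
rewrite ger0_norm; last lra.
(* Both sides are compared after multiplication by [1 + b]: the exponential gives at most 1, and
   [1 - b + b^2] gives [1 + b^3]. *)
have e2 : expR (- b) * (1 + b) <= 1.
  rewrite expRN ler_pdivrMl ?expR_gt0// mulr1; exact: expR_ge1Dx.
have e3 : 1 <= (1 - b + b ^+ 2) * (1 + b).
  have : 0 <= b ^+ 3 by rewrite exprn_ge0.
  have -> : (1 - b + b ^+ 2) * (1 + b) = 1 + b ^+ 3 by ring.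
  lra.
have b10 : 0 < 1 + b by lra.
have : expR (- b) <= 1 - b + b ^+ 2.
  by rewrite -(ler_pM2r b10); exact: le_trans e2 e3.
lra.
Qed.

(** On the negative axis the exponential is 1-Lipschitz, so it suffices to compare exponents. For
    [y = tau / m] at most 1/2, [ln (1 - y)] lies between [- y - 2 * y^2] and [- y]. *)
Lemma powR_exp_le (R : realType) (tau m : R) : 0 <= tau -> 0 < m -> 2 * tau <= m ->
  `|(1 - tau / m) `^ m - expR (- tau)| <= 2 * tau ^+ 2 / m.
Proof.
move=> tau0 m0 tm.
pose y := tau / m.
have y0 : 0 <= y by rewrite divr_ge0// ltW.
have y1 : y <= 2^-1 by rewrite ler_pdivrMr//; lra.
have x0 : 0 < 1 - y by lra.
have my : m * y = tau by rewrite /y mulrC divfK// gt_eqF.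
rewrite -/y /powR gt_eqF//.
have l1 : ln (1 - y) <= - y.
  have := @le_ln1Dx R (- y); apply; lra.
have l2 : - y - 2 * y ^+ 2 <= ln (1 - y).
  have iv : 0 < (1 - y)^-1 by rewrite invr_gt0.
  have := @le_ln1Dx R ((1 - y)^-1 - 1).
  rewrite subrKC lnV ?posrE// => h.
  have {}h : - ln (1 - y) <= (1 - y)^-1 - 1 by apply: h; lra.
  have : (1 - y)^-1 <= 1 + y + 2 * y ^+ 2.
    rewrite -[leLHS]mul1r ler_pdivrMr//.
    have -> : (1 + y + 2 * y ^+ 2) * (1 - y) = 1 + y ^+ 2 * (1 - 2 * y) by ring.
    by rewrite lerDl mulr_ge0 ?sqr_ge0//; lra.
  lra.
have m1 : m * ln (1 - y) <= - tau.
  have : m * ln (1 - y) <= m * - y by rewrite ler_pM2l.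
  by rewrite mulrN my.
have m2 : - tau - 2 * tau ^+ 2 / m <= m * ln (1 - y).
  have -> : - tau - 2 * tau ^+ 2 / m = m * (- y - 2 * y ^+ 2).
    by rewrite /y; field; rewrite gt_eqF.
  by rewrite ler_pM2l.
apply: le_trans (exp_sub_le _ _) _; [lra|lra|].
by rewrite ler_norml; apply/andP; split; lra.
Qed.

(** * Decorrelation of balls and the tail of the density *)

Lemma truncate_rdist_lipschitz (R : realType) (d : nat) (M : riemannianManifold R d)
    (B : R) (a x y : M) : 0 <= B ->
  ((`|truncate B (rdist x a) - truncate B (rdist y a)|)%:E <= rdist x y)%E.
Proof.
move=> B0.
suff H (u v : M) : ((truncate B (rdist u a) - truncate B (rdist v a))%:E <= rdist u v)%E.
  have [h|h] := leP (truncate B (rdist y a)) (truncate B (rdist x a)).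
    by rewrite ger0_norm ?subr_ge0//; exact: H.
  by rewrite ltr0_norm ?subr_lt0// opprB (rdistC x y); exact: H.
case E : (rdist u v) (rdist_ge0 u v) => [t| |]// t0; last by rewrite leey.
rewrite lee_fin lerBlDr.
have [vB|vB] := ltP (truncate B (rdist v a)) B; last first.
  apply: le_trans (truncate_le B0 (rdist_ge0 _ _)) _; apply: le_trans vB _.
  by rewrite lerDr -lee_fin.
apply: truncate_leP; first exact: rdist_ge0.
apply: le_trans (rdist_triangle _ v _) _.
by rewrite E EFinD -(truncate_id (rdist_ge0 _ _) vB).
Qed.

Lemma measurable_truncate_rdist (R : realType) (d : nat) (M : riemannianManifold R d)
    (B : R) (a : M) : 0 <= B ->
  measurable_fun setT ((fun x => truncate B (rdist x a)) : borel M -> R).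
Proof.
move=> B0; apply: (measurability _ (RGenInftyO.measurableE R)) => //.
move=> _ [_ [c ->] <-]; rewrite setTI.
have [cB|Bc] := leP c B.
  rewrite (_ : _ @^-1` _ = [set x | (rdist x a < c%:E)%E]).
    by apply: borel_open; exact: (rdist_ball_open a c).2.
  by apply/seteqP; split => x /=; rewrite in_itv/= truncate_lt// rdist_ge0.
rewrite (_ : _ @^-1` _ = setT)//.
apply/seteqP; split => x //= _; rewrite in_itv/=; apply: le_lt_trans Bc.
by apply: truncate_le => //; exact: rdist_ge0.
Qed.

Lemma bounded01_integrable (d : measure_display) (T : measurableType d) (R : realType)
    (nu : probability T R) (g : T -> R) : measurable_fun setT g ->
  (forall x, 0 <= g x <= 1) -> nu.-integrable setT (EFin \o g).
Proof.
move=> mg g01; apply: measurable_bounded_integrable => //.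
  by apply: le_lt_trans (probability_le1 _ _) (ltry _).
exists 1; split; first exact: num_real.
move=> y y1 x _ /=; have /andP[g0 g1] := g01 x.
by rewrite ger0_norm// (le_trans g1)// ltW.
Qed.

Lemma Rintegral_indic_pr (d : measure_display) (T : measurableType d) (R : realType)
    (nu : probability T R) (A : set T) : measurable A ->
  \int[nu]_x (\1_A x : R) = fine (nu A).
Proof. by move=> mA; rewrite /Rintegral integral_indic// setIT. Qed.

Lemma indic01 (T : Type) (R : realType) (A : set T) (x : T) : 0 <= (\1_A x : R) <= 1.
Proof. by rewrite indicE; case: (_ \in _); rewrite /= ?lexx ?ler01. Qed.

(* The indicator of a ball is sandwiched between Lipschitz functions supported
   in a slightly larger ball. *)
Lemma decorrelation (R : realType) (d : nat) (M : riemannianManifold R d)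
    (f : borel M -> borel M) (nu : probability (borel M) R) (Theta : nat -> R)
    (xt : M) (r eps : R) (W : set (borel M)) (t : nat) :
  correlation_decay f nu Theta -> measurable_fun setT f -> measurable W ->
  0 < r -> 0 < eps -> 0 <= Theta t ->
  `|fine (nu ([set x | (rdist x xt < r%:E)%E] `&` [set x | W (iter t f x)])) -
      fine (nu [set x | (rdist x xt < r%:E)%E]) * fine (nu W)| <=
    fine (nu ([set x | (rdist x xt < (r + eps)%:E)%E] `\`
              [set x | (rdist x xt < r%:E)%E])) + Theta t * (1 + eps^-1).
Proof.
move=> cd mf mW r0 e0 Th0; 
pose B : set (borel M) := [set x | (rdist x xt < r%:E)%E].
pose B' : set (borel M) := [set x | (rdist x xt < (r + eps)%:E)%E].
change (`|fine (nu (B `&` [set x | W (iter t f x)])) - fine (nu B) * fine (nu W)| <=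
  fine (nu (B' `\` B)) + Theta t * (1 + eps^-1)).
have re0 : 0 <= r + eps by rewrite addr_ge0// ltW.
have mB : measurable B by apply: borel_open; exact: (rdist_ball_open xt r).2.
have mB' : measurable B' by apply: borel_open; exact: (rdist_ball_open xt (r + eps)).2.
pose P := [set x : borel M | W (iter t f x)].
have mP : measurable P by exact: measurable_preimage_iter.
pose tr (x : M) := truncate (r + eps) (rdist x xt).
have trle x : tr x <= r + eps by apply: truncate_le => //; exact: rdist_ge0.
(* Equal to 1 on the ball of radius [r] and to 0 outside the ball of radius [r + eps], at infinite
   distance too because of the truncation. Its Lipschitz constant [eps^-1] produces the factor
   [1 + eps^-1]. *)
pose phi (x : borel M) : R := Num.min 1 ((r + eps - tr x) / eps).
have phi01 x : 0 <= phi x <= 1.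
  by rewrite /phi le_min ler01 ge_min lexx/= divr_ge0 ?subr_ge0//; exact: ltW.
have mphi : measurable_fun setT phi.
  apply: measurable_minr; first exact: measurable_cst.
  apply: measurable_funM; last exact: measurable_cst.
  apply: measurable_funB; first exact: measurable_cst.
  exact: measurable_truncate_rdist.
have phiB x : \1_B x <= phi x.
  rewrite indicE; case: (boolP (x \in B)) => [/set_mem Bx|_]; last by have /andP[] := phi01 x.
  rewrite /phi le_min lexx/= ler_pdivlMr// mul1r.
  have : tr x <= r by rewrite /tr; apply: truncate_leP; [exact: rdist_ge0|exact: ltW].
  by rewrite /=; lra.
have phiB' x : phi x <= \1_B' x.
  rewrite indicE; case: (boolP (x \in B')) => [_|nB]; first by have /andP[] := phi01 x.
  rewrite /phi ge_min; apply/orP; right.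
  have : ~~ (tr x < r + eps).
    rewrite /tr truncate_lt//; last exact: rdist_ge0.
    by apply: contra nB => H; rewrite inE.
  rewrite -leNgt => h; rewrite pmulr_lle0 ?invr_gt0// /=; lra.
have iphi := bounded01_integrable nu mphi phi01.
have lip : (lip_norm (M := M) phi <= (1 + eps^-1)%:E)%E.
  rewrite /lip_norm EFinD; apply: leeD.
    apply: ge_ereal_sup => _ [x _ <-]; rewrite lee_fin.
    by have /andP[h1 h2] := phi01 x; rewrite ger0_norm.
  apply: ereal_inf_lbound; exists eps^-1 => //; split; first by rewrite invr_ge0 ltW.
  move=> x y.
  have h : `|phi x - phi y| <= eps^-1 * `|tr x - tr y|.
    have E (a b : R) : `|Num.min 1 a - Num.min 1 b| <= `|a - b|.
      rewrite /Num.min; case: ltP => ha; case: ltP => hb.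
      - by rewrite subrr normr0.
      - by rewrite !ger0_norm; lra.
      - by rewrite !ler0_norm; lra.
      - by [].
    apply: le_trans (E _ _) _.
    rewrite -mulrBl normrM mulrC gtr0_norm ?invr_gt0// ler_pM2l ?invr_gt0//.
    by rewrite (_ : _ - _ = tr y - tr x); [rewrite distrC|ring].
  apply: (@le_trans _ _ ((eps^-1)%:E * (`|tr x - tr y|)%:E)%E).
    by rewrite -EFinM lee_fin.
  rewrite lee_wpmul2l ?lee_fin ?invr_ge0 ?(ltW e0)//.
  exact: truncate_rdist_lipschitz.
have Linf : ('N[nu]_+oo%E [EFin \o (\1_W : borel M -> R)] <= 1%:E)%E.
  rewrite unlock; case: ifP => // _.
  apply/ess_sup_inf.ess_supP; apply: aeW => x /=.
  by rewrite lee_fin; have /andP[h1 h2] := indic01 R W x; rewrite ger0_norm.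
have := cd phi (\1_W) t (le_lt_trans lip (ltry _)) (measurable_indic mW)
  (le_lt_trans Linf (ltry _)).
have Lge0 : (0 <= 'N[nu]_+oo%E [EFin \o (\1_W : borel M -> R)])%E by exact: Lnorm_ge0.
move=> /le_trans /(_ (_ : _ <= (Theta t * (1 + eps^-1))%:E)%E) H.
have {}H : ((`|\int[nu]_x (phi x * \1_W (iter t f x)) - \int[nu]_x phi x * \int[nu]_x \1_W x|) <=
    Theta t * (1 + eps^-1)).
  rewrite -lee_fin; apply: H.
  apply: (@le_trans _ _ ((Theta t)%:E * (1 + eps^-1)%:E * 1)%E); last by rewrite mule1 -EFinM.
  apply: lee_pmul => //.
    rewrite mule_ge0 ?lee_fin// /lip_norm adde_ge0//.
      apply: le_trans (ereal_sup_ubound _); last by exists xt.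
      by rewrite lee_fin.
    by apply: le_ereal_inf_tmp => _ [L [L0 _] <-]; rewrite lee_fin.
  by rewrite lee_wpmul2l ?lee_fin.
rewrite Rintegral_indic_pr// in H.
have ind1 (A : set (borel M)) x : 0 <= (\1_A x : R) <= 1 by exact: indic01.
have mg : measurable_fun setT (fun x => phi x * \1_P x).
  by apply: measurable_funM => //; exact: measurable_indic.
have g01 x : 0 <= phi x * \1_P x <= 1.
  have /andP[h1 h2] := phi01 x; have /andP[h3 h4] := ind1 P x.
  by rewrite mulr_ge0//= mulr_ile1.
have ig := bounded01_integrable nu mg g01.
have gE : \int[nu]_x (phi x * \1_W (iter t f x)) = \int[nu]_x (phi x * \1_P x).
  by apply: eq_Rintegral => x _; rewrite !indicE.
have iI (A : set (borel M)) : measurable A -> nu.-integrable setT (EFin \o (\1_A : borel M -> R)).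
  by move=> mA; apply: bounded01_integrable => //; exact: measurable_indic.
have indI (A C : set (borel M)) x : (\1_(A `&` C) x : R) = \1_A x * \1_C x.
  by rewrite indicI.
have l1 : fine (nu (B `&` P)) <= \int[nu]_x (phi x * \1_P x).
  rewrite -(Rintegral_indic_pr nu (measurableI _ _ mB mP)); apply: le_Rintegral => //.
    by apply: iI; exact: measurableI.
  by move=> x _; rewrite indI ler_wpM2r//; have /andP[] := ind1 P x.
have l2 : \int[nu]_x (phi x * \1_P x) <= fine (nu (B' `&` P)).
  rewrite -(Rintegral_indic_pr nu (measurableI _ _ mB' mP)); apply: le_Rintegral => //.
    by apply: iI; exact: measurableI.
  by move=> x _; rewrite indI ler_wpM2r//; have /andP[] := ind1 P x.
have l3 : fine (nu B) <= \int[nu]_x phi x.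
  by rewrite -(Rintegral_indic_pr nu mB); apply: le_Rintegral => //; exact: iI.
have l4 : \int[nu]_x phi x <= fine (nu B').
  by rewrite -(Rintegral_indic_pr nu mB'); apply: le_Rintegral => //; exact: iI.
have BB' : B `<=` B' by move=> x /= h; apply: lt_trans h _; rewrite lte_fin ltrDl.
have l5 : fine (nu B') = fine (nu (B' `\` B)) + fine (nu B).
  by rewrite (prDI nu mB' mB) (setIidr BB').
have l6 : fine (nu (B' `&` P)) <= fine (nu (B' `\` B)) + fine (nu (B `&` P)).
  apply: le_trans (prU2 _ _ _); [|exact: measurableD|exact: measurableI].
  apply: pr_le; [exact: measurableI|apply: measurableU; [exact: measurableD|exact: measurableI]|].
  by move=> x [B'x Px]; have [Bx|nBx] := pselect (B x); [right|left].
move: H; rewrite gE.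
set I1 := \int[nu]_x _ in l1 l2 *; set I2 := \int[nu]_x _ in l3 l4 *.
set w := fine (nu W); set a := fine (nu (B' `\` B)) in l5 l6 *.
have w0 : 0 <= w by exact: pr_ge0.
have w1 : w <= 1 by exact: pr_le1.
have a0 : 0 <= a by exact: pr_ge0.
have h1 : fine (nu B) * w <= I2 * w by rewrite ler_wpM2r.
have h2 : I2 * w <= (fine (nu B) + a) * w by rewrite ler_wpM2r//; lra.
have h3 : a * w <= a by rewrite ler_piMr.
rewrite !ler_norml => /andP[h4 h5]; apply/andP; split; lra.
Qed.

(** Splits the density at the level [s]: above it, [rho] is at most [s^(- delta) * rho^(1 + delta)].
    The level stays free, to be tuned to the size of the annulus. *)
Lemma density_tail (R : realType) (d : nat) (M : riemannianManifold R d)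
    (m : {measure set (borel M) -> \bar R}) (nu : probability (borel M) R)
    (rho : borel M -> R) (delta : R) : 0 < delta ->
  is_density m nu rho -> finite_norm m (1 + delta)%:E rho ->
  exists2 I : R, 0 <= I & forall (A : set (borel M)) (s : R), measurable A -> 0 < s ->
    (nu A <= s%:E * m A + (s `^ (- delta) * I)%:E)%E.
Proof.
move=> dl0 [mrho rho0 nuE] fn.
have p0 : 0 < 1 + delta by lra.
pose J := (\int[m]_x (rho x `^ (1 + delta))%:E)%E.
have J0 : (0 <= J)%E by apply: integral_ge0 => x _; rewrite lee_fin powR_ge0.
have Jfin : (J < +oo)%E.
  move: fn; rewrite /finite_norm unlock /=.
  have -> : (\int[m]_x (`|(rho x)%:E| `^ (1 + delta)))%E = J.
    by apply: eq_integral => x _; rewrite /= ger0_norm.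
  by apply: lty_poweRy; rewrite invr_eq0 gt_eqF.
have JE : J = (fine J)%:E by rewrite fineK// ge0_fin_numE.
exists (fine J); first exact: fine_ge0.
move=> A s mA s0.
have mpow : measurable_fun setT (fun x => rho x `^ (1 + delta)).
  exact: (measurableT_comp (measurable_powR (1 + delta)) mrho).
rewrite nuE//.
apply: (@le_trans _ _ (\int[m]_(x in A) (s%:E + (s `^ (- delta) * rho x `^ (1 + delta))%:E))%E).
  apply: ge0_le_integral => //.
  - by move=> x _; rewrite lee_fin.
  - by apply/measurable_EFinP; exact: measurable_funTS.
  - apply: emeasurable_funD => //; apply/measurable_EFinP; apply: measurable_funTS.
    by apply: measurable_funM => //.
  - move=> x _; rewrite -EFinD lee_fin.
    have [xs|sx] := leP (rho x) s.
      by rewrite (le_trans xs)// lerDl mulr_ge0 ?powR_ge0.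
    have x0 : 0 < rho x by exact: lt_trans sx.
    rewrite -[leLHS]add0r; apply: lerD; first exact: ltW.
    rewrite powRD; last by rewrite gt_eqF// implybT.
    rewrite powRr1// mulrC -mulrA ler_peMr//.
    rewrite powRN ler_pdivlMr ?powR_gt0// mul1r.
    by apply: ge0_ler_powR; rewrite ?nnegrE ?(ltW dl0)// ltW.
rewrite ge0_integralD//; last 3 first.
- by move=> x _; rewrite lee_fin ltW.
- by move=> x _; rewrite lee_fin mulr_ge0 ?powR_ge0.
- by apply/measurable_EFinP; apply: measurable_funTS; exact: measurable_funM.
rewrite integral_cst// leeD2l//.
under eq_integral do rewrite EFinM.
rewrite ge0_integralZl//; last 3 first.
- by apply/measurable_EFinP; exact: measurable_funTS.
- by move=> x _; rewrite lee_fin powR_ge0.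
- by rewrite lee_fin powR_ge0.
rewrite EFinM lee_wpmul2l ?lee_fin ?powR_ge0// -JE.
apply: ge0_subset_integral => //; first exact/measurable_EFinP.
by move=> x _; rewrite lee_fin powR_ge0.
Qed.

(** * Differentiation of measures *)

Lemma negligible_bigcup_count (d : measure_display) (T : measurableType d) (R : realType)
    (mu : {measure set T -> \bar R}) (I : countType) (F : I -> set T) :
  (forall i, mu.-negligible (F i)) -> mu.-negligible (\bigcup_i F i).
Proof.
move=> nF; pose G n := if @unpickle I n is Some i then F i else set0.
have nG n : mu.-negligible (G n).
  by rewrite /G; case: unpickle => //; exact: negligible_set0.
apply: negligibleS (negligible_bigcup nG) => x [i _ Fx].
by exists (pickle i) => //; rewrite /G pickleK.
Qed.

Lemma measurable_cball (R : realType) (d : nat) (q : 'rV[R]_d * R) :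
  measurable (cball q : set (borel 'rV[R]_d)).
Proof. by apply: borel_open; exact: cball_open. Qed.

Lemma lebesgue_cball_le (R : realType) (d : nat)
    (lam : {measure set (borel 'rV[R]_d) -> \bar R}) (y : 'rV[R]_d) (r : R)
    (D : set (borel 'rV[R]_d)) : is_lebesgue lam -> 0 <= r -> measurable D ->
  D `<=` cball (y, r) -> (lam D <= ((2 * r) ^+ d)%:E)%E.
Proof.
move=> lebl r0 mD Dc; apply: le_trans (lebesgue_ball_le y lebl r0).
by apply: (@le_mu _ _ _ lam D (cball (y, r))) => //; exact: measurable_cball.
Qed.

Lemma near_cball (R : realType) (d : nat) (y : 'rV[R]_d) (A : set 'rV[R]_d) :
  nbhs y A -> \forall r \near (0 : R)^'+, cball (y, r) `<=` A.
Proof.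
move=> /nbhs_ballP[r /= r0 rA]; near=> s => z; rewrite /cball/= => zs; apply: rA.
by rewrite -ball_normE/= distrC (lt_trans zs).
Unshelve. all: by end_near. Qed.

(** Telescoping: [c / (x + 1)^2 <= c / x - c / (x + 1)]. *)
Lemma sum_inv_sqr_le (R : realType) (c : R) (K n : nat) : 0 <= c ->
  \sum_(0 <= j < n) c / (K.+1 + j).+1%:R ^+ 2 <= c / K.+1%:R.
Proof.
move=> c0.
suff : \sum_(0 <= j < n) c / (K.+1 + j).+1%:R ^+ 2 <= c / K.+1%:R - c / (K.+1 + n)%:R.
  by move/le_trans; apply; rewrite gerBl divr_ge0.
elim: n => [|n IH]; first by rewrite big_nil addn0 subrr.
rewrite big_nat_recr//=; apply: le_trans (lerD IH (lexx _)) _.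
rewrite -addrA lerD2l addnS.
have := ltr0Sn R (K + n); rewrite -addSn; set x := (K.+1 + n)%:R => x0.
have -> : (K.+1 + n).+1%:R = x + 1 by rewrite /x -natr1.
suff : 0 <= c / x - c / (x + 1) - c / (x + 1) ^+ 2 by lra.
have -> : c / x - c / (x + 1) - c / (x + 1) ^+ 2 = c / (x * (x + 1) ^+ 2).
  by field; rewrite !gt_eqF// addr_gt0.
by rewrite divr_ge0// mulr_ge0 ?exprn_ge0// ?addr_ge0// ltW.
Qed.

(* Borel-Cantelli for the superlevel sets of the maximal functions of mu k. *)
Lemma maximal_borel_cantelli (R : realType) (d : nat)
    (lam : {measure set (borel 'rV[R]_d) -> \bar R})
    (mu : nat -> {measure set (borel 'rV[R]_d) -> \bar R}) (b : nat -> R) :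
  is_lebesgue lam ->
  (\forall k \near \oo, 0 < b k /\ (mu k setT <= (b k)%:E)%E) ->
  lam.-negligible [set y : borel 'rV[R]_d | ~ \forall k \near \oo, forall r, 0 < r ->
    (mu k (cball (y, r)) <= (k%:R ^+ 2 * b k * r ^+ d)%:E)%E].
Proof.
move=> lebl [K0 _ HK].
pose P k : set ('rV[R]_d * R) := [set q | 0 < q.2 /\
  ((k%:R ^+ 2 * b k * q.2 ^+ d)%:E <= mu k (cball q))%E].
pose U k : set (borel 'rV[R]_d) := \bigcup_(q in P k) cball q.
have mU k : measurable (U k).
  by apply: borel_open; apply: bigcup_open => q _; exact: cball_open.
(* At the level [k^2 * b k] the maximal inequality cancels [b k]; the factor [k^2] is put in to
   leave a summable series. *)
have lamU k : (0 < k)%N -> (K0 <= k)%N -> (lam (U k) <= (12 ^+ d / k%:R ^+ 2)%:E)%E.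
  move=> k0 /HK/=[bk0 mub].
  have t0 : 0 < k%:R ^+ 2 * b k by rewrite mulr_gt0// exprn_gt0 ?ltr0n.
  have := @maximal_inequality R d lam (mu k) _ (P k) lebl (ltW t0) (fun q Pq => Pq).
  move=> h; rewrite -(@lee_pmul2l _ (k%:R ^+ 2 * b k)%:E)//; apply: le_trans h _.
  apply: (@le_trans _ _ ((12 ^+ d)%:E * (b k)%:E)%E).
    by rewrite lee_wpmul2l// lee_fin exprn_ge0.
  rewrite -!EFinM lee_fin le_eqVlt; apply/orP; left; apply/eqP; field.
  by rewrite pnatr_eq0 -lt0n.
apply: negligible_small => e e0.
pose K := maxn K0 (Num.truncn (12 ^+ d / e)).
exists (\bigcup_j U (K.+1 + j).+1); split.
- by apply: bigcupT_measurable => j; exact: mU.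
- move=> y /= H; apply: contrapT => nH; apply: H.
  exists (K.+2) => // k /= Kk r r0; rewrite leNgt; apply/negP => h; apply: nH.
  exists (k - K.+2)%N => //; rewrite (_ : (K.+1 + (k - K.+2)).+1 = k); last by lia.
  exists (y, r); last by rewrite /cball/= subrr normr0.
  by split => //; exact: ltW.
- apply: le_trans (@measure_sigma_subadditive _ _ _ lam _ (fun j => U (K.+1 + j).+1) _ _ _) _ => //.
    by apply: bigcupT_measurable => j; exact: mU.
  apply: lime_le; first by apply: is_cvg_nneseries => j _ _; exact: measure_ge0.
  apply: nearW => n.
  apply: (@le_trans _ _ (\sum_(0 <= j < n) (12 ^+ d / (K.+1 + j).+1%:R ^+ 2)%:E)%E).
    apply: lee_sum => j _; apply: lamU => //.
    by rewrite /K; have := leq_maxl K0 (Num.truncn (12 ^+ d / e)); lia.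
  rewrite sumEFin lee_fin; apply: le_trans (sum_inv_sqr_le K n _) _; first by rewrite exprn_ge0.
  rewrite ler_pdivrMr// -ler_pdivrMl// mulrC ltW//.
  apply: lt_le_trans (truncnS_gt _) _; rewrite ler_nat ltnS; exact: leq_maxr.
Qed.

(** The arithmetic of [density_differentiation]: [m1], [l1] are the masses off a level set of [w],
    and [m2], [l2] those on it. The choice of [e1] bounds the first pair by half of the error, and
    [eta] bounds the oscillation of [w] and [k] by the other half. *)
Lemma density_squeeze (R : realType) (w k q q' s e c rd m1 m2 l1 l2 : R) :
  let e1 := e / (2 * (1 + w * k)) in
  let eta := Num.min 1 (e / (2 * c * (w + k + 1))) in
  0 < e -> 0 < c -> 0 <= rd -> 0 <= w -> 0 <= k -> 0 <= m1 -> 0 <= l1 -> 0 <= l2 ->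
  0 <= s -> 0 <= q -> q <= w -> w - eta <= q -> q' <= w + eta ->
  s <= k -> k - eta <= s ->
  m1 <= e1 * rd -> l1 <= e1 * rd -> l1 + l2 <= c * rd ->
  q * s * l2 <= m2 -> m2 <= q' * (k + eta) * l2 ->
  `|m1 + m2 - w * k * (l1 + l2)| <= e * rd.
Proof.
move=> e1 eta e0 c0 rd0 w0 k0 m10 l10 l20 s0 q0 qw wq wq' sk ks b1 b2 l12 h1 h2.
have wk0 : 0 <= w * k by rewrite mulr_ge0.
have wk1 : 0 < w + k + 1 by rewrite ltr_wpDl// addr_ge0.
have eta0 : 0 < eta by rewrite /eta lt_min ltr01 divr_gt0// mulr_gt0// mulr_gt0.
have eta1 : eta <= 1 by rewrite /eta ge_min lexx.
have etae : eta * (w + k + 1) * c <= e / 2.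
  have : eta <= e / (2 * c * (w + k + 1)) by rewrite /eta ge_min lexx orbT.
  rewrite ler_pdivlMr; last by rewrite mulr_gt0// mulr_gt0.
  clearbody eta e1; nra.
have H4 : e1 * rd * (1 + w * k) = e / 2 * rd.
  by rewrite /e1; field; rewrite gt_eqF// ltr_pwDl.
clearbody e1 eta.
have H1 : w * k - q * s <= eta * (w + k + 1).
  have : (w - q) * k <= eta * k by rewrite ler_wpM2r//; lra.
  have : q * (k - s) <= w * eta by apply: ler_pM => //; lra.
  by nra.
have H2 : q' * (k + eta) - w * k <= eta * (w + k + 1).
  have : q' * (k + eta) <= (w + eta) * (k + eta).
    by rewrite ler_wpM2r// addr_ge0// ltW.
  by nra.
have H3 : eta * (w + k + 1) * l2 <= e / 2 * rd.
  apply: (@le_trans _ _ (eta * (w + k + 1) * (c * rd))).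
    by rewrite ler_wpM2l//; [rewrite mulr_ge0// ltW|lra].
  by rewrite mulrA ler_wpM2r.
have H5 : w * k * l1 <= w * k * (e1 * rd) by rewrite ler_wpM2l.
have H6 : w * k * l2 - q * s * l2 <= e / 2 * rd.
  by rewrite -mulrBl; apply: le_trans H3; rewrite ler_wpM2r.
have H7 : q' * (k + eta) * l2 - w * k * l2 <= e / 2 * rd.
  by rewrite -mulrBl; apply: le_trans H3; rewrite ler_wpM2r.
have H8 : 0 <= w * k * l1 by rewrite mulr_ge0.
have H9 : 0 <= w * k * (e1 * rd) by apply: le_trans H5.
rewrite ler_norml; apply/andP; split; lra.
Qed.

(** Slice [U] by level sets of [w] with rational bounds. By [null_density], almost every point of a
    slice sees only a negligible part of [mu] and [lam] outside it, and on the slice both [w] and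
    [k] are nearly constant. The set [D] is arbitrary because the sets of interest, images of
    Riemannian balls, are not cubes. *)
Lemma density_differentiation (R : realType) (d : nat)
    (lam mu : {measure set (borel 'rV[R]_d) -> \bar R}) (U : set 'rV[R]_d)
    (w k : 'rV[R]_d -> R) :
  is_lebesgue lam -> open U -> (lam U < +oo)%E -> (mu setT < +oo)%E ->
  measurable_fun setT (w : borel 'rV[R]_d -> R) ->
  (forall y, 0 <= w y) -> (forall y, 0 <= k y) ->
  (forall y, U y -> {for y, continuous k}) ->
  (forall (A : set (borel 'rV[R]_d)) (q q' s s' : R), measurable A -> A `<=` U ->
    0 <= q -> 0 <= s ->
    (forall y, A y -> q <= w y <= q') -> (forall y, A y -> s <= k y <= s') ->
    ((q * s)%:E * lam A <= mu A)%E /\ (mu A <= (q' * s')%:E * lam A)%E) ->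
  lam.-negligible [set y : borel 'rV[R]_d | U y /\ ~ (forall e : R, 0 < e ->
    \forall r \near (0 : R)^'+, forall D : set (borel 'rV[R]_d), measurable D ->
      D `<=` cball (y, r) ->
      `|fine (mu D) - w y * k y * fine (lam D)| <= e * r ^+ d)].
Proof.
move=> lebl oU lamU muT mw w0 k0 ck bounds.
have mU : measurable (U : set (borel 'rV[R]_d)) by exact: borel_open.
pose A (p : rat * rat) : set (borel 'rV[R]_d) := U `&` [set y | ratr p.1 <= w y < ratr p.2].
have mA p : measurable (A p).
  apply: measurableI => //.
  rewrite (_ : [set y | _] = w @^-1` `[ratr p.1, ratr p.2[); last first.
    by apply/seteqP; split => y /=; rewrite in_itv.
  by rewrite -[X in measurable X]setTI; exact: mw.
have mUA p : measurable ((U : set (borel 'rV[R]_d)) `\` A p) by exact: measurableD.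
pose mu1 p : {measure set (borel 'rV[R]_d) -> \bar R} := mrestr mu (measurableC (mA p)).
(* [null_density] asks for a finite measure, hence the restriction to [U]. *)
pose lam1 p : {measure set (borel 'rV[R]_d) -> \bar R} := mrestr lam (mUA p).
pose N1 p := [set y : borel 'rV[R]_d | A p y /\ ~ (forall e : R, 0 < e ->
    \forall r \near (0 : R)^'+, (mu1 p (cball (y, r)) <= (e * r ^+ d)%:E)%E)].
pose N2 p := [set y : borel 'rV[R]_d | A p y /\ ~ (forall e : R, 0 < e ->
    \forall r \near (0 : R)^'+, (lam1 p (cball (y, r)) <= (e * r ^+ d)%:E)%E)].
have n1 p : lam.-negligible (N1 p).
  apply: null_density => //.
    rewrite /mu1/= /mrestr; apply: le_lt_trans muT; apply: le_mu => //.
    by apply: measurableI => //; exact: measurableC.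
  by rewrite /mu1/= /mrestr setICr measure0.
have n2 p : lam.-negligible (N2 p).
  apply: null_density => //.
    rewrite /lam1/= /mrestr setTI; by apply: le_lt_trans lamU; exact: le_mu.
  by rewrite /lam1/= /mrestr setDE setIC -setIA setICl setI0 measure0.
have := negligible_bigcup_count (fun p : rat * rat => negligibleU (n1 p) (n2 p)).
apply: negligibleS => y [Uy H]; apply: contrapT => nN; apply: H => e e0.
have wk0 : 0 <= w y * k y by rewrite mulr_ge0.
pose e1 := e / (2 * (1 + w y * k y)).
have e10 : 0 < e1 by rewrite divr_gt0// mulr_gt0// ltr_pwDl.
pose c0 := 2 * 2 ^+ d * (w y + k y + 1).
have c00 : 0 < c0 by rewrite !mulr_gt0 ?exprn_gt0// ltr_wpDl// addr_ge0.
pose eta := Num.min 1 (e / c0).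
have eta0 : 0 < eta by rewrite /eta lt_min ltr01 divr_gt0.
have [q1 /andP[q1w wq1]] : exists q : rat, w y - eta < ratr q < w y.
  have /rat_in_itvoo[q] : w y - eta < w y by rewrite ltrBlDr ltrDl.
  by rewrite in_itv/= => h; exists q.
have [q2 /andP[q2w wq2]] : exists q : rat, w y < ratr q < w y + eta.
  have /rat_in_itvoo[q] : w y < w y + eta by rewrite ltrDl.
  by rewrite in_itv/= => h; exists q.
pose p := (q1, q2).
have Apy : A p y by split => //=; rewrite (ltW wq1) q2w.
have G1 : \forall r \near (0 : R)^'+, (mu1 p (cball (y, r)) <= (e1 * r ^+ d)%:E)%E.
  apply: contrapT => h; apply: nN; exists p => //; left; split => // H; exact/h/H.
have G2 : \forall r \near (0 : R)^'+, (lam1 p (cball (y, r)) <= (e1 * r ^+ d)%:E)%E.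
  apply: contrapT => h; apply: nN; exists p => //; right; split => // H; exact/h/H.
have G3 : \forall r \near (0 : R)^'+, cball (y, r) `<=` [set z | U z /\ `|k z - k y| < eta].
  apply: near_cball; apply: filterI; first by apply: open_nbhs_nbhs; split.
  have /cvgrPdist_lt/(_ eta eta0) := ck _ Uy.
  by apply: filterS => z; rewrite distrC.
near=> r => D mD Dr.
have r0 : 0 < r by [].
have cU : cball (y, r) `<=` [set z | U z /\ `|k z - k y| < eta] by near: r.
have DU : D `<=` U by move=> z /Dr/cU[].
have mDA : measurable (D `&` A p) by exact: measurableI.
have mDC : measurable (D `\` A p) by exact: measurableD.
have lamD : (lam D <= ((2 * r) ^+ d)%:E)%E by apply: lebesgue_cball_le Dr => //; exact: ltW.
have fin (m : {measure set (borel 'rV[R]_d) -> \bar R}) B : measurable B -> B `<=` D ->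
    (m D < +oo)%E -> m B = (fine (m B))%:E.
  move=> mB BD fm; rewrite fineK// ge0_fin_numE//; apply: le_lt_trans fm; exact: le_mu.
have fl : (lam D < +oo)%E by exact: le_lt_trans lamD (ltry _).
have fm : (mu D < +oo)%E by apply: le_lt_trans muT; exact: le_mu.
have DE (m : {measure set (borel 'rV[R]_d) -> \bar R}) : (m D < +oo)%E ->
    fine (m D) = fine (m (D `\` A p)) + fine (m (D `&` A p)).
  move=> fmD; apply: EFin_inj; rewrite EFinD -!fin//.
  by rewrite (measureDI m mD (mA p)).
have b1 : fine (mu (D `\` A p)) <= e1 * r ^+ d.
  rewrite -lee_fin -(fin mu)//.
  have : (mu1 p (cball (y, r)) <= (e1 * r ^+ d)%:E)%E by near: r.
  apply: le_trans; rewrite /mu1/= /mrestr; apply: le_mu => //.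
    apply: measurableI; [exact: measurable_cball|exact: measurableC].
  by move=> z [Dz nAz]; split => //; exact: Dr.
have b2 : fine (lam (D `\` A p)) <= e1 * r ^+ d.
  rewrite -lee_fin -(fin lam)//.
  have : (lam1 p (cball (y, r)) <= (e1 * r ^+ d)%:E)%E by near: r.
  apply: le_trans; rewrite /lam1/= /mrestr; apply: le_mu => //.
    by apply: measurableI => //; exact: measurable_cball.
  by move=> z [Dz nAz]; split; [exact: Dr|split => //; exact: DU].
pose q := Num.max 0 (ratr q1 : R); pose s := Num.max 0 (k y - eta).
have q0 : 0 <= q by rewrite /q le_max lexx.
have s0 : 0 <= s by rewrite /s le_max lexx.
have qw : q <= w y by rewrite /q ge_max w0 ltW.
have q1q : ratr q1 <= q by rewrite /q le_max lexx orbT.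
have sk : s <= k y by rewrite /s ge_max k0/= lerBlDr lerDl ltW.
have kes : k y - eta <= s by rewrite /s le_max lexx orbT.
have [] := bounds _ q (ratr q2) s (k y + eta) mDA (subset_trans (@subIsetl _ _ _) DU) q0 s0.
- by move=> z [_ [_ /andP[h1 h2]]]; rewrite /q ge_max w0 h1/= ltW.
- move=> z [/Dr/cU[_ +] _]; rewrite ltr_norml => /andP[h1 h2].
  rewrite /s ge_max k0/= -lerBlDl (ltW h2) andbT.
  by rewrite -(subrK (k y) (k z)) [leLHS]addrC lerD2r ltW.
have DAD : D `&` A p `<=` D by exact: subIsetl.
rewrite (fin mu _ mDA DAD fm) (fin lam _ mDA DAD fl) -!EFinM !lee_fin => h1 h2.
have lamD' : fine (lam D) <= 2 ^+ d * r ^+ d.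
  by rewrite -exprMn -lee_fin -(fin lam D mD (@subset_refl _ _) fl).
move: lamD'; rewrite (DE mu fm) (DE lam fl) => lamD'.
have rd0 : 0 <= r ^+ d by rewrite exprn_ge0// ltW.
have cd0 : 0 < (2 : R) ^+ d by rewrite exprn_gt0.
have f0 (m : {measure set (borel 'rV[R]_d) -> \bar R}) B : 0 <= fine (m B).
  by rewrite fine_ge0.
apply: (@density_squeeze R (w y) (k y) q (ratr q2) s e (2 ^+ d) (r ^+ d)) => //.
- by apply: le_trans q1q; apply: ltW.
- exact: ltW.
Unshelve. all: by end_near. Qed.
(** * Volume and density of small balls *)

(** Charts and their inverses are continuous only on their domains. A constant value elsewhere makes
    them Borel on the whole space. *)
Lemma measurable_extend (T : ptopologicalType) (dU : measure_display)
    (U : measurableType dU) (G : set (set U)) (D : set T) (g : T -> U) (c : U) :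
  measurable = <<s G >> -> open D ->
  (forall V, G V -> open (D `&` g @^-1` V)) ->
  measurable_fun setT ((fun x => if x \in D then g x else c) : borel T -> U).
Proof.
move=> mE oD oG; apply: (@measurability _ _ (borel T) U setT _ G) => // _ [V GV <-].
rewrite setTI (_ : _ @^-1` _ = (D `&` g @^-1` V) `|` (~` D `&` [set _ | V c])); last first.
  apply/seteqP; split => x /=.
    have [Dx|nDx] := pselect (D x); first by rewrite mem_set//; left.
    by rewrite memNset//; right.
  move=> [[Dx Vx]|[nDx Vc]]; first by rewrite mem_set.
  by rewrite memNset.
apply: measurableU; first by apply: borel_open; exact: oG.
apply: measurableI; first by apply: measurableC; exact: borel_open.
have [Vc|nVc] := pselect (V c).
  by rewrite (_ : [set _ | _] = setT)//; apply/seteqP; split.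
by rewrite (_ : [set _ | _] = set0)//; apply/seteqP; split.
Qed.

Lemma open_preimage_on (T U : topologicalType) (D : set T) (V : set U) (g : T -> U) :
  open D -> (forall x, D x -> {for x, continuous g}) -> open V ->
  open (D `&` g @^-1` V).
Proof.
move=> oD cg oV; rewrite openE => x [Dx Vx].
apply: filterI; first by apply: open_nbhs_nbhs; split.
by apply: (near_comp (cg _ Dx)); apply: open_nbhs_nbhs; split.
Qed.

Lemma measurable_chart_preimage (R : realType) (d : nat) (M : riemannianManifold R d)
    (i : chart_index M) (A : set (borel 'rV[R]_d)) : measurable A ->
  measurable (dom i `&` (chart i @^-1` A) : set (borel M)).
Proof.
move=> mA.
have mh : measurable_fun setT ((fun x => if x \in dom i then chart i x else 0) : borel M -> borel 'rV[R]_d).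
  apply: (@measurable_extend _ _ (borel 'rV[R]_d) (@open 'rV[R]_d)) => //; first exact: dom_open.
  by move=> V oV; apply: open_preimage_on => //; [exact: dom_open|exact: chart_continuous].
rewrite (_ : _ `&` _ = (dom i : set (borel M)) `&` (setT `&` (fun x => if x \in dom i then chart i x else 0) @^-1` A)).
  apply: measurableI; first exact: borel_open (dom_open i).
  exact: mh.
by rewrite setTI; apply/seteqP; split => x /= [dx]; rewrite ifT ?inE.
Qed.

Lemma measurable_chart_image (R : realType) (d : nat) (M : riemannianManifold R d)
    (i : chart_index M) (A : set (borel M)) : measurable A -> A `<=` dom i ->
  measurable (chart i @` A : set (borel 'rV[R]_d)).
Proof.
move=> mA Ad.
have mh : measurable_fun setT ((fun y => if y \in chart i @` dom i then param i y else point) : borel 'rV[R]_d -> borel M).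
  apply: (@measurable_extend _ _ (borel M) (@open M)) => //; first exact: img_open.
  by move=> V oV; apply: open_preimage_on => //; [exact: img_open|exact: param_continuous].
rewrite (_ : _ @` _ = ((chart i @` dom i) : set (borel 'rV[R]_d)) `&` (setT `&` (fun y => if y \in chart i @` dom i then param i y else point) @^-1` A)).
  apply: measurableI; first by apply: borel_open; exact: img_open.
  exact: mh.
rewrite setTI; apply/seteqP; split => y /=.
  move=> [x Ax <-]; have ix := img_dom (Ad _ Ax); split => //.
  by rewrite mem_set// chartK//; exact: Ad.
move=> [iy]; rewrite mem_set// => Ay; exists (param i y) => //.
by have [] := imgP iy.
Qed.

(** Restricting to part of the domain before pushing forward removes the influence of the default
    value of the extended chart. *)
Lemma chart_measure (R : realType) (d : nat) (M : riemannianManifold R d)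
    (i : chart_index M) (nu : {measure set (borel M) -> \bar R}) (S : set (borel M)) :
  measurable S -> S `<=` dom i ->
  exists mu : {measure set (borel 'rV[R]_d) -> \bar R},
    forall A, mu A = nu (S `&` (chart i @^-1` A)).
Proof.
move=> mS Sd.
have mh : measurable_fun setT ((fun x => if x \in dom i then chart i x else 0) : borel M -> borel 'rV[R]_d).
  apply: (@measurable_extend _ _ (borel 'rV[R]_d) (@open 'rV[R]_d)) => //; first exact: dom_open.
  by move=> V oV; apply: open_preimage_on => //; [exact: dom_open|exact: chart_continuous].
have [mu muE] := pushforward_measure (mrestr nu mS : {measure set (borel M) -> \bar R}) mh.
exists mu => A; rewrite muE /= /mrestr; congr (nu _).
apply/seteqP; split => x /= [].
  by move=> + Sx; rewrite mem_set//; exact: Sd.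
by move=> Sx; rewrite mem_set//; exact: Sd.
Qed.

Lemma cvg_det (R : realType) (d : nat) (T : Type) (F : set_system T)
    (g : T -> 'M[R]_d) (g0 : 'M[R]_d) : Filter F ->
  g x @[x --> F] --> g0 -> \det (g x) @[x --> F] --> \det g0.
Proof.
move=> FF gg.
have cc i j : g x i j @[x --> F] --> g0 i j.
  apply: (@cvg_comp _ _ _ g (fun A : 'M[R]_d => A i j) F (nbhs g0) (nbhs (g0 i j)) gg).
  exact: coord_continuous.
rewrite /determinant; apply: cvg_sum_seq => s; apply: cvgM; first exact: cvg_cst.
elim: (index_enum _) => [|i l IH].
  by rewrite big_nil; under eq_fun do rewrite big_nil; exact: cvg_cst.
by rewrite big_cons; under eq_fun do rewrite big_cons; exact: cvgM.
Qed.

(* The determinant does not vanish on the segment from the identity to g. *)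
Lemma posdef_det_gt0 (R : realType) (d : nat) (g : 'M[R]_d) : posdef g -> 0 < \det g.
Proof.
move=> [gs gp].
pose h (t : R) := \det (1%:M + t *: (g - 1%:M)).
have hn0 t : 0 <= t <= 1 -> h t != 0.
  move=> /andP[t0 t1]; apply/negP => /eqP/eqP/det0P[v v0].
  rewrite mulmxDr mulmx1 -scalemxAr mulmxBr mulmx1 => E.
  have : gram_form (1%:M + t *: (g - 1%:M)) v v = 0.
    by rewrite /gram_form mulmxDr mulmx1 -scalemxAr mulmxBr mulmx1 E mul0mx mxE.
  have -> : gram_form (1%:M + t *: (g - 1%:M)) v v =
      (1 - t) * (v *m v^T) ord0 ord0 + t * gram_form g v v.
    rewrite /gram_form mulmxDr mulmx1 -scalemxAr mulmxBr mulmx1.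
    by rewrite mulmxDl -scalemxAl mulmxBl !mxE; ring.
  have vv : 0 < (v *m v^T) ord0 ord0.
    rewrite mxE; under eq_bigr do rewrite mxE -expr2.
    have [k vk] : exists k, v ord0 k != 0.
      apply: contrapT => H; move/eqP : v0; apply; apply/rowP => k; rewrite mxE.
      by apply: contrapT => /eqP vk; apply: H; exists k.
    rewrite (bigD1 k)//= ltr_pwDl ?sumr_ge0// => [|j _]; last exact: sqr_ge0.
    by rewrite exprn_even_gt0.
  have := gp _ v0; set a := gram_form g v v; set b := (v *m v^T) _ _ in vv * => a0 H.
  by have : 0 < (1 - t) * b + t * a; [nra|rewrite H ltxx].
have ch : continuous h.
  move=> t; apply: (@cvg_det _ _ _ (nbhs t) (fun t => 1%:M + t *: (g - 1%:M))).
  apply: cvgD; first exact: cvg_cst.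
  by apply: cvgZr_tmp; exact: cvg_id.
have h0 : h 0 = 1 by rewrite /h scale0r addr0 det1.
have h1 : h 1 = \det g by rewrite /h scale1r addrC subrK.
rewrite -h1 ltNge; apply/negP => hle.
have [||c] := @IVT R h 0 1 0 ler01.
- exact: continuous_subspaceT.
- by have h11 := le_trans hle ler01; rewrite h0 (min_r h11) (max_l h11) hle ler01.
- by rewrite in_itv/= => c01 /eqP; apply/negP; exact: hn0.
Qed.

Definition vol_density (R : realType) (d : nat) (M : riemannianManifold R d)
    (i : chart_index M) (y : 'rV[R]_d) : R := Num.sqrt (\det (metric i y)).

Lemma vol_density_gt0 (R : realType) (d : nat) (M : riemannianManifold R d)
    (i : chart_index M) (y : 'rV[R]_d) : (chart i @` dom i) y -> 0 < vol_density i y.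
Proof. by move=> iy; rewrite sqrtr_gt0 posdef_det_gt0//; exact: metric_posdef. Qed.

Lemma vol_density_continuous (R : realType) (d : nat) (M : riemannianManifold R d)
    (i : chart_index M) (y : 'rV[R]_d) : (chart i @` dom i) y ->
  {for y, continuous (vol_density i)}.
Proof.
move=> iy; apply: (@cvg_comp _ _ _ _ (@Num.sqrt R)); last exact: sqrt_continuous.
by apply: (@cvg_det _ _ _ (nbhs y) (metric i)); exact: metric_continuous.
Qed.

Definition chart_volume (R : realType) (d : nat) (M : riemannianManifold R d)
    (lam : {measure set (borel 'rV[R]_d) -> \bar R})
    (m : {measure set (borel M) -> \bar R}) : Prop :=
  forall (i : chart_index M) (A : set (borel M)), measurable A -> A `<=` dom i ->
    m A = (\int[lam]_(y in chart i @` A) (vol_density i y)%:E)%E.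

Lemma measurable_vol_density (R : realType) (d : nat) (M : riemannianManifold R d)
    (i : chart_index M) (A : set (borel 'rV[R]_d)) : A `<=` chart i @` dom i ->
  measurable A -> measurable_fun A (EFin \o vol_density i : borel 'rV[R]_d -> \bar R).
Proof.
move=> Ai mA; apply/measurable_EFinP.
have mh : measurable_fun setT ((fun y => if y \in chart i @` dom i then vol_density i y else 0) : borel 'rV[R]_d -> R).
  apply: (@measurable_extend _ _ R (@RGenOpens.G R)); [exact: RGenOpens.measurableE|exact: img_open|].
  move=> _ [a [b ->]]; apply: open_preimage_on; [exact: img_open| |exact: interval_open].
  exact: vol_density_continuous.
apply: (eq_measurable_fun (fun y : borel 'rV[R]_d => if y \in chart i @` dom i then vol_density i y else 0)).
  by move=> y /set_mem/Ai iy; rewrite ifT ?inE.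
exact: measurable_funTS.
Qed.

Lemma volume_bounds (R : realType) (d : nat) (M : riemannianManifold R d)
    (lam : {measure set (borel 'rV[R]_d) -> \bar R})
    (m : {measure set (borel M) -> \bar R}) (i : chart_index M) (A : set (borel M)) (s s' : R) :
  chart_volume lam m -> measurable A -> A `<=` dom i -> 0 <= s ->
  (forall x, A x -> s <= vol_density i (chart i x) <= s') ->
  (s%:E * lam (chart i @` A) <= m A)%E /\ (m A <= s'%:E * lam (chart i @` A))%E.
Proof.
move=> hm mA Ad s0 H.
have mC := measurable_chart_image mA Ad.
have mv : measurable_fun (chart i @` A : set (borel 'rV[R]_d)) (EFin \o vol_density i : borel 'rV[R]_d -> \bar R).
  by apply: measurable_vol_density => // y [x Ax <-]; exact/img_dom/Ad.
rewrite (hm i)// -!integral_cst//; split; apply: ge0_le_integral => //.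
- by move=> _ [x Ax <-]; rewrite lee_fin; have /andP[] := H _ Ax.
- by move=> _ [x Ax <-]; rewrite lee_fin sqrtr_ge0.
- by move=> _ [x Ax <-]; rewrite lee_fin; have /andP[] := H _ Ax.
Qed.

Lemma chart_null (R : realType) (d : nat) (M : riemannianManifold R d)
    (lam : {measure set (borel 'rV[R]_d) -> \bar R})
    (m : {measure set (borel M) -> \bar R}) (i : chart_index M) (N : set (borel 'rV[R]_d)) :
  chart_volume lam m -> lam.-negligible N ->
  m.-negligible (dom i `&` (chart i @^-1` N) : set (borel M)).
Proof.
move=> hm [G [mG G0 NG]].
have mS := measurable_chart_preimage i mG.
exists (dom i `&` (chart i @^-1` G)); split => //; last by move=> x [dx Nx]; split => //; exact: NG.
have Sd : dom i `&` (chart i @^-1` G) `<=` dom i by move=> x [].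
have mC := measurable_chart_image mS Sd.
rewrite (hm i)// null_set_integral//.
  by apply: measurable_vol_density => // y [x [dx _] <-]; exact: img_dom.
apply/eqP; rewrite -measure_le0 -G0; apply: le_mu => //.
by move=> _ [x [_ Gx] <-].
Qed.

(** * Riemannian balls of small radius *)

Lemma near_right0P (R : realType) (P : R -> Prop) :
  (\forall r \near (0 : R)^'+, P r) <-> exists2 e : R, 0 < e & forall r, 0 < r < e -> P r.
Proof.
split=> [[e /= e0 H]|[e e0 H]].
  exists e => // r /andP[r0 re]; apply: H => //=.
  by rewrite sub0r normrN gtr0_norm.
by near=> r; apply: H; apply/andP; split.
Unshelve. all: by end_near. Qed.

Lemma near_right0_scale (R : realType) (A : R) (P : R -> Prop) : 0 < A ->
  (\forall r \near (0 : R)^'+, P r) -> \forall r \near (0 : R)^'+, P (A * r).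
Proof.
move=> A0 /near_right0P[e e0 H]; apply/near_right0P; exists (e / A); first exact: divr_gt0.
move=> r /andP[r0 re]; apply: H; rewrite mulr_gt0//=.
by move: re; rewrite ltr_pdivlMr// mulrC.
Qed.

Definition rball (R : realType) (d : nat) (M : riemannianManifold R d) (x : M) (r : R) :
  set (borel M) := [set z | (rdist z x < r%:E)%E].

Lemma rball_open (R : realType) (d : nat) (M : riemannianManifold R d) (x : M) (r : R) :
  open (rball x r : set M).
Proof. exact: (rdist_ball_open x r).2. Qed.

Lemma measurable_rball (R : realType) (d : nat) (M : riemannianManifold R d) (x : M) (r : R) :
  measurable (rball x r).
Proof. by apply: borel_open; exact: rball_open. Qed.

Lemma rball_le (R : realType) (d : nat) (M : riemannianManifold R d) (x : M) (r s : R) :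
  r <= s -> rball x r `<=` rball x s.
Proof. by move=> rs z h; apply: lt_le_trans h _; rewrite lee_fin. Qed.

(** [rdist_lower] with [eta = 1]; dividing by the lower constant [c] of the metric at [p] passes to
    the coordinate norm. *)
Lemma chart_ball (R : realType) (d : nat) (M : riemannianManifold R d)
    (i : chart_index M) (p : 'rV[R]_d) : (chart i @` dom i) p ->
  exists2 A : R, 0 < A & \forall r \near (0 : R)^'+,
    rball (param i p) r `<=` dom i /\
    chart i @` rball (param i p) r `<=` cball (p, A * r).
Proof.
move=> ip; have [r0 r00 H] := rdist_lower ip ltr01.
have [c c0 Hc] := gram_norm_ge_coord (metric_posdef ip).
exists (2 / c); first exact: divr_gt0.
apply/near_right0P; exists (r0 / 2) => [|r /andP[rp rr]]; first exact: divr_gt0.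
have K z : rball (param i p) r z -> exists q, [/\ (chart i @` dom i) q, param i q = z & cball (p, 2 / c * r) q].
  move=> /rdist_lt_sym h.
  have [||q [iq qz qp]] := H p _ z r _ h; first by rewrite subrr gram_norm0.
    by move: rr; rewrite ltr_pdivlMr// mulrC => /ltW.
  exists q; split => //; rewrite /cball/= mulrAC ltr_pdivlMr// mulrC.
  exact: le_lt_trans (Hc _) qp.
split=> [z /K[q [iq <- _]]|_ [z /K[q [iq <- qp]] <-]]; first by have [] := imgP iq.
by have [_ ->] := imgP iq.
Qed.

Lemma near_rball (R : realType) (d : nat) (M : riemannianManifold R d)
    (x : M) (V : set M) : nbhs x V -> \forall r \near (0 : R)^'+, rball x r `<=` V.
Proof.
move=> xV; pose i := chart_at x; have dx := dom_chart_at x.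
have ip := img_dom dx; have px : param i (chart i x) = x by rewrite chartK.
have [A A0 HA] := chart_ball ip.
have pV : nbhs (chart i x) [set y | V (param i y)].
  by apply: (near_comp (param_continuous ip)); rewrite px.
have := near_right0_scale A0 (near_cball pV).
apply: filterS2 HA => r [rd rc] cV z rz.
have rz' : rball (param i (chart i x)) r z by rewrite px.
have := cV (chart i z); rewrite /= chartK; last exact: rd.
by apply; apply: rc; exists z.
Qed.

Lemma gram_ball_volume (R : realType) (d : nat)
    (lam : {measure set (borel 'rV[R]_d) -> \bar R}) (G : 'M[R]_d) (p : 'rV[R]_d) (r : R) :
  is_lebesgue lam -> posdef G -> 0 < r ->
  lam [set y | (gram_norm G (y - p) < r)%R] =
  ((r ^+ d)%:E * lam [set y | (gram_norm G (y - 0) < 1)%R])%E.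
Proof.
move=> lebl pG r0.
have mE : measurable ([set y | gram_norm G (y - 0) < 1] : set (borel 'rV[R]_d)).
  by apply: borel_open; exact: gram_ball_open.
have ri0 : 0 < r^-1 by rewrite invr_gt0.
have := lebesgue_affine 0 p lebl ri0 mE; rewrite invrK => <-.
congr (lam _); apply/seteqP; split => y /=;
  by rewrite subr0 add0r gram_normZ gtr0_norm// mulrC ltr_pdivrMr// mul1r.
Qed.

Lemma gram_ball_fin (R : realType) (d : nat)
    (lam : {measure set (borel 'rV[R]_d) -> \bar R}) (G : 'M[R]_d) :
  is_lebesgue lam -> posdef G ->
  exists2 L : R, 0 < L & lam [set y | (gram_norm G (y - 0) < 1)%R] = L%:E.
Proof.
move=> lebl pG.
have mE : measurable ([set y | gram_norm G (y - 0) < 1] : set (borel 'rV[R]_d)).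
  by apply: borel_open; exact: gram_ball_open.
have [c c0 Hc] := gram_norm_ge_coord pG.
have [C C0 HC] := gram_norm_le_coord G.
have h1 : (lam [set y | (gram_norm G (y - 0) < 1)%R] <= ((2 * c^-1) ^+ d)%:E)%E.
  apply: (@lebesgue_cball_le _ _ lam 0) => //; first by rewrite invr_ge0 ltW.
  move=> y /= h; rewrite /cball/= -[c^-1]mul1r ltr_pdivlMr// mulrC.
  exact: le_lt_trans (Hc _) h.
have h2 : ((C^-1 ^+ d)%:E <= lam [set y | (gram_norm G (y - 0) < 1)%R])%E.
  apply: le_trans (lebesgue_ball_ge 0 lebl _) _; first by rewrite invr_gt0.
  apply: le_mu => //; first exact: (measurable_cball (0, C^-1)).
  move=> y /=; rewrite -[C^-1]mul1r ltr_pdivlMr// mulrC; apply: le_lt_trans; exact: HC.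
move: h1 h2; case: (lam _) => [L| |]//=; rewrite !lee_fin => _ h.
by exists L => //; apply: lt_le_trans h; rewrite exprn_gt0// invr_gt0.
Qed.

Lemma near_pow_ratio (R : realType) (d : nat) (L e : R) : 0 < e ->
  \forall h \near (0 : R)^'+, (1 + h) ^+ d * L <= L + e /\ L - e <= L / (1 + h) ^+ d.
Proof.
move=> e0.
have c1 : (1 + h) ^+ d @[h --> (0 : R)] --> (1 : R).
  rewrite [X in _ --> X](_ : 1 = (1 + 0) ^+ d); last by rewrite addr0 expr1n.
  apply: (@continuous_comp _ _ _ (fun h : R => 1 + h) (fun h => h ^+ d)).
    by apply: cvgD; [exact: cvg_cst|exact: cvg_id].
  exact: exprn_continuous.
have c2 : (1 + h) ^+ d * L @[h --> (0 : R)] --> L.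
  by rewrite -[X in _ --> X]mul1r; apply: cvgM => //; exact: cvg_cst.
have c3 : L / (1 + h) ^+ d @[h --> (0 : R)] --> L.
  rewrite [X in _ --> X](_ : L = L * 1^-1); last by rewrite invr1 mulr1.
  apply: cvgM; first exact: cvg_cst.
  by apply: cvgV => //; exact: oner_neq0.
have n2 : \forall h \near (0 : R), `|L - (1 + h) ^+ d * L| <= e by move/cvgrPdist_le : c2; apply.
have n3 : \forall h \near (0 : R), `|L - L / (1 + h) ^+ d| <= e by move/cvgrPdist_le : c3; apply.
apply: cvg_within; apply: filterS2 n2 n3 => h; rewrite !ler_norml => /andP[a1 a2] /andP[a3 a4].
by split; lra.
Qed.

(** Up to a factor [1 + eta] in the radius, the image of the ball is the ellipsoid of the metric at
    [p]: [rdist_lower] puts it inside one and [rdist_segment] puts one inside it. The volume of the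
    ellipsoid is exactly [L * r ^+ d]. *)
Lemma chart_ball_volume (R : realType) (d : nat) (M : riemannianManifold R d)
    (lam : {measure set (borel 'rV[R]_d) -> \bar R}) (i : chart_index M) (p : 'rV[R]_d) :
  is_lebesgue lam -> (chart i @` dom i) p ->
  exists2 L : R, 0 < L &
    fine (lam (chart i @` rball (param i p) r)) / r ^+ d @[r --> (0 : R)^'+] --> L.
Proof.
move=> lebl ip; have pG := metric_posdef ip.
have [L L0 LE] := gram_ball_fin lebl pG; exists L => //.
apply/cvgrPdist_le => e e0.
have [eta [eta0 He1 He2]] : exists eta : R, [/\ 0 < eta, (1 + eta) ^+ d * L <= L + e & L - e <= L / (1 + eta) ^+ d].
  near (0 : R)^'+ => eta; exists eta.
  have [h1 h2] : (1 + eta) ^+ d * L <= L + e /\ L - e <= L / (1 + eta) ^+ d.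
    by near: eta; exact: near_pow_ratio.
  by split.
have [A A0 HA] := chart_ball ip.
have [r0 r00 Hlow] := rdist_lower ip eta0.
have [r1 r10 Hseg] := rdist_segment ip eta0.
have nI : nbhs p [set y | (chart i @` dom i) y /\ `|y - p| < r1].
  apply: filterI; first by apply: open_nbhs_nbhs; split => //; exact: img_open.
  by apply/nbhs_ballP; exists r1 => // y; rewrite -ball_normE/= distrC.
have [r2 r20 Hr2] := near_gram_ball pG nI.
have e1 : 0 < 1 + eta by rewrite addr_gt0.
near=> r.
have rp : 0 < r by [].
have [rd rc] : rball (param i p) r `<=` dom i /\
    chart i @` rball (param i p) r `<=` cball (p, A * r) by near: r.
have mD : measurable (chart i @` rball (param i p) r : set (borel 'rV[R]_d)).
  by apply: measurable_chart_image => //; exact: measurable_rball.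
have mG (s : R) : measurable ([set y | gram_norm (metric i p) (y - p) < s] : set (borel 'rV[R]_d)).
  by apply: borel_open; exact: gram_ball_open.
have up : (lam (chart i @` rball (param i p) r) <= (((1 + eta) * r) ^+ d * L)%:E)%E.
  rewrite EFinM -LE -(gram_ball_volume p lebl pG); last by rewrite mulr_gt0.
  apply: le_mu => // _ [z rz <-].
  have [||q [iq qz qp]] := Hlow p _ z r _ (rdist_lt_sym rz); first by rewrite subrr gram_norm0.
    rewrite -ler_pdivlMl//; apply/ltW; near: r; apply: nbhs_right_lt.
    by rewrite mulr_gt0// invr_gt0.
  by rewrite -qz /=; have [_ ->] := imgP iq.
have lo : (((r / (1 + eta)) ^+ d * L)%:E <= lam (chart i @` rball (param i p) r))%E.
  rewrite EFinM -LE -(gram_ball_volume p lebl pG); last by rewrite divr_gt0.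
  apply: le_mu => // y /= h.
  have [|iy yr1] := Hr2 y.
    apply: le_trans (ltW h) _; rewrite ler_pdivrMr//.
    have rr2 : r <= r2 by apply: ltW; near: r; exact: nbhs_right_lt.
    by apply: le_trans rr2 _; rewrite ler_peMr// ?(ltW r20)// lerDl ltW.
  have [dy cy] := imgP iy; exists (param i y) => //.
  apply: rdist_lt_sym; apply: le_lt_trans (Hseg p y _ yr1) _; first by rewrite subrr normr0.
  by rewrite lte_fin mulrC -ltr_pdivlMr.
have fl : (lam (chart i @` rball (param i p) r) < +oo)%E by apply: le_lt_trans up (ltry _).
have fE : lam (chart i @` rball (param i p) r) = (fine (lam (chart i @` rball (param i p) r)))%:E.
  by rewrite fineK// ge0_fin_numE.
move: up lo; rewrite fE !lee_fin; set l := fine _ => up lo.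
have rd0 : 0 < r ^+ d by rewrite exprn_gt0.
rewrite ler_norml; apply/andP; split.
  rewrite lerBrDr addrC -lerBrDr opprK ler_pdivrMr//; apply: le_trans up _.
  by rewrite exprMn mulrAC ler_wpM2r// ltW.
rewrite lerBlDr addrC -lerBlDr ler_pdivlMr//; apply: le_trans lo.
rewrite expr_div_n [leRHS](_ : _ = L / (1 + eta) ^+ d * r ^+ d); last by ring.
by rewrite ler_wpM2r// ltW.
Unshelve. all: by end_near. Qed.

(** * The invariant measure on small balls and annuli *)

Lemma density_null (R : realType) (d : nat) (M : riemannianManifold R d)
    (m : {measure set (borel M) -> \bar R}) (nu : probability (borel M) R)
    (rho : borel M -> R) (N : set (borel M)) :
  is_density m nu rho -> m.-negligible N -> nu.-negligible N.
Proof.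
move=> [mrho rho0 nuE] [G [mG G0 NG]]; exists G; split => //.
rewrite nuE// null_set_integral//.
by apply/measurable_EFinP; exact: measurable_funTS.
Qed.

Lemma density_pos (R : realType) (d : nat) (M : riemannianManifold R d)
    (m : {measure set (borel M) -> \bar R}) (nu : probability (borel M) R)
    (rho : borel M -> R) :
  is_density m nu rho -> nu.-negligible [set x | ~ 0 < rho x].
Proof.
move=> [mrho rho0 nuE].
have mZ : measurable [set x | ~ 0 < rho x].
  rewrite (_ : [set x | _] = setT `&` rho @^-1` `]-oo, 0]); first exact: mrho.
  by rewrite setTI; apply/seteqP; split => x /=; rewrite in_itv/= leNgt => /negP.
exists [set x | ~ 0 < rho x]; split => //; rewrite nuE//.
apply: integral0_eq => x /= /negP; rewrite -leNgt => h.
by congr (_%:E); apply/eqP; rewrite eq_le h rho0.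
Qed.

Lemma density_bounds (R : realType) (d : nat) (M : riemannianManifold R d)
    (m : {measure set (borel M) -> \bar R}) (nu : probability (borel M) R)
    (rho : borel M -> R) (A : set (borel M)) (q q' : R) :
  is_density m nu rho -> measurable A -> 0 <= q ->
  (forall x, A x -> q <= rho x <= q') ->
  (q%:E * m A <= nu A)%E /\ (nu A <= q'%:E * m A)%E.
Proof.
move=> [mrho rho0 nuE] mA q0 H.
have mr : measurable_fun A (EFin \o rho).
  by apply/measurable_EFinP; exact: measurable_funTS.
rewrite nuE// -!integral_cst//; split; apply: ge0_le_integral => //.
- by move=> x Ax; rewrite lee_fin; have /andP[] := H _ Ax.
- by move=> x Ax; rewrite lee_fin.
- by move=> x Ax; rewrite lee_fin; have /andP[] := H _ Ax.
Qed.

Lemma chart_image_preimage (R : realType) (d : nat) (M : riemannianManifold R d)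
    (i : chart_index M) (A : set 'rV[R]_d) : A `<=` chart i @` dom i ->
  chart i @` (dom i `&` (chart i @^-1` A)) = A.
Proof.
move=> Ai; apply/seteqP; split => [_ [x [dx Ax] <-]//|y Ay].
by have [dy cy] := imgP (Ai _ Ay); exists (param i y) => //; split => //=; rewrite cy.
Qed.

(** In the chart, [nu] has density [rho] times the volume density, so the limit is this density at
    the point times the volume of the unit ellipsoid. It is positive because [rho] is positive
    [nu]-almost everywhere. *)
Lemma local_density (R : realType) (d : nat) (M : riemannianManifold R d)
    (lam : {measure set (borel 'rV[R]_d) -> \bar R})
    (m : {measure set (borel M) -> \bar R}) (nu : probability (borel M) R)
    (rho : borel M -> R) (x0 : M) :
  is_lebesgue lam -> chart_volume lam m -> is_density m nu rho ->
  exists2 V : set M, nbhs x0 V & nu.-negligible [set x : borel M | V x /\ ~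
    exists2 C : R, 0 < C &
      fine (nu (rball x r)) / r ^+ d @[r --> (0 : R)^'+] --> C].
Proof.
move=> lebl hm den; have [mrho rho0 nuE] := den.
pose i := chart_at x0; have dx0 := dom_chart_at x0.
(* The cube makes the Lebesgue measure of [U] finite. *)
pose U : set 'rV[R]_d := chart i @` dom i `&` cball (chart i x0, 1).
have oU : open U by apply: openI; [exact: img_open|exact: cball_open].
pose V : set M := dom i `&` chart i @^-1` U.
have oV : open V by apply: open_preimage_on => //; [exact: dom_open|exact: chart_continuous].
have mV : measurable (V : set (borel M)) by exact: borel_open.
have Vd : V `<=` dom i by move=> x [].
exists V.
  apply: open_nbhs_nbhs; split => //; split => //; split; first exact: img_dom.
  by rewrite /cball/= subrr normr0.
have [mu muE] := chart_measure nu mV Vd.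
pose w (y : borel 'rV[R]_d) : R := rho (if y \in chart i @` dom i then param i y else point).
have mw : measurable_fun setT w.
  apply: (measurableT_comp mrho).
  apply: (@measurable_extend _ _ (borel M) (@open M)) => //; first exact: img_open.
  by move=> W oW; apply: open_preimage_on => //; [exact: img_open|exact: param_continuous].
have wE x : dom i x -> w (chart i x) = rho x.
  by move=> dx; rewrite /w mem_set ?chartK//; exact: img_dom.
have lamU : (lam U < +oo)%E.
  apply: le_lt_trans (ltry ((2 * 1) ^+ d)).
  apply: (@lebesgue_cball_le _ _ lam (chart i x0)) => //; first exact: borel_open.
  by move=> y [].
have bounds (A : set (borel 'rV[R]_d)) (q q' s s' : R) : measurable A -> A `<=` U ->
    0 <= q -> 0 <= s ->
    (forall y, A y -> q <= w y <= q') -> (forall y, A y -> s <= vol_density i y <= s') ->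
    ((q * s)%:E * lam A <= mu A)%E /\ (mu A <= (q' * s')%:E * lam A)%E.
  move=> mA AU q0 s0 qw sk.
  have [A0|/set0P[a Aa]] := eqVneq A set0.
    by rewrite A0 !measure0 !mule0.
  have q'0 : 0 <= q' by have /andP[h1 h2] := qw _ Aa; apply: le_trans q0 _; exact: le_trans h2.
  pose B : set (borel M) := dom i `&` chart i @^-1` A.
  have mB : measurable B by exact: measurable_chart_preimage.
  have Bd : B `<=` dom i by move=> x [].
  have Ai : A `<=` chart i @` dom i by move=> y /AU[].
  have BA : chart i @` B = A by exact: chart_image_preimage.
  have VB : V `&` (chart i @^-1` A) = B.
    apply/seteqP; split => x; first by move=> [[dx _] Ax].
    by move=> [dx Ax]; split => //; split => //; exact: AU.
  have [h1 h2] : (q%:E * m B <= nu B)%E /\ (nu B <= q'%:E * m B)%E.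
    by apply: (density_bounds den) => // x [dx Ax]; rewrite -wE//; exact: qw.
  have [h3 h4] : (s%:E * lam A <= m B)%E /\ (m B <= s'%:E * lam A)%E.
    by rewrite -BA; apply: (volume_bounds hm) => // x [dx Ax]; exact: sk.
  rewrite muE VB !EFinM -!muleA; split.
    by apply: le_trans h1; rewrite lee_wpmul2l.
  by apply: le_trans h2 _; rewrite lee_wpmul2l.
have muT : (mu setT < +oo)%E by rewrite muE preimage_setT setIT; exact: le_lt_trans (probability_le1 nu mV) (ltry 1).
have := density_differentiation lebl oU lamU muT mw _ _ _ bounds.
move=> /(_ (fun y => rho0 _) (fun y => sqrtr_ge0 _)).
have ck y : U y -> {for y, continuous (vol_density i)} by move=> [iy _]; exact: vol_density_continuous.
move=> /(_ ck) /(@chart_null _ _ _ _ _ i _ hm) /(density_null den) nN.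
apply: negligibleS (negligibleU nN (density_pos den)) => x [Vx H].
apply: contrapT => nx; apply: H.
have rx : 0 < rho x by apply: contrapT => h; apply: nx; right.
have [dx [ix cx]] := Vx.
pose p := chart i x; have px : param i p = x by rewrite /p chartK.
have G : forall e : R, 0 < e -> \forall r \near (0 : R)^'+, forall D : set (borel 'rV[R]_d),
    measurable D -> D `<=` cball (p, r) ->
    `|fine (mu D) - w p * vol_density i p * fine (lam D)| <= e * r ^+ d.
  by apply: contrapT => h; apply: nx; left; split => //; split.
have [L L0 cL] := chart_ball_volume lebl ix.
rewrite -/p px in cL.
have [A A0 HA] := chart_ball ix; rewrite -/p px in HA.
pose k := w p * vol_density i p.
have k0 : 0 < k by rewrite /k wE// mulr_gt0//; exact: vol_density_gt0.
exists (k * L); first exact: mulr_gt0.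
have ckL : k * (fine (lam (chart i @` rball x r)) / r ^+ d) @[r --> (0 : R)^'+] --> k * L.
  by apply: cvgM => //; exact: cvg_cst.
apply/cvgrPdist_le => e e0.
have e2 : 0 < e / 2 by rewrite divr_gt0.
(* The image of the ball lies in a cube scaled by [A]; dividing by [A ^+ d] makes the error relative
   to [r ^+ d]. *)
have eA : 0 < e / 2 / A ^+ d by rewrite divr_gt0// exprn_gt0.
have n1 : \forall r \near (0 : R)^'+, `|k * L - k * (fine (lam (chart i @` rball x r)) / r ^+ d)| <= e / 2.
  by move/cvgrPdist_le : ckL; apply.
have n2 := near_right0_scale A0 (G _ eA).
have n3 : \forall r \near (0 : R)^'+, rball x r `<=` V.
  by apply: near_rball; apply: open_nbhs_nbhs; split.
near=> r.
have rp : 0 < r by [].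
have rd0 : 0 < r ^+ d by rewrite exprn_gt0.
have [rd rc] : rball x r `<=` dom i /\ chart i @` rball x r `<=` cball (p, A * r) by near: r.
have rV : rball x r `<=` V by near: r.
have mD : measurable (chart i @` rball x r : set (borel 'rV[R]_d)).
  by apply: measurable_chart_image => //; exact: measurable_rball.
have h1 : `|k * L - k * (fine (lam (chart i @` rball x r)) / r ^+ d)| <= e / 2 by near: r.
have h2 : `|fine (mu (chart i @` rball x r)) - k * fine (lam (chart i @` rball x r))| <=
    e / 2 / A ^+ d * (A * r) ^+ d.
  move: (chart i @` rball x r : set (borel 'rV[R]_d)) mD rc.
  by near: r.
have muD : mu (chart i @` rball x r) = nu (rball x r).
  rewrite muE; congr (nu _); apply/seteqP; split => z.
    by move=> [Vz [z' rz' zz']]; rewrite -(chartK (Vd _ Vz)) -zz' chartK//; exact: rd.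
  by move=> rz; split; [exact: rV|exists z].
rewrite muD exprMn mulrA divfK ?gt_eqF ?exprn_gt0// in h2.
rewrite (_ : k * L - _ = (k * L - k * (fine (lam (chart i @` rball x r)) / r ^+ d)) -
   (fine (nu (rball x r)) - k * fine (lam (chart i @` rball x r))) / r ^+ d); last by ring.
rewrite (splitr e); apply: le_trans (ler_normB _ _) _; apply: lerD => //.
by rewrite normrM (gtr0_norm (_ : 0 < (r ^+ d)^-1)) ?invr_gt0// ler_pdivrMr.
Unshelve. all: by end_near. Qed.

(* The contraction of ratio 1 - s towards the center maps the ball of radius
   r + eps into the ball of radius r when (1 - s / 2) (r + eps) = r. *)
Lemma annulus_volume (R : realType) (d : nat) (M : riemannianManifold R d)
    (lam : {measure set (borel 'rV[R]_d) -> \bar R})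
    (m : {measure set (borel M) -> \bar R}) (x : M) :
  is_lebesgue lam -> chart_volume lam m ->
  exists c r0 : R, [/\ 0 < c, 0 < r0 & forall r eps, 0 < eps -> 3 * eps <= r ->
    r + eps < r0 -> (m (rball x (r + eps) `\` rball x r) <= (c * (eps / r))%:E)%E].
Proof.
move=> lebl hm; pose i := chart_at x; have dx := dom_chart_at x.
pose p := chart i x; have px : param i p = x by rewrite /p chartK.
have ip : (chart i @` dom i) p by exact: img_dom.
have [A A0 HA] := chart_ball ip; rewrite px in HA.
have [r1 r10 Hcon] := rdist_contract ip; rewrite px in Hcon.
pose K := vol_density i p + 1.
have K0 : 0 < K by rewrite ltr_wpDl// sqrtr_ge0.
have nK : nbhs p [set y | vol_density i y <= K].
  have /cvgrPdist_lt/(_ 1 ltr01) := vol_density_continuous ip.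
  apply: filterS => y; rewrite ltr_norml => /andP[h1 h2].
  by rewrite /= /K; lra.
have [r2 r20 H2] := (near_right0P _).1 (filterI HA (near_right0_scale A0 (near_cball nK))).
pose D r : set (borel 'rV[R]_d) := chart i @` rball x r.
pose c0 : R := (2 * (A * r2)) ^+ d.
have c00 : 0 < c0 by rewrite exprn_gt0// !mulr_gt0.
pose c := K * (2 ^+ d * (d%:R * 2) * c0) + 1.
have cc : 0 <= K * (2 ^+ d * (d%:R * 2) * c0) by rewrite !mulr_ge0// ltW.
exists c, (Num.min r1 r2); split; [by rewrite ltr_wpDl|by rewrite lt_min r10|].
move=> r eps eps0 er; rewrite lt_min => /andP[re1 re2].
have r0 : 0 < r by lra.
have rep : 0 < r + eps by rewrite addr_gt0.
have rer2 : 0 < r + eps < r2 by rewrite rep.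
have [[rd rc] rk] := H2 _ rer2.
(* At most 1/2, as [rdist_contract] requires, because [3 * eps <= r]. *)
pose s := 2 * eps / (r + eps).
have s0 : 0 < s by rewrite divr_gt0// mulr_gt0.
have s1 : s <= 2^-1 by rewrite /s ler_pdivrMr//; lra.
have sE : (1 - s / 2) * (r + eps) = r.
  by rewrite /s; field; rewrite gt_eqF.
have s01 : 0 < 1 - s by lra.
have rsub : rball x r `<=` rball x (r + eps) by apply: rball_le; rewrite lerDl ltW.
have mD t : rball x t `<=` dom i -> measurable (D t).
  by move=> h; apply: measurable_chart_image => //; exact: measurable_rball.
have mDr : measurable (D r) by apply: mD => z /rsub/rd.
have mDe : measurable (D (r + eps)) by apply: mD.
have sub : D (r + eps) `<=` (fun y : 'rV[R]_d => p + (1 - s) *: (y - p)) @^-1` (D r).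
  move=> _ [z rz <-].
  have [|q [iq qz iq' h]] := Hcon z (r + eps) s (ltW re1) _ (rdist_lt_sym rz).
    by rewrite (ltW s0).
  rewrite sE in h; have [dz cz] := imgP iq; rewrite qz in cz; rewrite /= cz.
  have [dz' cz'] := imgP iq'.
  by exists (param i (p + (1 - s) *: (q - p))) => //; exact: rdist_lt_sym.
have lamD : (lam (D (r + eps)%R) <= (((1 - s)^-1) ^+ d)%:E * lam (D r))%E.
  rewrite -(lebesgue_affine p p lebl s01 mDr); apply: le_mu => //.
  rewrite -[X in measurable X]setTI; apply: (@borel_continuous 'rV[R]_d 'rV[R]_d) => //.
  exact: continuous_affine.
have lamDr : (lam (D r) <= c0%:E)%E.
  apply: (@lebesgue_cball_le _ _ lam p) => //; first by rewrite mulr_ge0// ltW.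
  move=> _ [z rz <-]; have := rc (chart i z) (imageP _ (rsub _ rz)).
  rewrite /cball/= => /lt_trans; apply; rewrite ltr_pM2l//.
have fr : lam (D r) = (fine (lam (D r)))%:E.
  by rewrite fineK// ge0_fin_numE//; exact: le_lt_trans lamDr (ltry _).
have fre : (lam (D (r + eps)%R) < +oo)%E.
  by apply: le_lt_trans lamD _; rewrite fr -EFinM ltry.
pose N : set (borel M) := rball x (r + eps) `\` rball x r.
have mN : measurable N by apply: measurableD; exact: measurable_rball.
have Nd : N `<=` dom i by move=> z [/rd].
have NE : chart i @` N = D (r + eps) `\` D r.
  apply/seteqP; split => [_ [z [rz nrz] <-]|_ [[z rz <-] nDz]].
    split; first by exists z.
    by move=> [z' rz' /(congr1 (param i))]; rewrite !chartK//; [move=> E; rewrite E in rz'|exact: rd|exact/rd/rsub].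
  by exists z => //; split => // rz'; apply: nDz; exists z.
have lamN : (lam (chart i @` N) <= (2 ^+ d * (d%:R * s) * c0)%:E)%E.
  have DE : D (r + eps) `&` D r = D r by apply: setIidr; exact: image_subset.
  have -> : lam (chart i @` N) = (lam (D (r + eps)%R) - (fine (lam (D r)))%:E)%E.
    by rewrite NE measureD// DE; congr (_ - _)%E; exact: fr.
  rewrite leeBlDr//; apply: le_trans lamD _; rewrite fr -EFinM -EFinD lee_fin.
  have l0 : 0 <= fine (lam (D r)) by exact: fine_ge0.
  have lc : fine (lam (D r)) <= c0 by rewrite -lee_fin -fr.
  set l := fine _ in l0 lc *.
  (* With [a = (1 - s)^-d] the excess is [(a - 1) * l = a * (1 - (1 - s)^d) * l], where [a <= 2^d]
     and the middle factor is at most [d * s]. *)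
  have b1 : 1 - (1 - s) ^+ d <= d%:R * s.
    have := @pow_sub_le R 1 (1 - s) d; rewrite expr1n lexx ler01/=.
    have -> : 1 - (1 - s) = s by ring.
    rewrite (gtr0_norm s0) => /(_ isT) h; apply: le_trans (ler_norm _) (h _).
    by apply/andP; split; lra.
  have b2 : ((1 - s)^-1) ^+ d <= 2 ^+ d.
    apply: lerXn2r; rewrite ?nnegrE ?invr_ge0 ?(ltW s01)//.
    by rewrite invf_ple ?posrE//; lra.
  have b3 : ((1 - s)^-1) ^+ d * (1 - s) ^+ d = 1.
    by rewrite -exprMn mulVf ?expr1n// gt_eqF.
  have b0 : 0 <= ((1 - s)^-1) ^+ d by rewrite exprn_ge0// invr_ge0 ltW.
  move: b0 b2 b3; set a := _ ^+ d; set b := (1 - s) ^+ d in b1 *; set t := 2 ^+ d => b0 b2 b3.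
  have ds0 : 0 <= d%:R * s by rewrite mulr_ge0// ltW.
  rewrite -lerBlDr (_ : a * l - l = a * (1 - b) * l); last by rewrite mulrBr b3; ring.
  have b1' : 0 <= 1 - b by rewrite subr_ge0 exprn_ile1// ?ltW//; lra.
  by apply: ler_pM => //; [rewrite mulr_ge0|apply: ler_pM].
have [|_ h] := @volume_bounds R d M lam m i N 0 K hm mN Nd (lexx _).
  move=> z [rz _]; rewrite sqrtr_ge0/=; apply: rk.
  by apply: rc; exists z.
apply: le_trans h _; apply: le_trans (lee_wpmul2l _ lamN) _; first by rewrite lee_fin ltW.
rewrite -EFinM lee_fin.
have ser : s <= 2 * (eps / r).
  by rewrite /s -mulrA ler_pM2l// ler_pM2l// lef_pV2 ?posrE// lerDl ltW.
apply: (@le_trans _ _ (K * (2 ^+ d * (d%:R * (2 * (eps / r))) * c0))).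
  rewrite ler_pM2l// ler_pM2r// ler_pM2l ?exprn_gt0//.
  by rewrite ler_wpM2l.
rewrite (_ : K * _ = K * (2 ^+ d * (d%:R * 2) * c0) * (eps / r)); last by ring.
by rewrite ler_pM2r ?divr_gt0// lerDl.
Qed.

(** Statements proved chart by chart are glued along a finite subcover of the compact set of full
    measure. *)
Lemma ae_local (R : realType) (d : nat) (M : riemannianManifold R d)
    (f : M -> M) (nu : probability (borel M) R) (P : M -> Prop) :
  supported_on_compact_invariant f nu ->
  (forall x0 : M, exists2 V : set M, nbhs x0 V &
    nu.-negligible [set x : borel M | V x /\ ~ P x]) ->
  {ae nu, forall x : M, P x}.
Proof.
move=> [K [cK _ K1]] H.
have mK : measurable (K : set (borel M)).
  by apply: borel_closed; apply: compact_closed => //; exact: carrier_hausdorff.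
have KC : nu (~` K) = 0%E by rewrite probability_setC// K1 subee.
pose V (x : M) := projT1 (cid2 (H x)).
have HV x : nbhs x (V x) /\ nu.-negligible [set z : borel M | V x z /\ ~ P z].
  by rewrite /V; case: cid2.
have := cK; rewrite compact_cover => /(_ M setT (fun x => interior (V x))).
move=> [x _| |D _ KD].
- exact: open_interior.
- by move=> x Kx; exists x => //; have [] := HV x.
move: KD; set W := (X in cover X _) => KD.
have nD : nu.-negligible (\bigcup_(z in W) [set x : borel M | V z x /\ ~ P x]).
  rewrite bigcup_fset.
  by apply: big_ind => //; [exact: negligible_set0|exact: negligibleU|move=> z _; have [] := HV z].
have nK : nu.-negligible (~` K : set (borel M)).
  by exists (~` K); split => //; exact: measurableC.
apply: negligibleS (negligibleU nD nK) => x /= nPx.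
have [Kx|] := pselect (K x); last by right.
left; have [z Dz /interior_subset Vz] := KD _ Kx.
by exists z.
Qed.
(** * Recurrence sets *)

Lemma countable_bigcup_measurable_set (d : measure_display) (T : measurableType d) (I : Type)
    (P : set I) (F : I -> set T) : countable P ->
  (forall i, P i -> measurable (F i)) -> measurable (\bigcup_(i in P) F i).
Proof.
move=> /countable_injP[h hinj] mF.
rewrite (_ : \bigcup_(i in P) F i = \bigcup_n \bigcup_(i in [set i | P i /\ h i = n]) F i).
  apply: bigcupT_measurable => n.
  have [[i [Pi hi]]|nex] := pselect (exists i, P i /\ h i = n); last first.
    rewrite (_ : \bigcup_(i in _) _ = set0)//.
    by apply/seteqP; split => // x [i Pi _]; apply: nex; exists i.
  rewrite (_ : \bigcup_(i in _) _ = F i); first exact: mF.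
  apply/seteqP; split => [x [j [Pj hj] Fx]|x Fx]; last by exists i.
  by rewrite (_ : i = j)//; apply: hinj; rewrite ?inE// hi hj.
apply/seteqP; split => [x [i Pi Fx]|x [n _ [i [Pi _] Fx]]]; last by exists i.
by exists (h i) => //; exists i.
Qed.

(** The pairs at distance less than [r] form an open set of the product. Second countability writes
    it as a countable union of rectangles, whose preimages under [x -> (x, h x)] are measurable. *)
Lemma measurable_rdist_map (R : realType) (d : nat) (M : riemannianManifold R d)
    (h : borel M -> borel M) (r : R) : measurable_fun setT h ->
  measurable ([set x | (rdist x (h x) < r%:E)%E] : set (borel M)).
Proof.
move=> mh; have [B cB [Bo Bb]] := @carrier_second_countable R d M.
pose P : set (set M * set M) := [set UV | (B UV.1 /\ B UV.2) /\
  forall x y, UV.1 x -> UV.2 y -> (rdist x y < r%:E)%E].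
have cP : countable P.
  apply: sub_countable (countableX cB cB); apply: subset_card_le.
  by move=> UV [[B1 B2] _]; split.
rewrite (_ : [set x | _] = \bigcup_(UV in P) ((UV.1 : set (borel M)) `&` (setT `&` h @^-1` UV.2))).
  apply: countable_bigcup_measurable_set => // -[U V] [/= [BU BV] _].
  apply: measurableI; first by apply: borel_open; exact: Bo.
  by apply: mh => //; apply: borel_open; exact: Bo.
apply/seteqP; split => [x /= xr|x [[U V] [_ UV] /= [Ux [_ Vx]]]]; last exact: UV.
have [t [xt tr]] : exists t : R, (rdist x (h x) < t%:E)%E /\ t < r.
  have := xr; have := rdist_ge0 x (h x); case: (rdist x (h x)) => [t| |]//= _.
  rewrite lte_fin => tr; exists ((t + r) / 2); rewrite lte_fin.
  by split; [rewrite ltr_pdivlMr//; lra|rewrite ltr_pdivrMr//; lra].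
pose e := (r - t) / 2; have e0 : 0 < e by rewrite divr_gt0// subr_gt0.
have /Bb[U [BU Ux] HU] := near_rdist x e0.
have /Bb[V [BV Vx] HV] := near_rdist (h x : M) e0.
exists (U, V) => //=; split => //= y z Uy Vz.
have [_ yx] := HU _ Uy; have [xz _] := HV _ Vz.
have -> : r = e + t + e by rewrite /e; field.
exact: rdist_tri (rdist_tri yx xt) xz.
Qed.

Lemma measurable_recurrence_set (R : realType) (d : nat) (M : riemannianManifold R d)
    (f : borel M -> borel M) (g : nat -> R) (n : nat) : measurable_fun setT f ->
  measurable (recurrence_set (M := M) f g n : set (borel M)).
Proof.
move=> mf; pose r : R := n%:R `^ (- d%:R^-1).
rewrite (_ : recurrence_set f g n = \bigcup_(j in [set j : nat | (1 <= j)%N /\ j%:R <= g n])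
   \bigcap_k [set x : borel M | (rdist x (iter j f x) < (r + k.+1%:R^-1)%:E)%E]); last first.
  apply/seteqP; split => x.
    move=> [j [j1 jg jr]]; exists j => // k _ /=; apply: le_lt_trans jr _.
    by rewrite lte_fin ltrDl invr_gt0.
  move=> [j [j1 jg] jr]; exists j; split => //; apply/lee_addgt0Pr => e e0.
  have := jr (Num.truncn e^-1) I; move=> /ltW/le_trans; apply.
  rewrite -EFinD lee_fin lerD2l invf_ple ?posrE// ltW// truncnS_gt//.
apply: bigcup_measurable => j _; apply: bigcap_measurableType => k _.
by apply: measurable_rdist_map; exact: measurable_iter.
Qed.

(** [maximal_borel_cantelli] for the images in a chart of [nu] restricted to [E k]. Enclosing a
    Riemannian ball in a cube of radius [A * r] gives the constant [A ^+ d]. The radius [r0] does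
    not depend on [k]. *)
Lemma local_recurrence (R : realType) (d : nat) (M : riemannianManifold R d)
    (lam : {measure set (borel 'rV[R]_d) -> \bar R})
    (m : {measure set (borel M) -> \bar R}) (nu : probability (borel M) R)
    (rho : borel M -> R) (E : nat -> set (borel M)) (b : nat -> R) (x0 : M) :
  is_lebesgue lam -> chart_volume lam m -> is_density m nu rho ->
  (forall k, measurable (E k)) ->
  (\forall k \near \oo, 0 < b k /\ (nu (E k) <= (b k)%:E)%E) ->
  exists2 V : set M, nbhs x0 V & nu.-negligible [set x : borel M | V x /\ ~
    exists c r0 : R, [/\ 0 < c, 0 < r0 & \forall k \near \oo, forall r, 0 < r < r0 ->
      (nu (E k `&` rball x r) <= (c * (k%:R ^+ 2 * b k * r ^+ d))%:E)%E]].
Proof.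
move=> lebl hm den mE nb.
pose i := chart_at x0; have dx0 := dom_chart_at x0.
have mdom : measurable (dom i : set (borel M)) by exact: borel_open (dom_open i).
exists (dom i); first by apply: open_nbhs_nbhs; split => //; exact: dom_open.
have mS k : measurable ((dom i : set (borel M)) `&` E k) by exact: measurableI.
have Sd k : (dom i : set (borel M)) `&` E k `<=` dom i by exact: subIsetl.
pose mu k := projT1 (cid (chart_measure nu (mS k) (Sd k))).
have muE k A : mu k A = nu ((dom i : set (borel M)) `&` E k `&` (chart i @^-1` A)).
  by rewrite /mu; case: cid.
have nb' : \forall k \near \oo, 0 < b k /\ (mu k setT <= (b k)%:E)%E.
  apply: filterS nb => k [b0 nuE]; split => //; rewrite muE preimage_setT setIT.
  by apply: le_trans nuE; apply: le_mu => // x [].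
have /(@chart_null _ _ _ _ _ i _ hm) /(density_null den) nN := maximal_borel_cantelli lebl nb'.
apply: negligibleS nN => x [dx H]; split => // G; apply: H.
pose p := chart i x; have px : param i p = x by rewrite /p chartK.
have [A A0] := chart_ball (img_dom dx); rewrite -/p px => /near_right0P[r0 r00 HA].
exists (A ^+ d), r0; split => //; first exact: exprn_gt0.
apply: filterS G => k Gk r /andP[rp rr0].
have rr : 0 < r < r0 by rewrite rp.
have [rd rc] := HA _ rr.
have := Gk (A * r) (mulr_gt0 A0 rp); rewrite exprMn.
rewrite [X in (_ <= X%:E)%E -> _](_ : _ = A ^+ d * (k%:R ^+ 2 * b k * r ^+ d)); last by ring.
apply: le_trans; rewrite muE; apply: le_mu.
- by apply: measurableI => //; exact: measurable_rball.
- rewrite -setIA setICA; apply: measurableI => //.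
  by apply: measurable_chart_preimage; exact: measurable_cball.
- by move=> z [Ez rz]; split; [split => //; exact: rd|apply: rc; exists z].
Qed.
(** * Asymptotics *)

(** All rates are functions of [ln n], so asymptotics are done in a real variable and transferred
    here. *)
Lemma near_ln (R : realType) (P : R -> Prop) :
  (\forall x \near +oo, P x) -> \forall n \near \oo, P (ln (n%:R : R)).
Proof.
move=> [A [_ HA]]; exists (Num.truncn (expR A)).+1 => // n /= nA; apply: HA.
have h : expR A < n%:R by apply: lt_le_trans (truncnS_gt _) _; rewrite ler_nat.
by rewrite -ltr_expR lnK// posrE (lt_trans (expR_gt0 A)).
Qed.

Lemma near_exp_ge (R : realType) (A c : R) : 0 < c ->
  \forall x \near +oo, A <= expR (c * x).
Proof.
move=> c0; near=> x; apply: le_trans (expR_ge1Dx _).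
have : A / c <= x by near: x; apply: nbhs_pinfty_ge; exact: num_real.
by rewrite ler_pdivrMr// mulrC => /le_trans; apply; rewrite lerDr.
Unshelve. all: by end_near. Qed.

Lemma near_powR_ge (R : realType) (A p : R) : 0 < p ->
  \forall x \near +oo, A <= x `^ p.
Proof.
move=> p0; pose B := Num.max A 1.
have B0 : 0 < B by rewrite /B lt_max ltr01 orbT.
near=> x.
have h : B `^ p^-1 <= x by near: x; exact: nbhs_pinfty_ge.
apply: (@le_trans _ _ B); first by rewrite /B le_max lexx.
have pn0 : p != 0 by rewrite gt_eqF.
rewrite -[leLHS](powRr1 (ltW B0)) -(mulVf pn0) powRrM.
by apply: ge0_ler_powR; rewrite ?nnegrE ?powR_ge0 ?(ltW p0)// (le_trans (powR_ge0 _ _) h).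
Unshelve. all: by end_near. Qed.

Lemma near_powR_dominates (R : realType) (A c s t : R) : 0 < c -> s < t ->
  \forall x \near +oo, A * x `^ s <= c * x `^ t.
Proof.
move=> c0 st; near=> x.
have x0 : 0 < x by near: x; exact: nbhs_pinfty_gt.
have h : A / c <= x `^ (t - s) by near: x; apply: near_powR_ge; rewrite subr_gt0.
rewrite (_ : t = (t - s) + s); last by ring.
rewrite powRD; last by rewrite (gt_eqF x0) implybT.
by rewrite mulrA ler_wpM2r ?powR_ge0// -ler_pdivrMl// mulrC.
Unshelve. all: by end_near. Qed.

Lemma near_powR_le_exp (R : realType) (p c : R) : 0 < c ->
  \forall x \near +oo, x `^ p <= expR (c * x).
Proof.
move=> c0; pose q := Num.max p 1.
have q0 : 0 < q by rewrite /q lt_max ltr01 orbT.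
have qp : p <= q by rewrite /q le_max lexx.
near=> x.
have x1 : 1 <= x by near: x; exact: nbhs_pinfty_ge.
apply: le_trans (ler_powR x1 qp) _.
(* One half of the exponent carries the power of [x]; the other absorbs the constant that arises. *)
pose a := c / (2 * q); have a0 : 0 < a by rewrite divr_gt0// mulr_gt0.
have h1 : x <= a^-1 * expR (a * x).
  rewrite ler_pdivlMl//; apply: le_trans (expR_ge1Dx _); rewrite lerDr//.
have h2 : (a^-1) `^ q <= expR (c / 2 * x) by near: x; apply: near_exp_ge; rewrite divr_gt0.
apply: (@le_trans _ _ ((a^-1 * expR (a * x)) `^ q)).
  have x0 : 0 <= x by exact: le_trans ler01 x1.
  by apply: ge0_ler_powR => //; rewrite ?nnegrE ?(ltW q0)//; exact: le_trans h1.
rewrite powRM ?invr_ge0 ?(ltW a0) ?expR_ge0// -expRM.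
rewrite (_ : a * x * q = c / 2 * x); last by rewrite /a; field; rewrite gt_eqF.
apply: (@le_trans _ _ (expR (c / 2 * x) * expR (c / 2 * x))).
  by rewrite ler_wpM2r ?expR_ge0.
by rewrite -expRD ler_expR -mulrDl -splitr.
Unshelve. all: by end_near. Qed.

(** * The events expressed by balls *)

(** Staying at or below the level means avoiding the open ball, whereas the exceedances counted by
    [tau] form the closed ball. The sphere between them is later absorbed by the annulus. *)
Lemma observable_le (R : realType) (d : nat) (M : riemannianManifold R d) (xt x : M) (t : R) :
  (observable xt x <= t%:E)%E = ~~ (rdist x xt < (expR (- t))%:E)%E.
Proof.
rewrite /observable -leNgt; case: (rdist x xt) (rdist_ge0 x xt) => [y| |]//.
  rewrite !lee_fin => y0; rewrite /lne; case: (leP y 0) => yle.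
    by rewrite [RHS]leNgt (le_lt_trans yle (expR_gt0 (- t)))/= leNgt ltry.
  by rewrite -EFinN lee_fin lerNl -ler_expR lnK// posrE.
by rewrite !leey /= leNye.
Qed.

Lemma le_observable (R : realType) (d : nat) (M : riemannianManifold R d) (xt x : M) (t : R) :
  (t%:E <= observable xt x)%E = (rdist x xt <= (expR (- t))%:E)%E.
Proof.
rewrite /observable; case: (rdist x xt) (rdist_ge0 x xt) => [y| |]//.
rewrite !lee_fin => y0; rewrite /lne; case: (leP y 0) => yle.
  by rewrite (le_trans yle) ?expR_ge0//= leey.
by rewrite -EFinN lee_fin lerNr -{1}(expRK (- t)) ler_ln ?posrE ?expR_gt0.
Qed.

Lemma block_max_le (R : realType) (T : Type) (f : T -> T) (phi : T -> \bar R) (n : nat) (x : T)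
    (c : \bar R) :
  (block_max f phi n x <= c)%E <-> forall i, (i < n)%N -> (phi (iter i f x) <= c)%E.
Proof.
rewrite /block_max; elim: n => [|n IH].
  by rewrite big_geq//; split => // _; exact: leNye.
rewrite big_nat_recr//= ge_max; split => [/andP[/IH h1 h2] i|H].
  by rewrite ltnS leq_eqVlt => /predU1P[->//|]; exact: h1.
by rewrite (H n)// andbT; apply/IH => i ni; apply: H; exact: ltnW.
Qed.

Lemma prob_max_leE (R : realType) (d : nat) (M : riemannianManifold R d)
    (f : M -> M) (nu : probability (borel M) R) (xt : M) (u : R) (n : nat) :
  prob_max_le f nu xt u n = fine (nu (avoid f (rball xt (expR (- threshold d u n))) n)).
Proof.
rewrite /prob_max_le; congr (fine (nu _)); apply/seteqP; split => x /=.
  by move=> /block_max_le H i ni; apply/negP; rewrite -observable_le; exact: H.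
by move=> H; apply/block_max_le => i ni; rewrite observable_le; apply/negP; exact: H.
Qed.

Lemma tauE (R : realType) (d : nat) (M : riemannianManifold R d)
    (nu : probability (borel M) R) (xt : M) (u : R) (n : nat) :
  tau nu xt u n =
  n%:R * fine (nu [set x | (rdist x xt <= (expR (- threshold d u n))%:E)%E]).
Proof.
rewrite /tau; congr (_ * fine (nu _)); apply/seteqP; split => x /=; by rewrite le_observable.
Qed.

Lemma threshold_exp (R : realType) (d n : nat) (u : R) : (0 < d)%N -> (0 < n)%N ->
  expR (- threshold d u n) ^+ d = expR (- u) / n%:R.
Proof.
move=> d0 n0; rewrite -expRM_natl /threshold.
rewrite (_ : d%:R * _ = - u - ln n%:R); last by field; rewrite pnatr_eq0 -lt0n.
by rewrite expRD [X in _ * X]expRN lnK// posrE ltr0n.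
Qed.

Lemma measurable_closed_rball (R : realType) (d : nat) (M : riemannianManifold R d)
    (xt : M) (r : R) : measurable ([set x | (rdist x xt <= r%:E)%E] : set (borel M)).
Proof.
rewrite (_ : [set x | _] = ~` ([set x | (r%:E < rdist xt x)%E] : set (borel M))); last first.
  by apply/seteqP; split => x /=; rewrite rdistC leNgt => /negP.
by apply: measurableC; apply: borel_open; exact: rdist_gt_open.
Qed.

(** The sphere lies in every annulus outside the open ball. *)
Lemma closed_rball_le (R : realType) (d : nat) (M : riemannianManifold R d)
    (nu : probability (borel M) R) (xt : M) (r eps : R) : 0 < eps ->
  fine (nu (rball xt r)) <= fine (nu [set x | (rdist x xt <= r%:E)%E]) <=
  fine (nu (rball xt r)) + fine (nu (rball xt (r + eps) `\` rball xt r)).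
Proof.
move=> eps0; have mB := measurable_rball xt r; have mC := measurable_closed_rball xt r.
have mN : measurable (rball xt (r + eps) `\` rball xt r).
  by apply: measurableD => //; exact: measurable_rball.
apply/andP; split; first by apply: pr_le => // x /= /ltW.
apply: le_trans (prU2 nu mB mN); apply: pr_le => //; first exact: measurableU.
move=> x /= xr; have [?|nx] := pselect (rball xt r x); [by left|right; split => //].
by apply: le_lt_trans xr _; rewrite lte_fin ltrDl.
Qed.

Lemma poisson_bound (R : realType) (d : nat) (M : riemannianManifold R d)
    (f : borel M -> borel M) (nu : probability (borel M) R) (Theta : nat -> R)
    (xt : M) (r eps : R) (t n : nat) :
  correlation_decay f nu Theta -> measurable_fun setT f -> invariant_measure f nu ->
  0 < r -> 0 < eps -> 0 <= Theta t -> (0 < t)%N ->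
  let b := fine (nu (rball xt r)) in
  `|fine (nu (avoid f (rball xt r) n)) - expR (- (n%:R * b))| <=
    n%:R * (fine (nu (rball xt r `&` return_set f (rball xt r) t)) +
      (fine (nu (rball xt (r + eps) `\` rball xt r)) + Theta t * (1 + eps^-1)) +
      t%:R * b ^+ 2) + t%:R * b + n%:R * b ^+ 2.
Proof.
move=> cd mf inv r0 eps0 Th0 t0 /=.
have mB := measurable_rball xt r.
have b01 : 0 <= fine (nu (rball xt r)) <= 1 by rewrite pr_ge0 pr_le1.
have h1 := avoid_poisson mf inv mB t0 (fun k =>
  decorrelation xt cd mf (measurable_avoid k mf mB) r0 eps0 Th0) n.
have h2 := pow_exp_le n b01.
apply: le_trans (ler_distD ((1 - fine (nu (rball xt r))) ^+ n) _ _) _.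
exact: lerD.
Qed.

(** The second summand replaces the closed ball in [tau] by the open one. The smallness condition
    keeps [tau / sqrt n] below 1/2, where [powR_exp_le] applies. *)
Lemma G_sqrt_bound (R : realType) (d : nat) (M : riemannianManifold R d)
    (nu : probability (borel M) R) (xt : M) (u eps : R) (n : nat) :
  (0 < n)%N -> 0 < eps ->
  let r := expR (- threshold d u n) in
  let b := fine (nu (rball xt r)) in
  let a := fine (nu (rball xt (r + eps) `\` rball xt r)) in
  2 * (n%:R * b + n%:R * a) <= Num.sqrt n%:R ->
  `|G_sqrt nu xt u n - expR (- (n%:R * b))| <=
    2 * (n%:R * b + n%:R * a) ^+ 2 / Num.sqrt n%:R + n%:R * a.
Proof.
move=> n0 eps0 /=; set r := expR _; set b := fine (nu (rball xt r)).
set a := fine (nu (_ `\` _)) => H.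
have s0 : 0 < Num.sqrt (n%:R : R) by rewrite sqrtr_gt0 ltr0n.
have /andP[c1 c2] := closed_rball_le nu xt r eps0; rewrite -/b -/a in c1 c2.
have tE := tauE nu xt u n; rewrite -/r in tE.
set c := fine _ in c1 c2 tE.
have b0 : 0 <= b by exact: pr_ge0.
have a0 : 0 <= a by exact: pr_ge0.
have nn : 0 <= (n%:R : R) by [].
have t1 : tau nu xt u n <= n%:R * b + n%:R * a by rewrite tE -mulrDr ler_wpM2l.
have t0 : n%:R * b <= tau nu xt u n by rewrite tE ler_wpM2l.
have t00 : 0 <= tau nu xt u n by apply: le_trans t0; rewrite mulr_ge0.
have h1 : `|G_sqrt nu xt u n - expR (- tau nu xt u n)| <= 2 * (n%:R * b + n%:R * a) ^+ 2 / Num.sqrt n%:R.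
  apply: le_trans (powR_exp_le t00 s0 _) _; first by apply: le_trans H; rewrite ler_pM2l.
  by rewrite ler_pM2r ?invr_gt0// ler_pM2l// lerXn2r// nnegrE// (le_trans t00).
have h2 : `|expR (- tau nu xt u n) - expR (- (n%:R * b))| <= n%:R * a.
  apply: le_trans (exp_sub_le _ _) _; rewrite ?oppr_le0// ?mulr_ge0//.
  by rewrite opprK ler_norml; apply/andP; split; lra.
apply: le_trans (ler_distD (expR (- tau nu xt u n)) _ _) _.
exact: lerD.
Qed.

(** * Errors as functions of log n *)

Lemma exp_ln_nat (R : realType) (n : nat) : (0 < n)%N -> expR (ln (n%:R : R)) = n%:R.
Proof. by move=> n0; rewrite lnK// posrE ltr0n. Qed.

Lemma near_linear_le_powR (R : realType) (A c s : R) : 0 < c -> 1 < s ->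
  \forall x \near +oo, A * x <= c * x `^ s.
Proof.
move=> c0 s1; near=> x.
have x0 : 0 < x by near: x; exact: nbhs_pinfty_gt.
rewrite -{1}(powRr1 (ltW x0)); near: x; exact: near_powR_dominates.
Unshelve. all: by end_near. Qed.

Lemma near_radius (R : realType) (d : nat) (u : R) (P : R -> Prop) : (0 < d)%N ->
  (\forall r \near (0 : R)^'+, P r) -> \forall n \near \oo, P (expR (- threshold d u n)).
Proof.
move=> d0 /near_right0P[e e0 He].
have dr : 0 < (d%:R : R) by rewrite ltr0n.
have H : \forall x \near +oo, - (d%:R * ln e) - u < x by apply: nbhs_pinfty_gt; exact: num_real.
have := near_ln H; apply: filterS => n /= h; apply: He; rewrite expR_gt0/= -[ltRHS]lnK ?posrE// ltr_expR.
rewrite /threshold -mulrDl ltrNl ltr_pdivlMr// mulNr mulrC; lra.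
Qed.

(** The width [exp (- x^s)] with [s > 1] is smaller than every power of [n = exp x], whereas [r^-1]
    and the factor [n] are only powers of it. *)
Lemma near_annulus (R : realType) (d : nat) (M : riemannianManifold R d)
    (m : {measure set (borel M) -> \bar R}) (nu : probability (borel M) R)
    (xt : M) (u c r0 J delta s : R) :
  (0 < d)%N -> 0 < delta -> 1 < s -> 0 < c -> 0 < r0 -> 0 <= J ->
  (forall r eps, 0 < eps -> 3 * eps <= r -> r + eps < r0 ->
    (m (rball xt (r + eps) `\` rball xt r) <= (c * (eps / r))%:E)%E) ->
  (forall (A : set (borel M)) (s : R), measurable A -> 0 < s ->
    (nu A <= s%:E * m A + (s `^ (- delta) * J)%:E)%E) ->
  \forall n \near \oo,
    let r := expR (- threshold d u n) in let eps := expR (- (ln n%:R `^ s)) in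
    n%:R * fine (nu (rball xt (r + eps) `\` rball xt r)) <= expR (- ln n%:R).
Proof.
move=> d0 dl0 s1 c0 r00 J0 Hm Hnu.
have d1 : 1 <= (d%:R : R) by rewrite ler1n.
have dp : 0 < (d%:R : R) by rewrite ltr0n.
have HP : \forall x \near +oo, [/\ 1 <= x, 3 * x <= 1 * x `^ s, u / d%:R <= x &
    [/\ 6 * x <= 2^-1 * x `^ s, 4 * x <= (delta / 2) * x `^ s,
     3 <= expR (1 * x), c <= expR (1 * x) & J <= expR (1 * x)]].
  near=> x; split; last split.
  - by near: x; exact: nbhs_pinfty_ge.
  - by near: x; exact: near_linear_le_powR.
  - by near: x; apply: nbhs_pinfty_ge; exact: num_real.
  - by near: x; apply: near_linear_le_powR => //; rewrite invr_gt0.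
  - by near: x; apply: near_linear_le_powR => //; rewrite divr_gt0.
  - by near: x; exact: near_exp_ge.
  - by near: x; exact: near_exp_ge.
  - by near: x; exact: near_exp_ge.
have n2 := near_radius u d0 (@nbhs_right_lt R 0 (r0 / 2) (divr_gt0 r00 (ltr0Sn _ 1))).
have := near_ln HP; apply: filterS2 n2 => n rr0.
have [->|n0] := posnP n; first by move=> _ /=; rewrite mul0r expR_ge0.
set x := ln n%:R; move=> [x1 a1 a2 [a3 a4 a5 a6 a7]] /=.
rewrite !mul1r in a1 a5 a6 a7.
set r := expR _ in rr0 *; set eps := expR (- _); set N := rball _ _ `\` _.
have r_gt0 : 0 < r by exact: expR_gt0.
have eps0 : 0 < eps by exact: expR_gt0.
have x0 : 0 <= x by exact: le_trans ler01 x1.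
have thx : threshold d u n <= 2 * x.
  rewrite /threshold -/x mulr_natl mulr2n; apply: lerD => //.
  by rewrite ler_pdivrMr// ler_peMr.
have e3 : 3 * eps <= r.
  apply: (@le_trans _ _ (expR x * eps)); first by rewrite ler_pM2r.
  by rewrite -expRD ler_expR; lra.
have er : r + eps < r0 by lra.
have mN : measurable N by apply: measurableD; exact: measurable_rball.
(* The level of [density_tail]: the square root of [eps^-1]. Then [q * eps] and [q^(- delta)] are
   both of the form [exp (- const * x^s)]. *)
pose q := expR (2^-1 * x `^ s); have q0 : 0 < q by exact: expR_gt0.
have hN : fine (nu N) <= q * (c * (eps / r)) + q `^ (- delta) * J.
  rewrite -lee_fin -(pr_fin nu mN); apply: le_trans (Hnu N q mN q0) _.
  rewrite EFinD (EFinM q); apply: leeD => //; apply: lee_wpmul2l; last exact: Hm.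
  by rewrite lee_fin ltW.
have nE : n%:R = expR x by rewrite exp_ln_nat.
have ir : r^-1 <= expR (2 * x) by rewrite /r -expRN opprK ler_expR.
have t1 : expR x * (q * (c * (eps / r))) <= expR (- (2 * x)).
  apply: (@le_trans _ _ (expR x * (q * (expR x * (eps * expR (2 * x)))))).
    rewrite ler_pM2l ?expR_gt0// ler_pM2l//; apply: ler_pM => //; first exact: ltW.
      by rewrite mulr_ge0// ?invr_ge0 ltW.
    by rewrite ler_pM2l.
  by rewrite -!expRD ler_expR; lra.
have t2 : expR x * (q `^ (- delta) * J) <= expR (- (2 * x)).
  apply: (@le_trans _ _ (expR x * (q `^ (- delta) * expR x))).
    by rewrite ler_pM2l ?expR_gt0// ler_wpM2l// powR_ge0.
  rewrite /q -expRM -!expRD ler_expR.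
  have -> : 2^-1 * x `^ s * - delta = - (delta / 2 * x `^ s) by ring.
  by lra.
rewrite nE; apply: (@le_trans _ _ (expR x * (q * (c * (eps / r)) + q `^ (- delta) * J))).
  by rewrite ler_pM2l ?expR_gt0.
rewrite mulrDr; apply: le_trans (lerD t1 t2) _.
have -> : expR (- x) = expR (- (2 * x)) * expR x by rewrite -expRD; congr expR; ring.
by rewrite -{1 2}[expR (- (2 * x))]mulr1 -mulrDr ler_pM2l ?expR_gt0//; lra.
Unshelve. all: by end_near. Qed.

(** After a gap of [x^gamma] the correlations are at most a multiple of
    [exp (- l' * x^(gamma * beta))]. This outweighs [eps^-1 = exp (x^s)] because [s < gamma * beta],
    and [n] because [gamma * beta > 1]. *)
Lemma near_decorrelation (R : realType) (Theta : nat -> R) (theta0 beta gamma s : R) :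
  0 < theta0 < 1 -> 0 < beta -> 0 < gamma -> 1 < s -> s < gamma * beta ->
  Theta =O_\oo (fun n => theta0 `^ (n%:R `^ beta)) ->
  \forall n \near \oo,
    n%:R * (Theta (Num.truncn (ln n%:R `^ gamma)) * (1 + (expR (- (ln n%:R `^ s)))^-1)) <=
    expR (- ln n%:R).
Proof.
move=> /andP[th0 th1] b0 g0 s1 sgb /eqO_exP[k k0 [T0 _ HT]].
pose l := - ln theta0; have l0 : 0 < l by rewrite /l oppr_gt0 ln_lt0// th0.
(* The factor [2^(- beta)] pays for rounding: the gap is only known to be at least [x^gamma / 2]. *)
pose l' := l * 2^-1 `^ beta.
have l'0 : 0 < l' by rewrite mulr_gt0// powR_gt0// invr_gt0.
have HP : \forall x \near +oo, [/\ 1 <= x, 3 * x <= (l' / 2) * x `^ (gamma * beta),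
    1 * x `^ s <= (l' / 2) * x `^ (gamma * beta) &
    [/\ 2 <= x `^ gamma, T0.+1%:R <= x `^ gamma & 2 * k <= expR (1 * x)]].
  near=> x; split; last split.
  - by near: x; exact: nbhs_pinfty_ge.
  - by near: x; apply: near_linear_le_powR; [rewrite divr_gt0|exact: lt_trans sgb].
  - by near: x; apply: near_powR_dominates => //; rewrite divr_gt0.
  - by near: x; exact: near_powR_ge.
  - by near: x; exact: near_powR_ge.
  - by near: x; exact: near_exp_ge.
have := near_ln HP; apply: filterS => n.
have [->|n0] := posnP n; first by move=> _ /=; rewrite mul0r expR_ge0.
have nE : n%:R = expR (ln (n%:R : R)) by rewrite exp_ln_nat.
set x := ln n%:R; move=> [x1 a1 a2 [a3 a4 a5]].
rewrite mul1r in a2; rewrite mul1r in a5.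
have x0 : 0 <= x by exact: le_trans ler01 x1.
set t := Num.truncn _.
have tx : x `^ gamma < t.+1%:R by exact: truncnS_gt.
have tT : (T0 <= t)%N by rewrite -ltnS -(ltr_nat R); apply: le_lt_trans tx; apply: le_trans a4; rewrite ler_nat.
have t2 : x `^ gamma / 2 <= t%:R.
  by rewrite ler_pdivrMr//; move: tx; rewrite -natr1; lra.
have tb : x `^ (gamma * beta) * 2^-1 `^ beta <= t%:R `^ beta.
  rewrite powRrM -powRM ?powR_ge0 ?invr_ge0//.
  by apply: ge0_ler_powR; rewrite ?nnegrE ?(ltW b0)// mulr_ge0// ?powR_ge0 ?invr_ge0.
have Th : Theta t <= k * expR (- (l' * x `^ (gamma * beta))).
  apply: le_trans (ler_norm _) _; apply: le_trans (HT t tT) _.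
  rewrite ler_pM2l// ger0_norm ?powR_ge0// /powR gt_eqF// ler_expR.
  rewrite /l' (_ : ln theta0 = - l); last by rewrite /l opprK.
  by rewrite mulrN lerN2 mulrAC -mulrA [leRHS]mulrC ler_pM2l.
have e1 : 1 + (expR (- (x `^ s)))^-1 <= 2 * expR (x `^ s).
  rewrite -expRN opprK; have : 1 <= expR (x `^ s) by rewrite -expR0 ler_expR powR_ge0.
  by lra.
rewrite nE -/x; apply: (@le_trans _ _ (expR x * (k * expR (- (l' * x `^ (gamma * beta))) * (2 * expR (x `^ s))))).
  rewrite ler_pM2l ?expR_gt0//.
  apply: (@le_trans _ _ (k * expR (- (l' * x `^ (gamma * beta))) * (1 + (expR (- (x `^ s)))^-1))).
    by rewrite ler_wpM2r// addr_ge0// invr_ge0 expR_ge0.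
  by rewrite ler_wpM2l// mulr_ge0 ?expR_ge0// ltW.
rewrite [leLHS](_ : _ = (2 * k) * (expR x * expR (- (l' * x `^ (gamma * beta))) * expR (x `^ s))); last by ring.
apply: (@le_trans _ _ (expR x * (expR x * expR (- (l' * x `^ (gamma * beta))) * expR (x `^ s)))).
  by rewrite ler_wpM2r// !mulr_ge0// expR_ge0.
by rewrite -!expRD ler_expR; lra.
Unshelve. all: by end_near. Qed.

Lemma near_mass (R : realType) (d : nat) (M : riemannianManifold R d)
    (nu : probability (borel M) R) (xt : M) (u C0 : R) : (0 < d)%N ->
  fine (nu (rball xt r)) / r ^+ d @[r --> (0 : R)^'+] --> C0 ->
  n%:R * fine (nu (rball xt (expR (- threshold d u n)))) @[n --> \oo] --> C0 * expR (- u).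
Proof.
move=> d0 cC; apply/cvgrPdist_le => e e0.
have eu : 0 < e * expR u by rewrite mulr_gt0// expR_gt0.
have : \forall r \near (0 : R)^'+, `|C0 - fine (nu (rball xt r)) / r ^+ d| <= e * expR u.
  by move/cvgrPdist_le : cC; apply.
move=> /(near_radius u d0); near_simpl => H.
have n0 : \forall n \near \oo, (0 < n)%N by exists 1%N.
apply: filterS2 H n0 => n h n0; move: h; rewrite threshold_exp//.
set b := fine _ => h.
rewrite (_ : C0 * expR (- u) - n%:R * b = (C0 - b / (expR (- u) / n%:R)) * expR (- u)); last first.
  by rewrite mulrBl; congr (_ - _); field; rewrite pnatr_eq0 -lt0n n0 gt_eqF ?expR_gt0.
rewrite normrM (gtr0_norm (expR_gt0 _)) -ler_pdivlMr ?expR_gt0// -expRN opprK//.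
Qed.

(** Apart from the early returns, the errors are at most [n^(-1/2)] up to constants: the square root
    comes from [G_sqrt], while the gap terms are [(ln n)^gamma / n]. The exponent 1/4 leaves room
    for the constants. *)
Lemma near_poisson_bound (R : realType) (d : nat) (M : riemannianManifold R d)
    (f : borel M -> borel M) (nu : probability (borel M) R) (Theta : nat -> R)
    (xt : M) (u C0 gamma s : R) :
  (0 < d)%N -> 0 < gamma ->
  correlation_decay f nu Theta -> measurable_fun setT f -> invariant_measure f nu ->
  (forall t, 0 <= Theta t) ->
  fine (nu (rball xt r)) / r ^+ d @[r --> (0 : R)^'+] --> C0 ->
  (\forall n \near \oo,
    let r := expR (- threshold d u n) in let eps := expR (- (ln n%:R `^ s)) in
    n%:R * fine (nu (rball xt (r + eps) `\` rball xt r)) <= expR (- ln n%:R)) ->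
  (\forall n \near \oo,
    n%:R * (Theta (Num.truncn (ln n%:R `^ gamma)) * (1 + (expR (- (ln n%:R `^ s)))^-1)) <=
    expR (- ln n%:R)) ->
  \forall n \near \oo,
    let B := rball xt (expR (- threshold d u n)) in
    `|prob_max_le f nu xt u n - expR (- (n%:R * fine (nu B)))| <=
      n%:R * fine (nu (B `&` return_set f B (Num.truncn (ln n%:R `^ gamma)))) +
      expR (- (ln n%:R / 4)) /\
    `|G_sqrt nu xt u n - expR (- (n%:R * fine (nu B)))| <= expR (- (ln n%:R / 4)).
Proof.
move=> d0 g0 cd mf inv Th0 cC Hann Hdec.
(* At least 1, so that [K <= K ^+ 2] and one bound serves both powers of [n * b]. *)
pose K := Num.max 1 (C0 * expR (- u) + 1).
have K1 : 1 <= K by rewrite /K le_max lexx.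
have K0 : 0 < K by exact: lt_le_trans K1.
have HK : \forall n \near \oo, n%:R * fine (nu (rball xt (expR (- threshold d u n)))) <= K.
  have /cvgrPdist_le/(_ 1 ltr01) := @near_mass R d M nu xt u C0 d0 cC.
  apply: filterS => n; rewrite distrC => /(le_trans (ler_norm _)).
  by rewrite lerBlDr addrC => /le_trans; apply; rewrite /K le_max lexx orbT.
pose P (x : R) := [/\ 1 <= x, 1 <= x `^ gamma, x `^ gamma <= expR (4^-1 * x) &
    [/\ 3 * K ^+ 2 <= expR (4^-1 * x), 3 <= expR (4^-1 * x), 2 * (K + 1) <= expR (2^-1 * x) &
       2 * (K + 1) ^+ 2 + 1 <= expR (4^-1 * x)]].
have HP : \forall x \near +oo, P x.
  near=> x; split; last split.
  - by near: x; exact: nbhs_pinfty_ge.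
  - by near: x; exact: near_powR_ge.
  - by near: x; apply: near_powR_le_exp; rewrite invr_gt0.
  - by near: x; apply: near_exp_ge; rewrite invr_gt0.
  - by near: x; apply: near_exp_ge; rewrite invr_gt0.
  - by near: x; apply: near_exp_ge; rewrite invr_gt0.
  - by near: x; apply: near_exp_ge; rewrite invr_gt0.
have n1 : \forall n \near \oo, (0 < n)%N by exists 1%N.
near=> n; have n0 : (0 < n)%N by near: n.
have hK : n%:R * fine (nu (rball xt (expR (- threshold d u n)))) <= K by near: n.
have hx : P (ln (n%:R : R)) by near: n; exact: near_ln HP.
have hA : let r := expR (- threshold d u n) in let eps := expR (- (ln n%:R `^ s)) in
    n%:R * fine (nu (rball xt (r + eps) `\` rball xt r)) <= expR (- ln n%:R) by near: n.
have hD : n%:R * (Theta (Num.truncn (ln n%:R `^ gamma)) * (1 + (expR (- (ln n%:R `^ s)))^-1)) <=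
    expR (- ln n%:R) by near: n.
clear -n0 hK hx hA hD d0 g0 cd mf inv Th0 K1 K0.
move: hx hA => /=; rewrite /P; have nE := exp_ln_nat R n0.
have r0 : 0 < expR (- threshold d u n) by exact: expR_gt0.
have e0 : 0 < expR (- (ln (n%:R : R) `^ s)) by exact: expR_gt0.
have [t0|t0] := posnP (Num.truncn (ln (n%:R : R) `^ gamma)).
  move=> [_ h _ _]; have := truncnS_gt (ln (n%:R : R) `^ gamma).
  by rewrite t0 ltNge h.
have P1 := @poisson_bound R d M f nu Theta xt _ _ _ n cd mf inv r0 e0 (Th0 _) t0.
have P2 := G_sqrt_bound (nu := nu) (xt := xt) (u := u) n0 e0.
move: P1 P2 hK hD => /=; rewrite -prob_max_leE.
have tx : (Num.truncn (ln (n%:R : R) `^ gamma))%:R <= ln (n%:R : R) `^ gamma.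
  by rewrite truncn_le// powR_ge0.
set x := ln n%:R in nE tx *; set t : R := (Num.truncn _)%:R in tx *.
set B := rball xt (expR (- threshold d u n)).
have b0 : 0 <= fine (nu B) by exact: pr_ge0.
set b := fine (nu B) in b0 *; set a := fine (nu (_ `\` _)).
have a0 : 0 <= a by exact: pr_ge0.
set ret := fine (nu (_ `&` _)); set D := Theta _ * _.
move=> P1 P2 hK hD [x1 g1 gx [k1 k2 k3 k4]] hA.
have t00 : 0 <= t by [].
have nn0 : 0 < (n%:R : R) by rewrite ltr0n.
have nb0 : 0 <= n%:R * b by rewrite mulr_ge0.
have na0 : 0 <= n%:R * a by rewrite mulr_ge0.
have E1 : expR (- x) <= expR (- (x / 2)) by rewrite ler_expR; lra.
have E2 : 3 * expR (- (x / 2)) <= expR (- (x / 4)).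
  rewrite (_ : - (x / 4) = 4^-1 * x + - (x / 2)); last by field.
  by rewrite expRD ler_pM2r ?expR_gt0.
have iE : n%:R^-1 = expR (- x) by rewrite expRN nE.
have ex1 : expR (- x) <= 1 by rewrite -expR0 ler_expR; lra.
have nb2 : (n%:R * b) ^+ 2 <= K ^+ 2 by apply: lerXn2r; rewrite ?nnegrE// ltW.
have KK : K <= K ^+ 2 by rewrite expr2 ler_peMr// ltW.
(* Factoring out [1 / n] leaves polynomials in [n * b <= K] and in [t <= x^gamma]; half a power of
   [n] absorbs both. *)
have T3 : n%:R * (t * b ^+ 2) + t * b + n%:R * b ^+ 2 <= expR (- (x / 2)).
  rewrite (_ : _ + _ = (t * (n%:R * b) ^+ 2 + t * (n%:R * b) + (n%:R * b) ^+ 2) * n%:R^-1); last first.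
    by field; rewrite gt_eqF.
  rewrite iE (_ : - (x / 2) = (4^-1 * x + 4^-1 * x) + (- x)); last by field.
  rewrite expRD ler_pM2r ?expR_gt0// expRD.
  apply: (@le_trans _ _ (3 * K ^+ 2 * x `^ gamma)); last first.
    by apply: ler_pM => //; [rewrite mulr_ge0// exprn_ge0// ltW|exact: powR_ge0].
  have q1 : t * (n%:R * b) ^+ 2 <= x `^ gamma * K ^+ 2 by apply: ler_pM => //; exact: exprn_ge0.
  have q2 : t * (n%:R * b) <= x `^ gamma * K ^+ 2 by apply: ler_pM => //; exact: le_trans KK.
  have q3 : (n%:R * b) ^+ 2 <= x `^ gamma * K ^+ 2.
    by apply: le_trans nb2 _; rewrite ler_peMl// exprn_ge0// ltW.
  rewrite (_ : 3 * K ^+ 2 * x `^ gamma = x `^ gamma * K ^+ 2 + x `^ gamma * K ^+ 2 + x `^ gamma * K ^+ 2); last by ring.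
  by rewrite lerD// lerD.
split.
  apply: le_trans P1 _.
  rewrite (_ : _ + _ = n%:R * ret + (n%:R * a + n%:R * D + (n%:R * (t * b ^+ 2) + t * b + n%:R * b ^+ 2))); last by ring.
  rewrite lerD2l; apply: le_trans E2; lra.
have sE : Num.sqrt (n%:R : R) = expR (2^-1 * x).
  rewrite -nE (_ : x = 2^-1 * x + 2^-1 * x); last by field.
  rewrite expRD -expr2 sqrtr_sqr ger0_norm ?expR_ge0//; by congr expR; field.
have S1 : n%:R * b + n%:R * a <= K + 1 by lra.
have S0 : 0 <= n%:R * b + n%:R * a by rewrite addr_ge0.
have S3 : 2 * (n%:R * b + n%:R * a) <= Num.sqrt n%:R by rewrite sE; lra.
apply: le_trans (P2 S3) _.
rewrite sE -expRN.
have S2 : (n%:R * b + n%:R * a) ^+ 2 <= (K + 1) ^+ 2.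
  by apply: lerXn2r; rewrite ?nnegrE//; exact: le_trans S1.
apply: (@le_trans _ _ ((2 * (K + 1) ^+ 2 + 1) * expR (- (x / 2)))).
  rewrite [leRHS]mulrDl mul1r; apply: lerD; last by apply: le_trans E1.
  rewrite (_ : - (2^-1 * x) = - (x / 2)); last by field.
  by rewrite ler_pM2r ?expR_gt0// ler_pM2l.
rewrite (_ : - (x / 4) = 4^-1 * x + - (x / 2)); last by field.
by rewrite expRD ler_pM2r ?expR_gt0.
Unshelve. all: by end_near. Qed.

(** * Block times and early returns *)

Lemma ln_nat_ge0 (R : realType) (n : nat) : 0 <= ln (n%:R : R).
Proof. by case: n => [|n]; [rewrite ln0|rewrite ln_ge0// ler1n]. Qed.

Lemma ln_nat_homo (R : realType) : {homo (fun n => ln (n%:R : R)) : i j / (i <= j)%N >-> i <= j}.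
Proof.
move=> [|i] j ij; first by rewrite ln0// ln_nat_ge0.
by rewrite ler_ln ?posrE ?ltr0n ?ler_nat//; exact: leq_trans ij.
Qed.

(* The shift by 3 makes window a gamma (N_k) exceed (log n)^gamma for all n up to
   exp ((k + 2)^a), where N_k = floor (exp (k^a)). *)
Definition window (R : realType) (a : nat) (gamma : R) (n : nat) : R :=
  (ln n%:R `^ a%:R^-1 + 3) `^ (a%:R * gamma).

Lemma window_homo (R : realType) (a : nat) (gamma : R) : 0 <= gamma ->
  {homo window a gamma : i j / (i <= j)%N >-> i <= j}.
Proof.
move=> g0 i j ij; apply: ge0_ler_powR.
- by rewrite mulr_ge0.
- by rewrite nnegrE addr_ge0 ?powR_ge0.
- by rewrite nnegrE addr_ge0 ?powR_ge0.
- rewrite lerD2r; apply: ge0_ler_powR; rewrite ?nnegrE ?ln_nat_ge0 ?invr_ge0//.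
  exact: ln_nat_homo.
Qed.

(** The ratio is [(1 + 3 / y)^(a * gamma)] with [y = (ln n)^(1 / a)], so the shift disappears in the
    limit and the recurrence hypothesis applies to [window]. *)
Lemma window_equiv (R : realType) (a : nat) (gamma : R) : (0 < a)%N -> 0 < gamma ->
  window a gamma n / ln n%:R `^ gamma @[n --> \oo] --> (1 : R).
Proof.
move=> a0 g0; apply/cvgrPdist_le => e e0.
have ap : 0 < (a%:R : R) by rewrite ltr0n.
have le0 : 0 < ln (1 + e) by rewrite ln_gt0// ltrDl.
have HP : \forall x \near +oo, 0 < x /\ 3 * (a%:R * gamma) / ln (1 + e) <= x `^ a%:R^-1.
  near=> x; split; first by near: x; exact: nbhs_pinfty_gt.
  by near: x; apply: near_powR_ge; rewrite invr_gt0.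
have := near_ln HP; apply: filterS => n; rewrite /window.
set x := ln n%:R; move=> [x0 hy].
set y := x `^ a%:R^-1 in hy *.
have y0 : 0 < y by exact: powR_gt0.
have c0 : 0 < a%:R * gamma by rewrite mulr_gt0.
have -> : x `^ gamma = y `^ (a%:R * gamma).
  by rewrite /y -powRrM mulrA mulVf ?mul1r// gt_eqF.
have yc : 0 < y `^ (a%:R * gamma) by exact: powR_gt0.
have -> : (y + 3) `^ (a%:R * gamma) / y `^ (a%:R * gamma) = (1 + 3 / y) `^ (a%:R * gamma).
  rewrite (_ : y + 3 = (1 + 3 / y) * y); last by field; rewrite gt_eqF.
  by rewrite powRM ?(ltW y0) ?addr_ge0 ?divr_ge0 ?(ltW y0)// mulfK ?gt_eqF.
have b1 : 1 <= (1 + 3 / y) `^ (a%:R * gamma).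
  rewrite [leLHS](_ : 1 = 1 `^ (a%:R * gamma)); last by rewrite powR1.
  apply: ge0_ler_powR; rewrite ?nnegrE ?(ltW c0)//.
    by rewrite addr_ge0// divr_ge0// ltW.
  by rewrite lerDl divr_ge0// ltW.
have b2 : (1 + 3 / y) `^ (a%:R * gamma) <= 1 + e.
  apply: (@le_trans _ _ ((expR (3 / y)) `^ (a%:R * gamma))).
    apply: ge0_ler_powR; rewrite ?nnegrE ?(ltW c0) ?expR_ge0 ?expR_ge1Dx//.
    by rewrite addr_ge0// divr_ge0// ltW.
  rewrite -expRM -[leRHS]lnK ?posrE ?addr_gt0// ler_expR.
  by rewrite ler_pdivrMr// in hy; rewrite mulrAC ler_pdivrMr// [leRHS]mulrC.
by rewrite distrC ger0_norm ?subr_ge0// lerBlDl.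
Unshelve. all: by end_near. Qed.

(** For [a >= 2] consecutive powers are at least [y] apart. One step of [k] thus changes [exp (k^a)]
    by a factor of at least [exp k], enough to absorb any constant. *)
Lemma pow_succ_ge (R : realType) (a : nat) (y : R) : (2 <= a)%N -> 1 <= y ->
  y ^+ a + y <= (y + 1) ^+ a.
Proof.
case: a => [|[|a]]// _ y1.
have y0 : 0 <= y by exact: le_trans ler01 y1.
apply: (@le_trans _ _ ((y + 1) * y ^+ a.+1)).
  rewrite mulrDl mul1r -exprS lerD2l exprS ler_peMr//.
  exact: exprn_ege1.
rewrite [leRHS]exprS ler_wpM2l ?addr_ge0//.
by apply: lerXn2r; rewrite ?nnegrE ?addr_ge0// lerDl.
Qed.

Definition block_time (R : realType) (a k : nat) : nat :=
  Num.truncn (expR ((k%:R : R) ^+ a)).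

(** Rounding costs at most a factor 2, which the step from [k - 1] to [k] in the exponent covers. *)
Lemma block_time_bounds (R : realType) (a k : nat) : (2 <= a)%N -> (2 <= k)%N ->
  [/\ (k <= block_time R a k)%N,
      ((block_time R a k)%:R : R) <= expR (k%:R ^+ a) &
      (k%:R - 1) ^+ a <= ln ((block_time R a k)%:R : R)].
Proof.
move=> a2 k2; rewrite /block_time; set E := expR _.
have k2' : 2%:R <= (k%:R : R) by rewrite ler_nat.
have k1 : 1 <= (k%:R : R) - 1 by lra.
have kk : (k%:R - 1) ^+ a + 1 <= (k%:R : R) ^+ a.
  by have := pow_succ_ge a2 k1; rewrite subrK; lra.
have ka : (k%:R : R) <= k%:R ^+ a.
  by rewrite -[leLHS]expr1; apply: ler_weXn2l; [lra|exact: leq_trans a2].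
have TE : E < (Num.truncn E).+1%:R by exact: truncnS_gt.
have E0 : 0 <= E by exact: expR_ge0.
have kE : k%:R + 1 <= E.
  by apply: le_trans (expR_ge1Dx _); rewrite addrC lerD2l.
have kN : (k <= Num.truncn E)%N.
  by rewrite -ltnS -(ltr_nat R); apply: le_lt_trans TE; lra.
split => //; first by rewrite truncn_le.
have N0 : 0 < ((Num.truncn E)%:R : R) by rewrite ltr0n; apply: leq_trans kN; exact: leq_trans k2.
rewrite -ler_expR lnK ?posrE//.
set w := expR ((k%:R - 1) ^+ a).
have w1 : 1 <= w by rewrite -expR0 ler_expR exprn_ge0//; lra.
have wE : 2 * w <= E.
  apply: (@le_trans _ _ (expR ((k%:R - 1) ^+ a + 1))); last by rewrite ler_expR.
  rewrite expRD mulrC ler_pM2l ?expR_gt0//.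
  by apply: le_trans (expR_ge1Dx _); rewrite -natr1.
by move: TE; rewrite -natr1; lra.
Qed.

(** A point of the ball that comes back to the ball has moved by less than [2 * r]. It is recurrent
    at scale [N] as soon as [2 * r <= N^(-1/d)] and the window at [N] contains all times up to
    [(ln n)^gamma]: [N] must be below [n] by a growing factor, but not by much on the logarithmic
    scale. *)
Lemma near_return (R : realType) (d : nat) (M : riemannianManifold R d)
    (f : borel M -> borel M) (nu : probability (borel M) R)
    (xt : M) (u c r0 gamma : R) (a : nat) (bound : nat -> R) :
  (0 < d)%N -> (2 <= a)%N -> 0 < gamma -> 0 < r0 -> measurable_fun setT f ->
  (\forall k \near \oo, forall r, 0 < r < r0 ->
    (nu (recurrence_set (M := M) f (window a gamma) (block_time R a k) `&` rball xt r) <=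
      (c * (k%:R ^+ 2 * bound (block_time R a k) * r ^+ d))%:E)%E) ->
  \forall n \near \oo, exists k N : nat,
    [/\ k%:R <= ln (n%:R : R) `^ a%:R^-1,
        (ln (n%:R : R) `^ a%:R^-1 - 3) ^+ a <= ln (N%:R : R),
        (k <= N)%N, ln (n%:R : R) `^ a%:R^-1 - 3 <= k%:R &
        n%:R * fine (nu (rball xt (expR (- threshold d u n)) `&`
          return_set f (rball xt (expR (- threshold d u n))) (Num.truncn (ln n%:R `^ gamma)))) <=
          c * expR (- u) * (k%:R ^+ 2 * bound N)].
Proof.
move=> d0 a2 g0 r00 mf [K0 _ HK].
have ap : 0 < (a%:R : R) by rewrite ltr0n; exact: leq_trans a2.
have dp : 0 < (d%:R : R) by rewrite ltr0n.
(* Makes [k] so large that [exp k] exceeds the constant [2^d * exp (- u)] and that the recurrence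
   estimate holds at [k]. *)
pose A := Num.max (ln (2 ^+ d * expR (- u)) : R) K0%:R.
have HP : \forall x \near +oo, 0 < x /\ A + 4 <= x `^ a%:R^-1 /\ 4 <= x `^ a%:R^-1.
  near=> x; split; first by near: x; exact: nbhs_pinfty_gt.
  by split; near: x; apply: near_powR_ge; rewrite invr_gt0.
have n2 := near_radius u d0 (@nbhs_right_lt R 0 r0 r00).
have := near_ln HP; apply: filterS2 n2 => n rr0.
have [->|n0] := posnP n; first by rewrite ln0// ltxx => -[].
set x := ln n%:R; move=> [x0 [yA y4]].
set y := x `^ a%:R^-1 in yA y4 *.
have y0 : 0 <= y by exact: powR_ge0.
have yx : y ^+ a = x.
  by rewrite /y -powR_mulrn ?powR_ge0// -powRrM mulVf ?gt_eqF// powRr1// ltW.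
have [ty1 ty2] : (Num.truncn y)%:R <= y /\ y < (Num.truncn y).+1%:R.
  by split; [rewrite truncn_le|exact: truncnS_gt].
have T3 : (3 < (Num.truncn y).+1)%N by rewrite -(ltr_nat R); apply: le_lt_trans ty2; lra.
(* One below the integer part, so that [k + 1 <= y < k + 2]: the first inequality leaves a factor
   [exp k] between [N] and [n], the second keeps [ln N] above [(y - 3)^a]. *)
pose k := (Num.truncn y).-1.
have kE : (Num.truncn y) = k.+1 by rewrite /k prednK// (leq_trans _ (T3 : (3 <= _)%N)).
have k2 : (2 <= k)%N by rewrite -ltnS -kE.
rewrite kE in ty1 ty2.
have ky : k%:R + 1 <= y by rewrite natr1.
have yk : y < k%:R + 2 by move: ty2; rewrite -natr1 -natr1; lra.
have [kN NE lnN] := @block_time_bounds R a k a2 k2.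
pose N := block_time R a k; rewrite -/N in kN NE lnN.
have lnN' : (y - 3) ^+ a <= ln (N%:R : R).
  by apply: le_trans lnN; apply: lerXn2r; rewrite ?nnegrE; lra.
have kK0 : (K0 <= k)%N.
  rewrite -(ler_nat R); have : K0%:R <= A by rewrite /A le_max lexx orbT.
  by lra.
have kA : ln (2 ^+ d * expR (- u)) <= (k%:R : R).
  have : ln (2 ^+ d * expR (- u)) <= A by rewrite /A le_max lexx.
  by lra.
exists k, N; split => //; [lra|lra|].
set r := expR (- threshold d u n) in rr0 *; pose B := rball xt r; rewrite -/B.
have rp : 0 < r by exact: expR_gt0.
have rd : r ^+ d = expR (- u) / n%:R by exact: threshold_exp.
have Np : 0 < (N%:R : R) by rewrite ltr0n; apply: leq_trans kN; exact: leq_trans k2.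
(* [(2 * r)^d] is the constant [2^d * exp (- u)] times [exp (- y^a)], hence at most
   [exp (k - y^a) <= exp (- k^a) <= 1 / N]. *)
have r2N : 2 * r <= N%:R `^ (- d%:R^-1).
  have h : (2 * r) ^+ d <= (N%:R)^-1.
    rewrite -[leRHS]mul1r ler_pdivlMr// exprMn rd -{1}(exp_ln_nat R n0) -/x -yx.
    rewrite mulrA -expRN.
    have e1 : 2 ^+ d * expR (- u) <= expR (k%:R).
      by rewrite -[leLHS]lnK ?ler_expR// posrE mulr_gt0 ?expR_gt0// exprn_gt0.
    apply: (@le_trans _ _ (expR k%:R * expR (- y ^+ a) * expR (k%:R ^+ a))).
      apply: ler_pM => //; rewrite ?mulr_ge0 ?expR_ge0 ?exprn_ge0//.
      by rewrite ler_wpM2r ?expR_ge0.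
    rewrite -!expRD -[leRHS]expR0 ler_expR.
    have h1 : (k%:R : R) ^+ a + k%:R <= (k%:R + 1) ^+ a.
      by apply: pow_succ_ge => //; rewrite ler1n; exact: leq_trans k2.
    have h2 : (k%:R + 1) ^+ a <= y ^+ a by apply: lerXn2r; rewrite ?nnegrE ?addr_ge0.
    by lra.
  have -> : 2 * r = ((2 * r) ^+ d) `^ d%:R^-1.
    rewrite -powR_mulrn; last by rewrite mulr_ge0// ltW.
    by rewrite -powRrM mulfV ?gt_eqF// powRr1// mulr_ge0// ltW.
  rewrite (_ : - d%:R^-1 = -1 * d%:R^-1); last by rewrite mulN1r.
  rewrite powRrM powR_inv1 ?(ltW Np)//.
  apply: ge0_ler_powR; rewrite ?nnegrE ?invr_ge0 ?(ltW dp) ?(ltW Np)//.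
  by rewrite exprn_ge0// mulr_ge0// ltW.
(* The shift by 3 in the window makes up for [(ln N)^(1/a) >= y - 3]. *)
have tg : x `^ gamma <= window a gamma N.
  rewrite -yx -powR_mulrn// -powRrM; apply: ge0_ler_powR; rewrite ?nnegrE ?addr_ge0 ?powR_ge0//.
    by rewrite mulr_ge0// ltW.
  have : y - 3 <= ln N%:R `^ a%:R^-1.
    have -> : y - 3 = ((y - 3) ^+ a) `^ a%:R^-1.
      rewrite -powR_mulrn; last by lra.
      by rewrite -powRrM mulfV ?gt_eqF// powRr1//; lra.
    apply: ge0_ler_powR; rewrite ?nnegrE ?invr_ge0 ?(ltW ap) ?ln_nat_ge0//.
    by rewrite exprn_ge0//; lra.
  by lra.
have mE : measurable (recurrence_set (M := M) f (window a gamma) N : set (borel M)).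
  exact: measurable_recurrence_set.
have mB : measurable B by exact: measurable_rball.
have sub : B `&` return_set f B (Num.truncn (x `^ gamma)) `<=`
    recurrence_set (M := M) f (window a gamma) N `&` rball xt r.
  move=> z [Bz [j [/andP[j0 jt] Bj]]]; split => //; exists j; split => //.
    apply: le_trans tg; apply: (@le_trans _ _ (Num.truncn (x `^ gamma))%:R).
      by rewrite ler_nat ltnW.
    by rewrite truncn_le// powR_ge0.
  apply/ltW; apply: lt_le_trans (rdist_tri Bz (rdist_lt_sym Bj)) _.
  by rewrite lee_fin; move: r2N; rewrite mulr_natl mulr2n.
have rr : 0 < r < r0 by rewrite rp.
have H := HK k kK0 r rr.
have nn0 : 0 < (n%:R : R) by rewrite ltr0n.
rewrite (_ : c * expR (- u) * _ = n%:R * (c * (k%:R ^+ 2 * bound N * r ^+ d))); last first.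
  by rewrite rd; field; rewrite gt_eqF.
rewrite ler_pM2l// -lee_fin -pr_fin; last first.
  by apply: measurableI => //; exact: measurable_return.
apply: le_trans H; apply: le_mu => //.
- by apply: measurableI => //; exact: measurable_return.
- exact: measurableI.
Unshelve. all: by end_near. Qed.

(** * Rates and the limit law *)

(** The recurrence bound stays abstract so that both cases can share the argument. The constants
    [C0] and [c], and the exceptional set, are fixed before [u], as the limit law demands. *)
Lemma ae_mixing_bound (R : realType) (d : nat) (M : riemannianManifold R d)
    (m : {measure set (borel M) -> \bar R}) (f : borel M -> borel M)
    (nu : probability (borel M) R) (rho : borel M -> R) (delta beta gamma : R)
    (a : nat) (bound : nat -> R) :
  0 < delta -> (0 < d)%N -> is_riemannian_volume m -> measurable_fun setT f ->
  invariant_measure f nu -> supported_on_compact_invariant f nu ->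
  is_density m nu rho -> finite_norm m (1 + delta)%:E rho ->
  0 < beta <= 1 -> stretched_exponential_decay f nu beta ->
  1 < gamma * beta -> (2 <= a)%N ->
  (\forall n \near \oo, 0 < bound n) -> recurrence_bound f nu gamma bound ->
  {ae nu, forall xt : M, exists C0 c : R, [/\ 0 < C0, 0 < c & forall u : R,
    (n%:R * fine (nu (rball xt (expR (- threshold d u n)))) @[n --> \oo] -->
       C0 * expR (- u)) /\
    \forall n \near \oo, exists k N : nat,
      [/\ k%:R <= ln (n%:R : R) `^ a%:R^-1,
        (ln (n%:R : R) `^ a%:R^-1 - 3) ^+ a <= ln (N%:R : R),
        bound N >= 0,
        `|prob_max_le f nu xt u n -
          expR (- (n%:R * fine (nu (rball xt (expR (- threshold d u n))))))| <=
          c * expR (- u) * (k%:R ^+ 2 * bound N) + expR (- (ln n%:R / 4)) &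
        `|G_sqrt nu xt u n -
          expR (- (n%:R * fine (nu (rball xt (expR (- threshold d u n))))))| <=
          expR (- (ln n%:R / 4))]]}.
Proof.
move=> dl0 d0 [lam lebl hm] mf inv supp den fn /andP[b0 b1] sed gb a2 bpos rec.
have hm' : chart_volume lam m by exact: hm.
have g0 : 0 < gamma by rewrite -(pmulr_lgt0 _ b0); exact: lt_trans gb.
have [theta0 [Th [th01 Thm Thc ThO cd]]] := sed.
(* A decreasing sequence tending to 0 is nonnegative. *)
have Th0 t : 0 <= Th t.
  have nTh : nonincreasing_seq Th by move=> i j ij; exact: Thm.
  have cTh : cvgn Th by apply/cvg_ex; exists 0.
  by have := nonincreasing_cvgn_ge nTh cTh t; rewrite (cvg_lim _ Thc).
have a0 : (0 < a)%N by exact: leq_trans a2.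
pose E k := recurrence_set (M := M) f (window a gamma) (block_time R a k).
have mE k : measurable (E k : set (borel M)) by exact: measurable_recurrence_set.
have := rec _ (window_homo a (ltW g0)) (window_equiv a0 g0) => recb.
have [K1 _ HK1] := bpos.
have nb : \forall k \near \oo, 0 < bound (block_time R a k) /\
    (nu (E k) <= (bound (block_time R a k))%:E)%E.
  have [K2 _ HK2] := recb.
  exists (maxn (maxn K1 K2) 2) => // k /=; rewrite !geq_max => /andP[/andP[k1 k2] k3].
  have [kN _ _] := @block_time_bounds R a k a2 k3.
  by split; [apply: HK1; exact: leq_trans kN|apply: HK2; exact: leq_trans kN].
have A1 := ae_local supp (fun x0 => local_density x0 lebl hm' den).
have A2 := ae_local supp (fun x0 => local_recurrence x0 lebl hm' den mE nb).
apply: filterS2 A1 A2 => xt [C0 C00 cC] [c [r0 [c0 r00 Hrec]]].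
exists C0, c; split => // u; split; first exact: near_mass.
have [c1 [r1 [c10 r10 Hann]]] := annulus_volume xt lebl hm'.
have [J J0 HJ] := density_tail dl0 den fn.
(* Any exponent strictly between 1 and [gamma * beta] serves both the annulus and the decorrelation;
   this is the midpoint. *)
pose s := (1 + gamma * beta) / 2.
have s1 : 1 < s by rewrite /s ltr_pdivlMr//; lra.
have sgb : s < gamma * beta by rewrite /s ltr_pdivrMr//; lra.
have nA := near_annulus u d0 dl0 s1 c10 r10 J0 Hann HJ.
have nD := near_decorrelation th01 b0 g0 s1 sgb ThO.
have nP := near_poisson_bound d0 g0 cd mf inv Th0 cC nA nD.
have nR := near_return u d0 a2 g0 r00 mf Hrec.
have HP : \forall x \near +oo, K1%:R + 3 <= (x : R) `^ a%:R^-1.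
  by apply: near_powR_ge; rewrite invr_gt0 ltr0n.
have := near_ln HP.
apply: filterS3 nP nR => n /= [p1 p2] [k [N [k1 k2 kN k3 k4]]] hy.
exists k, N; split => //.
- apply/ltW/HK1; apply: leq_trans kN; rewrite -(ler_nat R); lra.
- by apply: le_trans p1 _; rewrite lerD2r.
Unshelve. all: by end_near. Qed.

Lemma ae_mono (d : measure_display) (T : measurableType d) (R : realType)
    (mu : {measure set T -> \bar R}) (P Q : T -> Prop) :
  (forall x, P x -> Q x) -> {ae mu, forall x, P x} -> {ae mu, forall x, Q x}.
Proof. by move=> PQ; apply: negligibleS => x /= nQ Px; exact/nQ/PQ. Qed.

Lemma near_gumbel (R : realType) (P b : nat -> R) (h : R -> R) (L : R) :
  (\forall n \near \oo, `|P n - expR (- b n)| <= h (ln n%:R)) ->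
  (forall e : R, 0 < e -> \forall x \near +oo, h x <= e) ->
  b @ \oo --> L -> P @ \oo --> expR (- L).
Proof.
move=> HP hh bL.
have cE : expR (- b n) @[n --> \oo] --> expR (- L).
  apply: (@cvg_comp _ _ _ (fun n => - b n) (@expR R) \oo (nbhs (- L))); first exact: cvgN.
  exact: continuous_expR.
apply/cvgrPdist_le => e e0.
have e2 : 0 < e / 2 by rewrite divr_gt0.
have n1 : \forall n \near \oo, `|expR (- L) - expR (- b n)| <= e / 2.
  by move/cvgrPdist_le : cE; apply.
have n2 := near_ln (hh _ e2).
apply: filterS3 HP n1 n2 => n h1 h2 h3.
apply: le_trans (ler_distD (expR (- b n)) _ _) _.
rewrite (splitr e); apply: lerD => //; rewrite distrC; exact: le_trans h3.
Qed.

Lemma near_exp_opp_powR (R : realType) (e p : R) : 0 < e -> 0 < p ->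
  \forall x \near +oo, expR (- (x `^ p)) <= e.
Proof.
move=> e0 p0; have := near_powR_ge (- ln e) p0; apply: filterS => x h.
by rewrite -[leRHS]lnK ?posrE// ler_expR lerNl.
Qed.

Lemma near_comp_powR (R : realType) (p : R) (P : R -> Prop) : 0 < p ->
  (\forall x \near +oo, P x) -> \forall x \near +oo, P (x `^ p).
Proof.
move=> p0 [A [_ HA]]; have := near_powR_ge (A + 1) p0.
apply: filterS => x h; apply: HA; apply: lt_le_trans h; by rewrite ltrDl.
Qed.

(** From 6 on, subtracting 3 at most halves the root; hence [ln N] is at least a fixed fraction of
    [ln n]. *)
Lemma powR_root_half (R : realType) (a : nat) (x y : R) : (0 < a)%N -> 0 <= x ->
  6 <= x `^ a%:R^-1 -> (x `^ a%:R^-1 - 3) ^+ a <= y -> (2^-1 ^+ a) * x <= y.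
Proof.
move=> a0 x0 h; apply: le_trans.
rewrite [X in _ * X](_ : x = (x `^ a%:R^-1) ^+ a); last first.
  by rewrite -powR_mulrn ?powR_ge0// -powRrM mulVf ?powRr1// pnatr_eq0 -lt0n//.
rewrite -exprMn; apply: lerXn2r; rewrite ?nnegrE ?mulr_ge0 ?powR_ge0//; last by lra.
lra.
Qed.

Lemma polynomial_rate (R : realType) (d : nat) (M : riemannianManifold R d)
    (m : {measure set (borel M) -> \bar R}) (f : borel M -> borel M)
    (nu : probability (borel M) R) (rho : borel M -> R) (delta beta gamma alpha C : R) :
  0 < delta -> (0 < d)%N -> is_riemannian_volume m -> measurable_fun setT f ->
  invariant_measure f nu -> supported_on_compact_invariant f nu ->
  is_density m nu rho -> finite_norm m (1 + delta)%:E rho ->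
  0 < beta <= 1 -> stretched_exponential_decay f nu beta ->
  1 < gamma * beta -> 0 < alpha -> 0 < C ->
  recurrence_bound f nu gamma (fun n => C * ln n%:R `^ (- alpha)) ->
  {ae nu, forall xt : M, forall (u kappa : R), 1 <= kappa ->
     exists2 C1 : R, 0 < C1 &
     \forall n \near \oo,
       `| prob_max_le f nu xt u n - G_sqrt nu xt u n | <= C1 / ln n%:R `^ (alpha - kappa)} /\
  gumbel_limit f nu.
Proof.
move=> dl0 d0 vol mf inv supp den fn b01 sed gb al0 C0 rec.
(* The loss is [(ln n)^(2 / a)]. [a >= 2] keeps its exponent at most 1, hence at most [kappa];
   [a > 2 / alpha] keeps it below [alpha], so that the error vanishes in the limit law. *)
pose a := maxn 2 (Num.truncn (2 / alpha)).+1.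
have a2 : (2 <= a)%N by rewrite leq_maxl.
have a0 : (0 < a)%N by exact: leq_trans a2.
have ap : 0 < (a%:R : R) by rewrite ltr0n.
have a1 : 2 / a%:R <= (1 : R) by rewrite ler_pdivrMr// mul1r (ler_nat R 2).
have aal : 2 / a%:R < alpha.
  rewrite ltr_pdivrMr// mulrC -ltr_pdivrMr//; apply: lt_le_trans (truncnS_gt _) _.
  by rewrite ler_nat leq_maxr.
have bpos : \forall n \near \oo, 0 < C * ln (n%:R : R) `^ (- alpha).
  have := near_ln (@nbhs_pinfty_gt R 0 (num_real _)); apply: filterS => n h.
  by rewrite mulr_gt0// powR_gt0.
have H := ae_mixing_bound dl0 d0 vol mf inv supp den fn b01 sed gb a2 bpos rec.
pose D := C * (2^-1 ^+ a) `^ (- alpha).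
have D0 : 0 < D by rewrite mulr_gt0// powR_gt0// exprn_gt0// invr_gt0.
have HP : \forall x \near +oo, 1 <= (x : R) /\ 6 <= (x : R) `^ a%:R^-1.
  near=> x; split; first by near: x; exact: nbhs_pinfty_ge.
  by near: x; apply: near_powR_ge; rewrite invr_gt0.
have key (n k N : nat) : 1 <= ln (n%:R : R) -> 6 <= ln (n%:R : R) `^ a%:R^-1 ->
    k%:R <= ln (n%:R : R) `^ a%:R^-1 ->
    (ln (n%:R : R) `^ a%:R^-1 - 3) ^+ a <= ln (N%:R : R) ->
    k%:R ^+ 2 * (C * ln (N%:R : R) `^ (- alpha)) <= D * ln (n%:R : R) `^ (2 / a%:R - alpha).
  set x := ln n%:R => x1 y6 ky yN.
  have x0 : 0 < x by exact: lt_le_trans x1.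
  have h1 := powR_root_half a0 (ltW x0) y6 yN.
  have c0 : 0 < 2^-1 ^+ a * x by rewrite mulr_gt0// exprn_gt0// invr_gt0.
  have h2 : ln (N%:R : R) `^ (- alpha) <= (2^-1 ^+ a * x) `^ (- alpha).
    rewrite !powRN lef_pV2 ?posrE ?powR_gt0//; last exact: lt_le_trans h1.
    by apply: ge0_ler_powR; rewrite ?nnegrE ?(ltW al0) ?(ltW c0) ?ln_nat_ge0.
  have h3 : k%:R ^+ 2 <= x `^ (2 / a%:R).
    rewrite mulrC powRrM (_ : (2 : R) = 2%:R)// powR_mulrn ?powR_ge0//.
    by apply: lerXn2r; rewrite ?nnegrE ?powR_ge0.
  apply: (@le_trans _ _ (x `^ (2 / a%:R) * (C * (2^-1 ^+ a * x) `^ (- alpha)))).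
    apply: ler_pM => //; rewrite ?exprn_ge0// ?mulr_ge0 ?powR_ge0 ?(ltW C0)//.
    by rewrite ler_pM2l.
  rewrite powRM ?exprn_ge0 ?invr_ge0 ?(ltW x0)// powRD; last by rewrite (gt_eqF x0) implybT.
  by rewrite /D le_eqVlt; apply/orP; left; apply/eqP; ring.
split.
- move: H; apply: ae_mono => xt [K0 [c [K00 c0 Hu]]] u kappa k1.
  have [_ Hn] := Hu u.
  have cu0 : 0 < c * expR (- u) * D by rewrite !mulr_gt0// expR_gt0.
  exists (c * expR (- u) * D + 1); first by rewrite addr_gt0.
  have HQ : \forall x \near +oo, 2 <= expR (8^-1 * x) /\ (x : R) `^ (alpha - kappa) <= expR (8^-1 * x).
    near=> x; split; near: x; [apply: near_exp_ge|apply: near_powR_le_exp]; by rewrite invr_gt0.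
  have n1 := near_ln HP; have n2 := near_ln HQ.
  apply: filterS3 Hn n1 n2 => n [k [N [ky yN bN hP hG]]] [x1 y6] [q1 q2].
  have x0 : 0 < ln (n%:R : R) by exact: lt_le_trans x1.
  have hk := key n k N x1 y6 ky yN.
  have rate : ln (n%:R : R) `^ (2 / a%:R - alpha) <= (ln n%:R `^ (alpha - kappa))^-1.
    rewrite -powRN; apply: ler_powR => //; lra.
  have small : 2 * expR (- (ln (n%:R : R) / 4)) <= (ln n%:R `^ (alpha - kappa))^-1.
    rewrite -[leRHS]mul1r ler_pdivlMr ?powR_gt0//.
    apply: (@le_trans _ _ (expR (8^-1 * ln n%:R) * expR (- (ln n%:R / 4)) * expR (8^-1 * ln n%:R))).
      apply: ler_pM => //; rewrite ?mulr_ge0 ?expR_ge0 ?powR_ge0//.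
      by rewrite ler_pM2r ?expR_gt0.
    by rewrite -!expRD -[leRHS]expR0 ler_expR le_eqVlt; apply/orP; left; apply/eqP; field.
  set E := expR (- (n%:R * _)) in hP hG.
  apply: le_trans (ler_distD E _ _) _; rewrite (distrC E).
  apply: le_trans (lerD hP hG) _.
  have h1 : c * expR (- u) * (k%:R ^+ 2 * (C * ln (N%:R : R) `^ (- alpha))) <=
      c * expR (- u) * D * (ln n%:R `^ (alpha - kappa))^-1.
    rewrite -[leRHS]mulrA ler_pM2l ?mulr_gt0 ?expR_gt0//; apply: le_trans hk _.
    by rewrite ler_pM2l.
  rewrite mulrDl mul1r; lra.
- move: H; apply: ae_mono => xt [K0 [c [K00 c0 Hu]]]; exists K0 => // u.
  have [cM Hn] := Hu u.
  have cu0 : 0 < c * expR (- u) * D by rewrite !mulr_gt0// expR_gt0.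
  apply: (@near_gumbel R _ _ (fun x => c * expR (- u) * D * x `^ (2 / a%:R - alpha) + expR (- (x / 4))) _ _ _ cM).
    have n1 := near_ln HP.
    apply: filterS2 Hn n1 => n [k [N [ky yN bN hP hG]]] [x1 y6].
    apply: le_trans hP _; rewrite lerD2r -[leRHS]mulrA ler_pM2l ?mulr_gt0 ?expR_gt0//.
    exact: key.
  move=> e e0; near=> x.
  have x0 : 0 < x by near: x; exact: nbhs_pinfty_gt.
  rewrite (splitr e); apply: lerD.
    rewrite (_ : 2 / a%:R - alpha = - (alpha - 2 / a%:R)); last by ring.
    rewrite powRN ler_pdivrMr ?powR_gt0// -ler_pdivrMl ?divr_gt0//.
    by near: x; apply: near_powR_ge; rewrite subr_gt0.
  rewrite expRN -[leRHS]invrK lef_pV2 ?posrE ?expR_gt0 ?invr_gt0 ?divr_gt0//.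
  by rewrite [x / 4]mulrC; near: x; apply: near_exp_ge; rewrite invr_gt0.
Unshelve. all: by end_near. Qed.

(** Here [a = 2] suffices: the loss [k^2 <= ln n] is negligible against [exp (- c' * (ln n)^alpha)].
    Halving [alpha] leaves room for all constants, including [exp (- u)]. *)
Lemma stretched_rate (R : realType) (d : nat) (M : riemannianManifold R d)
    (m : {measure set (borel M) -> \bar R}) (f : borel M -> borel M)
    (nu : probability (borel M) R) (rho : borel M -> R) (delta beta gamma alpha C : R) :
  0 < delta -> (0 < d)%N -> is_riemannian_volume m -> measurable_fun setT f ->
  invariant_measure f nu -> supported_on_compact_invariant f nu ->
  is_density m nu rho -> finite_norm m (1 + delta)%:E rho ->
  0 < beta <= 1 -> stretched_exponential_decay f nu beta ->
  1 < gamma * beta -> 0 < alpha < 1 -> 0 < C ->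
  recurrence_bound f nu gamma (fun n => C * expR (- (ln n%:R `^ alpha))) ->
  {ae nu, forall xt : M, forall u : R, exists2 C1 : R, 0 < C1 &
     \forall n \near \oo,
       `| prob_max_le f nu xt u n - G_sqrt nu xt u n | <=
       C1 * expR (- (ln n%:R `^ (alpha / 2)))} /\
  gumbel_limit f nu.
Proof.
move=> dl0 d0 vol mf inv supp den fn b01 sed gb /andP[al0 al1] C0 rec.
have bpos : \forall n \near \oo, 0 < C * expR (- (ln (n%:R : R) `^ alpha)).
  by apply: nearW => n; rewrite mulr_gt0// expR_gt0.
have H := ae_mixing_bound dl0 d0 vol mf inv supp den fn b01 sed gb (leqnn 2) bpos rec.
(* From [ln N >= ln n / 4], see [powR_root_half]. *)
pose c' : R := (2^-1 ^+ 2) `^ alpha.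
have c'0 : 0 < c' by rewrite powR_gt0// exprn_gt0// invr_gt0.
have al2 : 0 < alpha / 2 by rewrite divr_gt0.
have step (c u : R) : 0 < c -> \forall n \near \oo, forall k N : nat,
    k%:R <= ln (n%:R : R) `^ 2%:R^-1 ->
    (ln (n%:R : R) `^ 2%:R^-1 - 3) ^+ 2 <= ln (N%:R : R) ->
    c * expR (- u) * (k%:R ^+ 2 * (C * expR (- (ln (N%:R : R) `^ alpha)))) <=
      expR (- (ln (n%:R : R) `^ (alpha / 2))) /\
    expR (- (ln (n%:R : R) / 4)) <= expR (- (ln (n%:R : R) `^ (alpha / 2))).
  move=> c0; pose A := c * expR (- u) * C.
  have A0 : 0 < A by rewrite !mulr_gt0// expR_gt0.
  have HP : \forall x \near +oo, [/\ 1 <= (x : R), 6 <= (x : R) `^ 2%:R^-1,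
      A <= expR (c' / 4 * x `^ alpha), (x `^ alpha) `^ alpha^-1 <= expR (c' / 4 * x `^ alpha) &
      1 * x `^ (alpha / 2) <= c' / 2 * x `^ alpha /\ 1 * x `^ (alpha / 2) <= 4^-1 * x `^ 1].
    near=> x; split; last split.
    - by near: x; exact: nbhs_pinfty_ge.
    - by near: x; apply: near_powR_ge; rewrite invr_gt0.
    - near: x; apply: (near_comp_powR (P := fun z => A <= expR (c' / 4 * z))) => //.
      by apply: near_exp_ge; rewrite divr_gt0.
    - near: x; apply: (near_comp_powR (P := fun z => z `^ alpha^-1 <= expR (c' / 4 * z))) => //.
      by apply: near_powR_le_exp; rewrite divr_gt0.
    - near: x; apply: near_powR_dominates; first by rewrite divr_gt0.
      by rewrite ltr_pdivrMr//; lra.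
    - near: x; apply: near_powR_dominates; first by rewrite invr_gt0.
      by rewrite ltr_pdivrMr//; lra.
  have := near_ln HP; apply: filterS => n; set x := ln n%:R.
  move=> [x1 y6 hA hx [d1 d2]] k N ky yN.
  have x0 : 0 < x by exact: lt_le_trans x1.
  rewrite !mul1r powRr1 ?(ltW x0)// in d1 d2.
  rewrite -powRrM mulfV ?gt_eqF// powRr1 ?(ltW x0)// in hx.
  have h1 := powR_root_half (ltn0Sn 1) (ltW x0) y6 yN.
  have q0 : 0 <= 2^-1 ^+ 2 * x by rewrite mulr_ge0 ?exprn_ge0 ?invr_ge0// ltW.
  have h2 : c' * x `^ alpha <= ln (N%:R : R) `^ alpha.
    rewrite /c' -powRM ?exprn_ge0 ?invr_ge0 ?(ltW x0)//.
    by apply: ge0_ler_powR; rewrite ?nnegrE ?(ltW al0) ?ln_nat_ge0.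
  have h3 : k%:R ^+ 2 <= x.
    have -> : x = (x `^ 2%:R^-1) ^+ 2.
      by rewrite -powR_mulrn ?powR_ge0// -powRrM mulVf ?powRr1// ltW.
    by apply: lerXn2r; rewrite ?nnegrE ?powR_ge0.
  split; last by rewrite ler_expR lerN2 [x / 4]mulrC.
  rewrite (_ : _ * _ = A * k%:R ^+ 2 * expR (- (ln (N%:R : R) `^ alpha))); last by rewrite /A; ring.
  (* A quarter of the decay pays for the constant [A] and a quarter for [k^2]; the remaining half
     exceeds [x^(alpha / 2)]. *)
  apply: (@le_trans _ _ (expR (c' / 4 * x `^ alpha) * expR (c' / 4 * x `^ alpha) * expR (- (c' * x `^ alpha)))).
    apply: ler_pM.
    - by apply: mulr_ge0; [exact: ltW|exact: exprn_ge0].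
    - exact: expR_ge0.
    - by apply: ler_pM => //; [exact: ltW|exact: le_trans hx].
    - by rewrite ler_expR lerN2.
  by rewrite -!expRD ler_expR; lra.
split.
- move: H; apply: ae_mono => xt [K0 [c [K00 c0 Hu]]] u.
  have [_ Hn] := Hu u.
  (* One unit for the early returns and one for each of the two errors [n^(-1/4)]. *)
  have Hstep := step c u c0; exists 3; first by [].
  apply: filterS2 Hn Hstep => n [k [N [ky yN bN hP hG]]] Hs.
  have [s1 s2] := Hs k N ky yN.
  set E := expR (- (n%:R * _)) in hP hG.
  apply: le_trans (ler_distD E _ _) _; rewrite (distrC E).
  apply: le_trans (lerD hP hG) _; apply: le_trans (lerD (lerD s1 s2) s2) _.
  by rewrite mulr_natl -mulr2n -mulrSr.
- move: H; apply: ae_mono => xt [K0 [c [K00 c0 Hu]]]; exists K0 => // u.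
  have [cM Hn] := Hu u.
  apply: (@near_gumbel R _ _ (fun x => 2 * expR (- (x `^ (alpha / 2)))) _ _ _ cM).
    apply: filterS2 Hn (step c u c0) => n [k [N [ky yN bN hP hG]]] Hs.
    have [s1 s2] := Hs k N ky yN.
    have w2 (w : R) : 2 * w = w + w by rewrite mulr_natl mulr2n.
    rewrite w2; exact: le_trans hP (lerD s1 s2).
  move=> e e0; have e2 : 0 < e / 2 by rewrite divr_gt0.
  have := near_exp_opp_powR e2 al2; apply: filterS => x h; lra.
Unshelve. all: by end_near. Qed.
Theorem theorem2p1 (R : realType) (delta : R) (delta_gt0 : 0 < delta) :
  exists2 C2 : R, 0 < C2 &
  forall (d : nat) (M : riemannianManifold R d)
    (m : {measure set (borel M) -> \bar R})
    (f : borel M -> borel M) (nu : probability (borel M) R)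
    (rho : borel M -> R),
    (0 < d)%N ->
    is_riemannian_volume m ->
    measurable_fun setT f ->
    invariant_measure f nu ->
    supported_on_compact_invariant f nu ->
    nonuniformly_expanding m f nu ->
    is_ergodic f nu ->
    is_density m nu rho ->
    finite_norm m (1 + delta)%:E rho ->
    (forall beta gamma alpha C : R,
       0 < beta <= 1 ->
       stretched_exponential_decay f nu beta ->
       1 < gamma -> 0 < alpha -> 0 < C ->
       recurrence_bound f nu gamma (fun n => C * ln n%:R `^ (- alpha)) ->
       1 < gamma * beta ->
       (forall u : R,
          {ae nu, forall xt : M, forall kappa : R, C2 / beta < kappa ->
             exists2 C1 : R, 0 < C1 &
             \forall n \near \oo,
               `| prob_max_le f nu xt u n - G_sqrt nu xt u n |
               <= C1 / ln n%:R `^ (alpha - kappa)}) /\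
       gumbel_limit f nu) /\
    (forall beta gamma alpha C : R,
       0 < beta <= 1 ->
       stretched_exponential_decay f nu beta ->
       1 < gamma -> 0 < alpha < 1 -> 0 < C ->
       recurrence_bound f nu gamma
         (fun n => C * expR (- (ln n%:R `^ alpha))) ->
       1 < gamma * beta ->
       (forall u : R,
          exists2 alphat : R, 0 < alphat &
          {ae nu, forall xt : M,
             exists2 C1 : R, 0 < C1 &
             \forall n \near \oo,
               `| prob_max_le f nu xt u n - G_sqrt nu xt u n |
               <= C1 * expR (- (ln n%:R `^ alphat))}) /\
       gumbel_limit f nu).
Proof.
(* As [beta <= 1], [1 / beta < kappa] forces [1 <= kappa], which covers the loss [(log n)^(2 / a)]
   of [polynomial_rate]. *)
exists 1 => // d M m f nu rho d0 vol mf inv supp _ _ den fn; split.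
- move=> beta gamma alpha C b01 sed _ al0 C0 rec gb.
  have [H gum] := polynomial_rate delta_gt0 d0 vol mf inv supp den fn b01 sed gb al0 C0 rec.
  split => // u; apply: ae_mono H => xt Hxt kappa bk; apply: Hxt.
  have /andP[b0 b1] := b01; apply/ltW; apply: le_lt_trans bk.
  by rewrite ler_pdivlMr// mul1r.
- move=> beta gamma alpha C b01 sed _ al01 C0 rec gb.
  have [H gum] := stretched_rate delta_gt0 d0 vol mf inv supp den fn b01 sed gb al01 C0 rec.
  have /andP[al0 _] := al01.
  split => // u; exists (alpha / 2); first by rewrite divr_gt0.
  by apply: ae_mono H => xt Hxt; exact: Hxt.
Qed.
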